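(* Let $\beta$ be a Liouville number and let $f:\mathbb{T}\to\mathbb{R}_{>0}$ be a real analytic function such that the special flow $T^f_\beta$ is weak mixing. Then there is a dense $G_\delta$ set of $\alpha$ such that the special flow $T^f_\alpha$ is weak mixing and is spectrally orthogonal to $T^f_\beta$.
   Context: $\mathbb{T}=\mathbb{R}/\mathbb{Z}$. For irrational $\gamma$ and a strictly positive integrable roof function $f$ on $\mathbb{T}$, the special flow $T^f_\gamma=(T^f_{\gamma,t})_{t\in\mathbb{R}}$ over the rotation $R_\gamma(x)=x+\gamma$ is the unit-speed vertical flow on $\{(x,y): x\in\mathbb{T},\ 0\le y<f(x)\}$ in which each point $(x,f(x))$ is identified with $(x+\gamma,0)$; explicitly, $T^f_{\gamma,t}(x,r)=(x+n\gamma,\ r+t-S_n(f)(x))$, where $S_n(f)(x)=\sum_{0\le i<n}f(x+i\gamma)$ for $n>0$, $S_0=0$, $S_n(f)(x)=\sum_{n\le i<0}f(x+i\gamma)$ for $n<0$, and $n\in\mathbb{Z}$ is the unique integer with $S_n(f)(x)\le r+t<S_{n+1}(f)(x)$. It preserves the normalized restriction of Lebesgue measure. A Liouville number is an irrational $x$ such that for every positive integer $n$ there are positive integers $p,q$ with $0<|x-p/q|<q^{-n}$. Two measure-preserving flows are spectrally orthogonal if the maximal spectral types of their Koopman representations on $L^2$ are mutually singular.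
   Formalization: Spectral orthogonality is taken on zero-mean (real) L^2 functions, since on all of L^2 the constants give both flows a common atom at 0; and S_n(f) for n<0 carries the minus sign needed for the flow to be well defined. *)

(* Defs.v *)
From HB Require Import structures.
From mathcomp Require Import all_boot all_order all_algebra.
From mathcomp Require Import all_classical all_reals all_analysis.
From mathcomp Require Import borel_hierarchy.
Set Implicit Arguments. Unset Strict Implicit. Unset Printing Implicit Defensive.
Import Order.TTheory GRing.Theory Num.Theory.
Import numFieldNormedType.Exports.
Local Open Scope classical_set_scope.
Local Open Scope ring_scope.

Section Defs.
Variable R : realType.

Definition liouville (x : R) : Prop :=
  irrational x /\
  forall n : nat, (0 < n)%N ->
    exists p q : nat, [/\ (0 < p)%N, (0 < q)%N &
      0 < `|x - p%:R / q%:R| < (q%:R : R) ^- n].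

Definition real_analytic (f : R -> R) : Prop :=
  forall x0 : R, exists r : R, 0 < r /\ exists a : nat -> R,
    forall x : R, `|x - x0| < r ->
      series (fun k => a k * (x - x0) ^+ k) @ \oo --> f x.

(** A roof function on T = R/Z, seen as a 1-periodic function on R. *)
Definition periodic1 (f : R -> R) : Prop := forall x, f (x + 1) = f x.

Definition frac (x : R) : R := x - (Num.floor x)%:~R.

Definition birkhoff (gam : R) (f : R -> R) (n : int) (x : R) : R :=
  match n with
  | Posz m => \sum_(0 <= i < m) f (x + i%:R * gam)
  | Negz m => - \sum_(0 <= i < m.+1) f (x - i.+1%:R * gam)
  end.

Definition phase (f : R -> R) : set (R * R) :=
  [set p | (0 <= p.1 < 1) /\ (0 <= p.2 < f p.1)].

Definition flow_n (gam : R) (f : R -> R) (t : R) (p : R * R) : int :=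
  xget 0%Z [set n : int | birkhoff gam f n p.1 <= p.2 + t < birkhoff gam f (n + 1) p.1].

Definition sflow (gam : R) (f : R -> R) (t : R) (p : R * R) : R * R :=
  let n := flow_n gam f t p in
  (frac (p.1 + n%:~R * gam), p.2 + t - birkhoff gam f n p.1).

Definition leb2 := ((@lebesgue_measure R) \x (@lebesgue_measure R))%E.

Definition nmu (f : R -> R) (A : set (R * R)) : R :=
  fine (leb2 (A `&` phase f)) / fine (leb2 (phase f)).

Definition weak_mixing (gam : R) (f : R -> R) : Prop :=
  forall A B : set (R * R), measurable A -> measurable B ->
    A `<=` phase f -> B `<=` phase f ->
    (fun T : R => T^-1 * Rintegral (@lebesgue_measure R) `[0, T]
        (fun t => `| nmu f [set p | B p /\ A (sflow gam f t p)]
                     - nmu f A * nmu f B |)) x @[x --> +oo] --> 0.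

Definition L2_0 (f : R -> R) (g : R * R -> R) : Prop :=
  [/\ measurable_fun (phase f) g,
      leb2.-integrable (phase f) (fun p => (g p ^+ 2)%:E) &
      Rintegral leb2 (phase f) g = 0].

Definition corr (gam : R) (f : R -> R) (g : R * R -> R) (t : R) : R :=
  Rintegral leb2 (phase f) (fun p => g (sflow gam f t p) * g p)
  / fine (leb2 (phase f)).

(** sigma is the spectral measure of g: a finite Borel measure on R
    whose Fourier transform is t |-> <U_t g, g>. For real g this
    means: cosine transform = corr and sine transform = 0. *)
Definition spectral_measure (gam : R) (f : R -> R) (g : R * R -> R)
    (sigma : {measure set R -> \bar R}) : Prop :=
  (sigma setT < +oo)%E /\
  forall t : R,
    (\int[sigma]_x (cos (t * x))%:E = (corr gam f g t)%:E)%E /\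
    (\int[sigma]_x (sin (t * x))%:E = 0)%E.

Definition mutually_singular (mu nu : {measure set R -> \bar R}) : Prop :=
  exists A : set R, [/\ measurable A, mu A = 0%E & nu (~` A) = 0%E].

(** Spectral orthogonality: the maximal spectral types (on L^2_0) are
    mutually singular, i.e. every spectral measure of the first flow is
    singular to every spectral measure of the second one. *)
Definition spectrally_orthogonal (gam1 : R) (f1 : R -> R)
    (gam2 : R) (f2 : R -> R) : Prop :=
  forall (g1 g2 : R * R -> R), L2_0 f1 g1 -> L2_0 f2 g2 ->
  forall sigma1 sigma2 : {measure set R -> \bar R},
    spectral_measure gam1 f1 g1 sigma1 ->
    spectral_measure gam2 f2 g2 sigma2 ->
    mutually_singular sigma1 sigma2.

End Defs.

(* Main.v *)
(* The set is cut out by Baire category from two kinds of open conditions on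
   [alpha], indexed by finitely many test functions and an error.  In the first,
   some time almost decorrelates the test functions under the flow of [alpha];
   times of this kind yield nearly orthogonal translates of any function of mean
   zero, hence weak mixing.  In the second, some time moves the test functions
   very little under the flow of [alpha] while it almost decorrelates them under
   the flow of [beta]; along such times [t_j], the averages of [cos (t_j x)] tend
   to 1 for the spectral measures of the first flow and to 0 for those of the
   second, which makes these measures mutually singular.

   Both conditions are dense because of what happens at a rational angle [p / q],
   where every point of the base is periodic, with return time
   [rho(x) = \sum_(j < q) f(x + j / q)].  As [rho] is within [O(1 / q)] of
   [q * \int f], the time [q * \int f] is almost a period of the whole flow, and
   among the multiples of such a time there is one that decorrelates the weakly
   mixing flow of [beta].  On the other hand, if [rho] is not constant, then by
   analyticity its derivative is almost nowhere zero, so that the flow shears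
   nearby periodic orbits and, as time grows, equidistributes each short arc of
   the base along orbits that are themselves nearly equidistributed for large
   [q].  Finally [rho] is nonconstant for infinitely many [q]: otherwise [f] is a
   trigonometric polynomial, so it is cohomologous to a constant over the rotation
   by [beta], and the flow of [beta] has a nontrivial eigenfunction. *)
Require Import Defs.
From HB Require Import structures.
From mathcomp Require Import all_boot all_order all_algebra.
From mathcomp Require Import all_classical all_reals all_analysis.
From mathcomp Require Import borel_hierarchy measurable_realfun.
From mathcomp Require Import ring lra zify.
Import Order.TTheory GRing.Theory Num.Theory.
Import numFieldNormedType.Exports.
Import Defs.
Local Open Scope classical_set_scope.
Local Open Scope ring_scope.
Set Implicit Arguments. Unset Strict Implicit. Unset Printing Implicit Defensive.

(** * Real analytic functions *)

(** Weak mixing concerns averages over all large times, and orthogonality concerns all pairs of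
    spectral measures; neither is visibly an intersection of open conditions on the angle. Each is
    replaced by the existence of suitable times for the first [n] of countably many test functions.
    These vanish on the base and at the roof, so their lifts to the plane depend continuously on the
    angle, and a strict inequality at a fixed time is an open condition. For the rigid times, one
    time must serve two flows. The angle [p / k] with [k = s r m + 1] and [p = r^2 m] is close to a
    prescribed [r / s], and its almost period [k * \int f] runs through an arithmetic progression as
    [m] varies; a uniformly continuous function with vanishing averages is small somewhere far along
    any such progression. For the mixing times, the denominator must be large and must divide a
    frequency present in [f]. Fractions whose denominator is a very high frequency, taken near an
    irrational point, meet both requirements once reduced to lowest terms. *)

Section PowerSeries.
Context {R : realType}.
Implicit Types (a : nat -> R) (x y z r : R).

Lemma geom_term_le (s : R) n : 0 <= s < 1 -> n.+1%:R * s ^+ n <= (1 - s)^-1.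
Proof.
move=> /andP[s0 s1]; rewrite -[leRHS]div1r ler_pdivlMr ?subr_gt0//.
elim: n => [|n IH]; first by rewrite expr0 !mul1r lerBlDr lerDl.
(* After multiplication by [1 - s], each term is [s] times the previous one plus at most [1 - s], so
   the bound [1] persists. *)
have -> : n.+2%:R * s ^+ n.+1 * (1 - s) =
    s * (n.+1%:R * s ^+ n * (1 - s)) + s ^+ n.+1 * (1 - s).
  by rewrite -[n.+2%:R]natr1 exprS; ring.
rewrite [leRHS](_ : 1 = s + (1 - s)); last by rewrite subrKC.
rewrite lerD//; first exact: ler_piMr.
by rewrite ger_pMl ?subr_gt0// exprn_ile1// ltW.
Qed.

(** At a radius [y] strictly between [|x|] and [|K|] the series converges absolutely, and the
    geometric factor [(|x| / y) ^ n] absorbs the factor [n + 1] created by differentiation. *)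
Lemma cvg_pseries_diffs a K x :
  cvgn (pseries a K) -> `|x| < `|K| -> cvgn (pseries (pseries_diffs a) x).
Proof.
move=> aK xK.
pose y := (`|x| + `|K|) / 2.
have y0 : 0 < y by rewrite divr_gt0// (le_lt_trans (normr_ge0 x))// ltr_wpDl.
have xy : `|x| < y by rewrite /y; lra.
have yK : `|y| < `|K| by rewrite gtr0_norm// /y; lra.
pose s := `|x| / y.
have s01 : 0 <= s < 1 by rewrite divr_ge0 ?(ltW y0)//= ltr_pdivrMr// mul1r.
apply: normed_cvg.
have cy := is_cvg_pseries_inside_norm aK yK.
have cy1 : cvgn (series (fun n => `|a n.+1| * y ^+ n.+1)).
  move: cy; rewrite /pseries -(is_cvg_series_restrict 1) => /cvg_ex[/= l].
  rewrite -cvg_shiftS/= => hl; apply/cvg_ex; exists l.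
  by move: hl; under eq_fun do rewrite big_add1/=.
apply: (@series_le_cvg _ _ (fun n => ((1 - s)^-1 / y) * (`|a n.+1| * y ^+ n.+1))).
- by move=> n; exact: normr_ge0.
- move=> n; rewrite mulr_ge0// ?divr_ge0 ?invr_ge0 ?subr_ge0 ?(ltW y0)//.
    by case/andP: s01 => _ /ltW.
  by rewrite mulr_ge0// exprn_ge0// ltW.
- move=> n /=; rewrite /pseries_diffs !normrM normr_nat normrX.
  have -> : `|x| = s * y by rewrite /s divfK// gt_eqF.
  rewrite exprMn exprSr.
  rewrite (_ : _ * _ * (s ^+ n * _) = (n.+1%:R * s ^+ n) * (`|a n.+1| * y ^+ n)); last by ring.
  rewrite (_ : _ / y * _ = (1 - s)^-1 * (`|a n.+1| * y ^+ n)); last first.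
    by set u := (1 - s)^-1; field; rewrite gt_eqF.
  by rewrite ler_wpM2r ?geom_term_le// mulr_ge0// exprn_ge0// ltW.
- exact: is_cvg_seriesZ.
Unshelve. all: by end_near. Qed.

Lemma real_analytic_is_derive (f : R -> R) : real_analytic f ->
  real_analytic (derive1 f) /\ forall x, is_derive x 1 f (derive1 f x).
Proof.
move=> af.
have loc x0 : exists r, 0 < r /\ exists a, forall x, `|x - x0| < r ->
    is_derive x 1 f (limn (pseries (pseries_diffs a) (x - x0))) /\
    cvgn (pseries (pseries_diffs a) (x - x0)).
  have [r [r0 [a ha]]] := af x0; exists r; split => //; exists a => x xr.
  have cv z : `|z| < r -> cvgn (pseries a z).
    move=> zr; apply/cvg_ex; exists (f (z + x0)).
    by have := ha (z + x0); rewrite addrK; apply.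
  (* [pseries_snd_diffs] asks for convergence of the series and of its first two derived series at
     one point; each differentiation shrinks the radius, whence three radii between [|x - x0|] and
     [r]. *)
  pose K1 := `|x - x0| + (r - `|x - x0|) / 4.
  pose K2 := `|x - x0| + (r - `|x - x0|) / 2.
  pose K3 := `|x - x0| + (r - `|x - x0|) / 4 * 3.
  have xx := normr_ge0 (x - x0).
  have nK1 : `|K1| = K1 by rewrite ger0_norm// /K1; lra.
  have nK2 : `|K2| = K2 by rewrite ger0_norm// /K2; lra.
  have nK3 : `|K3| = K3 by rewrite ger0_norm// /K3; lra.
  have c3 : cvgn (pseries a K3) by apply: cv; rewrite nK3 /K3; lra.
  have c2 : cvgn (pseries (pseries_diffs a) K2).
    by apply: cvg_pseries_diffs c3 _; rewrite nK3 nK2 /K3 /K2; lra.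
  have c1 : cvgn (pseries (pseries_diffs (pseries_diffs a)) K1).
    by apply: cvg_pseries_diffs c2 _; rewrite nK1 nK2 /K1 /K2; lra.
  have c21 : cvgn (pseries (pseries_diffs a) K1).
    by apply: is_cvg_pseries_inside c2 _; rewrite nK1 nK2 /K1 /K2; lra.
  have c31 : cvgn (pseries a K1).
    by apply: cv; rewrite nK1 /K1; lra.
  have xK1 : `|x - x0| < `|K1| by rewrite nK1 /K1; lra.
  split; last exact: is_cvg_pseries_inside c21 xK1.
  have D := pseries_snd_diffs c31 c21 c1 xK1.
  have D2 : is_derive x 1 (fun y : R => y - x0) 1.
    by rewrite -[X in is_derive _ _ _ X]subr0; exact: is_deriveB.
  have := @is_derive1_comp _ (fun z => limn (pseries a z)) (fun y => y - x0) x _ _ D D2.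
  rewrite mulr1; apply: near_eq_is_derive.
  have e0 : 0 < r - `|x - x0| by rewrite subr_gt0.
  near=> y => /=.
  apply/cvg_lim => //; apply: ha.
  have -> : y - x0 = (x - x0) - (x - y) by ring.
  rewrite (le_lt_trans (ler_normB _ _))// -ltrBrDl.
  by near: y; apply: nbhsx_ballx.
have dE x0 r a : (forall x, `|x - x0| < r ->
    is_derive x 1 f (limn (pseries (pseries_diffs a) (x - x0))) /\
    cvgn (pseries (pseries_diffs a) (x - x0))) ->
  forall x, `|x - x0| < r -> derive1 f x = limn (pseries (pseries_diffs a) (x - x0)).
  by move=> h x xr; have [d _] := h x xr; rewrite derive1E; exact: derive_val.
split.
  move=> x0; have [r [r0 [a ha]]] := loc x0.
  exists r; split => //; exists (pseries_diffs a) => x xr.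
  by rewrite (dE _ _ _ ha)//; exact: (ha x xr).2.
move=> x; have [r [r0 [a ha]]] := loc x.
have xr : `|x - x| < r by rewrite subrr normr0.
by rewrite (dE _ _ _ ha _ xr); exact: (ha x xr).1.
Unshelve. all: by end_near. Qed.

Lemma real_analytic_continuous (f : R -> R) : real_analytic f -> continuous f.
Proof.
move=> /real_analytic_is_derive[_ df] x.
by apply: differentiable_continuous; apply/derivable1_diffP; exact: ex_derive.
Qed.

Lemma real_analyticD (f g : R -> R) :
  real_analytic f -> real_analytic g -> real_analytic (fun x => f x + g x).
Proof.
move=> af ag x0; have [r [r0 [a ha]]] := af x0; have [s [s0 [b hb]]] := ag x0.
exists (Num.min r s); rewrite lt_min r0 s0; split => //.
exists (fun k => a k + b k) => x; rewrite lt_min => /andP[xr xs].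
rewrite [X in series X](_ : _ = (fun k => a k * (x - x0) ^+ k) +
    (fun k => b k * (x - x0) ^+ k)); last by apply/funext => k /=; rewrite mulrDl.
by rewrite seriesD; exact: cvgD (ha x xr) (hb x xs).
Qed.

Lemma real_analytic_shift (f : R -> R) c :
  real_analytic f -> real_analytic (fun x => f (x + c)).
Proof.
move=> af x0; have [r [r0 [a ha]]] := af (x0 + c).
exists r; split => //; exists a => x xr.
have := ha (x + c); rewrite (_ : x + c - (x0 + c) = x - x0); last by ring.
exact.
Qed.

Lemma real_analytic_cst (c : R) : real_analytic (fun=> c).
Proof.
move=> x0; exists 1; split => //; exists (fun k => if k == 0%N then c else 0) => x _.
apply: cvg_near_cst; near=> n.
have n0 : (0 < n)%N by near: n; exists 1%N.
rewrite /series/= -(prednK n0) big_nat_recl//= expr0 mulr1 big1 ?addr0// => i _.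
by rewrite mul0r.
Unshelve. all: by end_near. Qed.

(* Either the power series at [x0] vanishes, or its first nonzero term
   dominates near [x0]. *)
Lemma real_analytic_zero_dichotomy (f : R -> R) x0 : real_analytic f ->
  (exists2 r : R, 0 < r & forall x, `|x - x0| < r -> f x = 0) \/
  (exists2 r : R, 0 < r & forall x, 0 < `|x - x0| < r -> f x != 0).
Proof.
move=> af; have [r [r0 [a ha]]] := af x0.
have [a0|] := pselect (forall k, a k = 0).
  left; exists r => // x /ha.
  rewrite (_ : (fun k => _) = fun=> 0); last by apply/funext => k; rewrite a0 mul0r.
  move=> h; have h0 : series (fun=> 0 : R) @ \oo --> (0 : R).
    by apply: cvg_near_cst; near=> n; rewrite /series/= big1.
  exact: (cvg_unique _ h h0).
move=> /existsNP; rewrite -/(exists k, a k <> 0) => aE.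
have aE' : exists k, a k != 0 by case: aE => k /eqP ?; exists k.
right; pose m := ex_minn aE'.
have [am0 mmin] : a m != 0 /\ forall k, (k < m)%N -> a k = 0.
  rewrite /m; case: ex_minnP => m' am' h; split => // k km.
  by apply/eqP/negPn/negP => /h; rewrite leqNgt km.
pose b k := a (k + m.+1)%N.
have cb y : 0 < `|y| < r -> cvgn (pseries b y).
  move=> /andP[y0 yr].
  have : cvgn (pseries a y).
    by apply/cvg_ex; exists (f (y + x0)); have := ha (y + x0); rewrite addrK; apply.
  rewrite /pseries -(is_cvg_series_restrict m.+1) => /cvg_ex[/= l hl].
  have : cvgn (series (fun k => (b k * y ^+ k) * y ^+ m.+1)).
    apply/cvg_ex; exists l.
    move: hl; rewrite -(cvg_shiftn m.+1) => hl.
    rewrite (_ : series _ = (fun n => \sum_(m.+1 <= k < n + m.+1) a k * y ^+ k))//.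
    apply/funext => n; rewrite /series/= -[X in _ = \sum_(X <= k < _) _]add0n big_addn addnK.
    by apply: eq_bigr => i _; rewrite /b exprD mulrA.
  move=> /(@is_cvg_seriesZ _ _ (y ^- m.+1)).
  rewrite [X in cvgn (series X) -> _](_ : _ = (fun i => b i * y ^+ i))//.
  apply/funext => n /=.
  change (y ^- m.+1 * (b n * y ^+ n * y ^+ m.+1) = b n * y ^+ n).
  rewrite mulrC mulfK// expf_neq0//.
  by move: y0; rewrite normr_gt0.
pose y := r / 2.
have y0 : 0 < y by rewrite divr_gt0.
have yr : y < r by rewrite /y; lra.
have cby : cvgn (pseries (fun i => `|b i|) (y / 2)).
  apply: is_cvg_pseries_inside_norm (cb y _) _; rewrite ?gtr0_norm ?divr_gt0// ?y0//.
  by lra.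
pose B := limn (pseries (fun i => `|b i|) (y / 2)).
have B0 : 0 <= B.
  apply: limr_ge => //; near=> n; rewrite /pseries/series/=.
  by apply: sumr_ge0 => i _; rewrite mulr_ge0// exprn_ge0// ltW// divr_gt0.
(* [B] bounds the part after the leading term, divided by [z ^+ m.+1]. Within this radius [B * |z|]
   stays below [|a m|], so the two cannot cancel. *)
exists (Num.min (y / 2) (`|a m| / (B + 1))).
  by rewrite lt_min !divr_gt0 ?normr_gt0// ltr_wpDl.
move=> x /andP[z0]; rewrite lt_min => /andP[zy za].
set z := x - x0 in z0 zy za *.
have zr : `|z| < r by rewrite (lt_trans zy)// /y; lra.
have fE : f x = a m * z ^+ m + limn (pseries b z) * z ^+ m.+1.
  have h : cvgn (pseries b z) by apply: cb; rewrite z0.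
  have key : series (fun k => a k * z ^+ k) @ \oo -->
      a m * z ^+ m + limn (pseries b z) * z ^+ m.+1.
    rewrite -(cvg_shiftn m.+1).
    rewrite (_ : [sequence _]_n = fun n => a m * z ^+ m + pseries b z n * z ^+ m.+1).
      by apply: cvgD; [exact: cvg_cst|apply: cvgMl].
    apply/funext => n; rewrite /= /pseries /series/=.
    rewrite (big_cat_nat (n := m.+1)) ?leq_addl//= big_nat_recr//=.
    rewrite big_nat_cond big1 ?add0r; last first.
      by move=> i /andP[/andP[_ im] _]; rewrite mmin// mul0r.
    congr (_ + _).
    rewrite -[X in \sum_(X <= k < _) _ = _]add0n big_addn addnK mulr_suml.
    by apply: eq_bigr => i _; rewrite exprD mulrA.
  exact: (cvg_unique _ (ha x zr) key).
have lb : `|limn (pseries b z)| <= B.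
  have cz : cvgn (pseries b z) by apply: cb; rewrite z0.
  have : `|pseries b z n| @[n --> \oo] --> `|limn (pseries b z)| by apply: cvg_norm.
  move=> h; apply: (ler_cvg_to h cby); near=> n.
  rewrite /pseries/series/= (le_trans (ler_norm_sum _ _ _))//.
  apply: ler_sum => i _; rewrite normrM normrX ler_wpM2l// lerXn2r ?nnegrE//.
    by rewrite ltW// divr_gt0.
  exact: ltW.
rewrite fE exprS (mulrC z) mulrA mulrAC -mulrDl mulf_neq0//; last first.
  by rewrite expf_neq0// -normr_gt0.
rewrite addr_eq0; apply/negP => /eqP/(congr1 Num.norm); rewrite normrN normrM.
move=> E; move: za; rewrite ltr_pdivlMr ?ltr_wpDl// E; apply/negP; rewrite -leNgt.
by rewrite mulrC ler_pM// (le_trans lb)// lerDl.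
Unshelve. all: by end_near. Qed.

(** The points near which [f] vanishes identically form an open and closed set, empty by
    connectedness since [f] is not zero. So the zeros are isolated, hence countable. *)
Lemma real_analytic_zeros_null (f : R -> R) : real_analytic f ->
  (exists x, f x != 0) -> lebesgue_measure [set x | f x = 0] = 0%E.
Proof.
move=> af [x1 fx1].
pose Z := [set x0 | exists2 r : R, 0 < r & forall x, `|x - x0| < r -> f x = 0].
have oZ : open Z.
  rewrite openE => x0 [r r0 h]; near=> y.
  exists (r / 2); first by rewrite divr_gt0.
  move=> x xy; apply: h; rewrite (_ : x - x0 = (x - y) - (x0 - y)); last by ring.
  rewrite (le_lt_trans (ler_normB _ _))// [ltRHS](splitr r) ltrD//.
  by near: y; apply: nbhsx_ballx; rewrite divr_gt0.
have oCZ : open (~` Z).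
  rewrite openE => x0; have [//|[r r0 h] _] := real_analytic_zero_dichotomy x0 af.
  near=> y; move=> [s s0 hs].
  pose e := Num.min s (r / 2); pose d := e / 2.
  have e0 : 0 < e by rewrite lt_min s0 divr_gt0.
  have es : e <= s by rewrite ge_min lexx.
  have er : e <= r / 2 by rewrite ge_min lexx orbT.
  have d0 : 0 < d by rewrite divr_gt0.
  have ds : d < s by rewrite /d; lra.
  have dr : d < r / 2 by rewrite /d; lra.
  have yr : `|x0 - y| < r / 2 by near: y; apply: nbhsx_ballx; rewrite divr_gt0.
  have z1 : f (y + d) = 0 by apply: hs; rewrite addrAC subrr add0r gtr0_norm.
  have z2 : f (y - d / 2) = 0.
    apply: hs; rewrite addrAC subrr add0r normrN gtr0_norm ?divr_gt0//.
    by rewrite (lt_trans _ ds)//; lra.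
  (* Both [y + d] and [y - d / 2] are zeros of [f], and at most one of them is [x0]; the other
     contradicts the absence of further zeros near [x0]. *)
  have [E|E] := eqVneq (y + d) x0.
    have : f (y - d / 2) != 0.
      apply: h; rewrite -E (_ : y - d / 2 - (y + d) = - (d * (3 / 2))); last by field.
      by rewrite normrN gtr0_norm; lra.
    by rewrite z2 eqxx.
  have : f (y + d) != 0.
    apply: h; rewrite normr_gt0 subr_eq0 E/=.
    rewrite (_ : y + d - x0 = d - (x0 - y)); last by ring.
    rewrite (le_lt_trans (ler_normB _ _))// [ltRHS](splitr r) ltrD//.
    by rewrite gtr0_norm.
  by rewrite z1 eqxx.
have Z0 : Z = set0.
  apply: contrapT => /eqP/set0P Zn0.
  have /connected_intervalP cT : is_interval [set: R] by [].
  have ZT : Z = setT.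
    apply: cT => //; first by exists Z => //; rewrite setTI.
    by exists Z; rewrite ?setTI// -[Z]setCK; exact: open_closedC.
  have : Z x1 by rewrite ZT.
  move=> [r r0 /(_ x1)]; rewrite subrr normr0 => /(_ r0)/eqP.
  by rewrite (negbTE fx1).
(* A rational before the next zero to the right of [x0]: distinct zeros receive distinct
   rationals. *)
have iso x0 : exists q : rat, f x0 = 0 ->
    x0 < ratr q /\ forall x, x0 < x -> x < ratr q -> f x != 0.
  have [h|[r r0 h]] := real_analytic_zero_dichotomy x0 af.
    by exfalso; have : Z x0 by []; rewrite Z0.
  have /rat_in_itvoo[q] : x0 < x0 + r by rewrite ltrDl.
  rewrite in_itv/= => /andP[q1 q2]; exists q => _; split => // x xx0 xq.
  apply: h; rewrite gtr0_norm subr_gt0 ?xx0//= ltrBlDl (lt_trans xq)//.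
have [q hq] := choice iso.
apply: countable_lebesgue_measure0.
apply/countable_injP; exists (fun x => pickle (q x)).
move=> x y; rewrite !inE/= => fx fy /(pcan_inj pickleK) qxy.
have [x1q hx] := hq _ fx; have [y1q hy] := hq _ fy.
case: (ltgtP x y) => // xy.
  by have := hx _ xy; rewrite qxy => /(_ y1q); rewrite fy eqxx.
by have := hy _ xy; rewrite -qxy => /(_ x1q); rewrite fx eqxx.
Unshelve. all: by end_near. Qed.

End PowerSeries.

Section PeriodicSmooth.
Context {R : realType}.
Implicit Types f g : R -> R.

Lemma periodic1_int f (k : int) x : periodic1 f -> f (x + k%:~R) = f x.
Proof.
move=> pf; elim: k => [|n IH|n IH] in x *.
- by rewrite addr0.
- by rewrite -addn1 PoszD intrD addrA pf IH.
- rewrite -addn1 PoszD opprD intrD addrA -[LHS]pf -[x + _ + _ + _]addrA addNr addr0.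
  exact: IH.
Qed.

Lemma frac_in01 (x : R) : 0 <= frac x < 1.
Proof. by have := floor_itv x; rewrite /frac intrD; lra. Qed.

Lemma periodic1_frac f x : periodic1 f -> f (frac x) = f x.
Proof. by move=> pf; rewrite /frac -mulrNz periodic1_int. Qed.

Lemma frac_id (x : R) : 0 <= x < 1 -> frac x = x.
Proof.
by move=> h; rewrite /frac (@floor_def _ x 0) ?subr0// add0r.
Qed.

Lemma fracDz (x : R) (k : int) : frac (x + k%:~R) = frac x.
Proof.
by rewrite /frac [in X in _ - X]addrC floorDzr ?intr_int// intrKfloor intrD; ring.
Qed.

Lemma periodic1_bounded f : periodic1 f -> continuous f ->
  exists C : R, forall x, `|f x| <= C.
Proof.
move=> pf cf.
have ab : {within `[0, 1], continuous f} by exact: continuous_subspaceT.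
have [c _ hc] := EVT_max (ler01 : (0 : R) <= 1) ab.
have [d _ hd] := EVT_min (ler01 : (0 : R) <= 1) ab.
exists (`|f c| + `|f d|) => x; rewrite -(periodic1_frac x pf).
have fx : frac x \in `[0, 1] by rewrite in_itv/=; have := frac_in01 x; lra.
have := hc _ fx; have := hd _ fx.
rewrite ler_norml => h1 h2.
have := ler_norm (f c); have := ler_norm (- f d); rewrite normrN.
have := normr_ge0 (f c); have := normr_ge0 (f d); lra.
Qed.

Lemma periodic1_min f : periodic1 f -> continuous f -> (forall x, 0 < f x) ->
  exists2 m, 0 < m & forall x, m <= f x.
Proof.
move=> pf cf f0.
have ab : {within `[0, 1], continuous f} by exact: continuous_subspaceT.
have [d _ hd] := EVT_min (ler01 : (0 : R) <= 1) ab.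
exists (f d) => // x; rewrite -(periodic1_frac x pf); apply: hd.
by rewrite in_itv/=; have := frac_in01 x; lra.
Qed.

Lemma derive_le_lipschitz f f1 (C : R) :
  (forall x : R, is_derive x 1 f (f1 x)) -> (forall x, `|f1 x| <= C) ->
  forall x y, `|f x - f y| <= C * `|x - y|.
Proof.
move=> df bf.
have cf : continuous f.
  move=> x; apply: differentiable_continuous; apply/derivable1_diffP.
  by have := df x => ?; exact: ex_derive.
have H x y : x <= y -> `|f x - f y| <= C * `|x - y|.
  move=> xy; have := @MVT_segment _ f f1 x y xy (fun z _ => df z) (continuous_subspaceT cf).
  by move=> [z _ E]; rewrite distrC E normrM distrC ler_wpM2r.
by move=> x y; have [/H//|/ltW/H] := leP x y; rewrite distrC [X in C * X]distrC.
Qed.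

Lemma real_analytic_taylor2 f : periodic1 f -> real_analytic f ->
  exists C : R, [/\ 0 < C,
    periodic1 (derive1 f),
    real_analytic (derive1 f),
    forall x y, `|f x - f y| <= C * `|x - y| &
    (forall x y, `|derive1 f x - derive1 f y| <= C * `|x - y|) /\
    (forall x h, `|f (x + h) - f x - h * derive1 f x| <= C * h ^+ 2)].
Proof.
move=> pf af.
have per1 g : periodic1 g -> (forall x : R, is_derive x 1 g (derive1 g x)) -> periodic1 (derive1 g).
  move=> pg dg x; have dx := dg (x + 1).
  have D : is_derive x 1 (fun y : R => y + 1) 1.
    by rewrite -[X in is_derive _ _ _ X]addr0; exact: is_deriveD.
  have := @is_derive1_comp _ g (fun y => y + 1) x _ _ dx D.
  rewrite mulr1 (_ : g \o _ = g); last by apply/funext => y /=; rewrite pg.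
  by move=> E; rewrite [RHS]derive1E; apply/esym; exact: derive_val.
have [af1 df] := real_analytic_is_derive af.
have [af2 df1] := real_analytic_is_derive af1.
have p1 := per1 _ pf df; have p2 := per1 _ p1 df1.
have [C1 hC1] := periodic1_bounded p1 (real_analytic_continuous af1).
have [C2 hC2] := periodic1_bounded p2 (real_analytic_continuous af2).
pose C := 1 + `|C1| + `|C2|.
have C10 := normr_ge0 C1; have C20 := normr_ge0 C2.
have C1n := ler_norm C1; have C2n := ler_norm C2.
exists C; split => //.
- by rewrite /C; lra.
- apply: (derive_le_lipschitz df) => x; apply: le_trans (hC1 x) _; rewrite /C; lra.
split; first by move=> x y; apply: (derive_le_lipschitz df1) => z; apply: le_trans (hC2 z) _; rewrite /C; lra.
move=> x h.
(* The Taylor bound is the mean value theorem for [f z - z * derive1 f x], whose derivative is small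
   near [x] by the Lipschitz bound on [derive1 f]. *)
have dg (y : R) : is_derive y 1 (fun z => f z - z * derive1 f x) (derive1 f y - derive1 f x).
  apply: is_deriveB.
  rewrite (_ : (fun z => _) = (derive1 f x) \*: id); last first.
    by apply/funext => z /=; rewrite mulrC.
  by apply: is_derive_eq; rewrite /GRing.scale/= mulr1.
have cg : continuous (fun z => f z - z * derive1 f x).
  move=> y; apply: differentiable_continuous; apply/derivable1_diffP.
  by have := dg y => ?; exact: ex_derive.
have H (a b : R) : a <= b -> (x = a \/ x = b) ->
   `|f b - f a - (b - a) * derive1 f x| <= C * (b - a) ^+ 2.
  move=> ab xab.
  have [z] := @MVT_segment _ _ _ a b ab (fun z _ => dg z) (continuous_subspaceT cg).
  rewrite in_itv/= => /andP[az zb] E.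
  rewrite (_ : f b - _ - _ = f b - b * derive1 f x - (f a - a * derive1 f x)); last by ring.
  rewrite E normrM expr2 mulrA (@ger0_norm _ (b - a)) ?subr_ge0//.
  rewrite ler_wpM2r ?subr_ge0//.
  apply: le_trans (derive_le_lipschitz df1 hC2 z x) _.
  have zx : `|z - x| <= b - a.
    by rewrite ler_norml; case: xab => ->; lra.
  apply: (@le_trans _ _ (`|C2| * `|z - x|)); first by rewrite ler_wpM2r.
  by apply: ler_pM => //; rewrite /C; lra.
have [h0|h0] := leP 0 h.
  have := H x (x + h); rewrite (_ : x + h - x = h); last by ring.
  by rewrite lerDl; apply => //; left.
have := H (x + h) x; rewrite gerDl ltW// => /(_ isT (or_intror erefl)).
rewrite (_ : x - (x + h) = - h); last by ring.
rewrite sqrrN mulNr opprK -normrN opprD opprB; congr (`| _ | <= _); ring.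
Qed.

End PeriodicSmooth.

(** * Special flows *)

Section Cocycle.
Context {R : realType}.
Implicit Types (f : R -> R) (gam x u t : R) (n k : int).

Lemma birkhoff0 gam f x : birkhoff gam f 0 x = 0.
Proof. by rewrite /birkhoff/= big_nil. Qed.

Lemma birkhoffS gam f n x :
  birkhoff gam f (n + 1) x = birkhoff gam f n x + f (x + n%:~R * gam).
Proof.
case: n => [n|[|n]].
- by rewrite -PoszD addn1 /birkhoff/= big_nat_recr.
- by rewrite (_ : Negz 0 + 1 = 0)// birkhoff0 /birkhoff/= big_nat1 NegzE mulNr mul1r addNr.
- rewrite (_ : Negz n.+1 + 1 = Negz n); last by rewrite !NegzE; lia.
  by rewrite /birkhoff [in RHS]big_nat_recr//= opprD NegzE mulrNz mulNr subrK.
Qed.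

Lemma birkhoffD gam f n k x : birkhoff gam f (n + k) x =
  birkhoff gam f n x + birkhoff gam f k (x + n%:~R * gam).
Proof.
elim: k => [|k IH|k IH].
- by rewrite birkhoff0 !addr0.
- rewrite (_ : n + k.+1%:Z = n + k + 1); last by lia.
  rewrite (_ : k.+1%:Z = k%:Z + 1); last by lia.
  by rewrite 2!birkhoffS IH -!addrA intrD mulrDl !addrA.
- have := birkhoffS gam f (n - k.+1%:Z) x.
  have := birkhoffS gam f (- k.+1%:Z) (x + n%:~R * gam).
  rewrite (_ : n - k.+1%:Z + 1 = n - k%:Z); last by lia.
  rewrite (_ : - k.+1%:Z + 1 = - k%:Z); last by lia.
  rewrite IH => ->; rewrite intrD (mulrDl _ _ gam) !addrA.
  by move/addIr => <-.
Qed.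

Lemma birkhoff_periodic gam f n k x : periodic1 f ->
  birkhoff gam f n (x + k%:~R) = birkhoff gam f n x.
Proof.
move=> pf; case: n => n; rewrite /birkhoff; [|congr (- _)]; apply: eq_bigr => i _.
  by rewrite addrAC periodic1_int.
by rewrite addrAC periodic1_int.
Qed.

Lemma birkhoffN gam f n x :
  birkhoff gam f (- n) (x + n%:~R * gam) = - birkhoff gam f n x.
Proof. by apply/eqP; rewrite -addr_eq0 addrC -birkhoffD subrr birkhoff0. Qed.

Lemma birkhoff_growth gam f (m0 : R) : (forall x, m0 <= f x) ->
  forall n k x, n <= k ->
  m0 * (k - n)%:~R <= birkhoff gam f k x - birkhoff gam f n x.
Proof.
move=> hf n k x nk.
have -> : k = n + (`|k - n|%N)%:Z by lia.
elim: `|k - n|%N => [|d IH]; first by rewrite !(addr0, subrr, mulr0).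
have -> : n + d.+1%:Z = n + d%:Z + 1 by lia.
rewrite birkhoffS [leRHS]addrAC (_ : n + d%:Z + 1 - n = n + d%:Z - n + 1); last by lia.
by rewrite intrD mulrDr mulr1 lerD.
Qed.

Lemma birkhoff_lt gam f (m0 : R) n k x : 0 < m0 -> (forall x, m0 <= f x) ->
  birkhoff gam f n x < birkhoff gam f k x -> n < k.
Proof.
move=> m00 hf; apply: contraTT; rewrite -!leNgt => kn.
have := birkhoff_growth gam hf x kn.
have : 0 <= m0 * (n - k)%:~R by rewrite mulr_ge0 ?(ltW m00)// ler0z subr_ge0.
lra.
Qed.

End Cocycle.

(** The metric data behind the estimates for the flow: [m0] limits the number of returns in a given
    time, and the Lipschitz constant compares Birkhoff sums at nearby points and angles. *)
Record roof {R : realType} (f : R -> R) (m0 M0 C : R) : Prop := Roof {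
  roof_per : periodic1 f;
  roof_m0 : 0 < m0;
  roof_ge : forall x, m0 <= f x;
  roof_le : forall x, f x <= M0;
  roof_lip : forall x y, `|f x - f y| <= C * `|x - y| }.

Section Flow.
Context {R : realType} (f : R -> R) (m0 M0 Cf : R) (rf : roof f m0 M0 Cf).
Let pf : periodic1 f. Proof. exact: roof_per rf. Qed.
Let m00 : 0 < m0. Proof. exact: roof_m0 rf. Qed.
Let fm0 x : m0 <= f x. Proof. exact: roof_ge rf x. Qed.
Implicit Types (gam x u t : R) (n k : int).

Lemma roof_C0 : 0 <= Cf.
Proof.
have := roof_lip rf 0 1; rewrite sub0r normrN normr1 mulr1.
exact: le_trans.
Qed.

Lemma flow_n_exists gam x u :
  exists n : int, birkhoff gam f n x <= u < birkhoff gam f (n + 1) x.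
Proof.
have [N0 uN] : exists N : nat, `|u| < m0 * N%:R.
  exists (Num.truncn (`|u| / m0)).+1; rewrite mulrC -ltr_pdivrMr//.
  exact: truncnS_gt.
have h1 : birkhoff gam f (- N0%:Z) x <= u.
  have := birkhoff_growth gam fm0 x (_ : - N0%:Z <= 0); rewrite birkhoff0 sub0r opprK.
  have : - `|u| <= u by rewrite lerNl -normrN ler_norm.
  by rewrite -pmulrn => ? /(_ ltac:(lia)); lra.
have h2 : exists k : nat, u < birkhoff gam f (- N0%:Z + k%:Z + 1) x.
  exists (N0 + N0)%N.
  have := birkhoff_growth gam fm0 x (_ : 0 <= - N0%:Z + (N0 + N0)%N%:Z + 1).
  rewrite birkhoff0 !subr0 (_ : - N0%:Z + (N0 + N0)%N%:Z = N0%:Z); last by lia.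
  rewrite intrD -pmulrn mulrDr mulr1 => /(_ ltac:(lia)); apply: lt_le_trans.
  by rewrite (le_lt_trans (ler_norm u))// (lt_trans uN)// ltrDl.
have [k hk mk] := ex_minnP h2; exists (- N0%:Z + k%:Z); rewrite hk andbT.
case: k mk {hk} => [|k] mk; first by rewrite addr0.
rewrite leNgt; apply/negP => h; suff /mk : u < birkhoff gam f (- N0%:Z + k%:Z + 1) x by rewrite ltnn.
by rewrite (_ : _ + _ + 1 = - N0%:Z + k.+1%:Z)//; lia.
Qed.

Lemma flow_nP gam t p :
  birkhoff gam f (flow_n gam f t p) p.1 <= p.2 + t <
  birkhoff gam f (flow_n gam f t p + 1) p.1.
Proof.
rewrite /flow_n; case: xgetP => [n _ //|h].
have [n hn] := flow_n_exists gam p.1 (p.2 + t).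
by have /= := h n; rewrite hn.
Qed.

Lemma flow_n_uniq gam x u n k :
  birkhoff gam f n x <= u < birkhoff gam f (n + 1) x ->
  birkhoff gam f k x <= u < birkhoff gam f (k + 1) x -> n = k.
Proof.
move=> /andP[a1 a2] /andP[b1 b2].
have := birkhoff_lt m00 fm0 (le_lt_trans a1 b2).
have := birkhoff_lt m00 fm0 (le_lt_trans b1 a2).
lia.
Qed.

Lemma flow_n_eq gam t p n :
  birkhoff gam f n p.1 <= p.2 + t < birkhoff gam f (n + 1) p.1 ->
  flow_n gam f t p = n.
Proof. by move=> h; apply: flow_n_uniq h; exact: flow_nP. Qed.

(** Each return takes a time at least [m0]; the bound is uniform in the point and the angle. *)
Lemma flow_n_bound gam x u n :
  birkhoff gam f n x <= u < birkhoff gam f (n + 1) x ->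
  `|n%:~R| <= `|u| / m0 + 1.
Proof.
move=> /andP[h1 h2]; rewrite ler_norml.
have a1 := ler_norm u; have a2 := ler_norm (- u); rewrite normrN in a2.
apply/andP; split.
  have [n0|n0] := leP 0 n.
    have : 0 <= n%:~R :> R by rewrite ler0z.
    have : 0 <= `|u| / m0 by rewrite divr_ge0// ltW.
    lra.
  have := birkhoff_growth gam fm0 x (_ : n + 1 <= 0).
  rewrite birkhoff0 => /(_ ltac:(lia)) h.
  rewrite lerNl -lerBlDr ler_pdivlMr//.
  rewrite mulrC (_ : - n%:~R - 1 = (0 - (n + 1))%:~R :> R); first lra.
  by rewrite intrD rmorphN/= intrD; ring.
have [n0|n0] := leP 0 n; last first.
  have : n%:~R <= 0 :> R by rewrite lerz0 ltW.
  have : 0 <= `|u| / m0 by rewrite divr_ge0// ltW.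
  lra.
have := birkhoff_growth gam fm0 x n0; rewrite birkhoff0 !subr0 => h.
by rewrite ler_wpDr// ler_pdivlMr// mulrC; lra.
Qed.

(** The time is absorbed in the height. At time [0], [sflow] is the projection of the whole plane to
    the phase space, and the flow becomes vertical translation upstairs. *)
Lemma sflowE gam t p : sflow gam f t p = sflow gam f 0 (p.1, p.2 + t).
Proof. by rewrite /sflow /flow_n/= addr0. Qed.

Lemma sflow0_eq gam x u n :
  birkhoff gam f n x <= u < birkhoff gam f (n + 1) x ->
  sflow gam f 0 (x, u) = (frac (x + n%:~R * gam), u - birkhoff gam f n x).
Proof. by move=> h; rewrite /sflow (@flow_n_eq _ _ _ n)/= addr0. Qed.

(** The gluing of the roof to the base, seen in the plane: both points lie over the same point of
    the phase space. *)
Lemma sflow0_shift gam x u n :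
  sflow gam f 0 (x + n%:~R * gam, u) = sflow gam f 0 (x, u + birkhoff gam f n x).
Proof.
have [k hk] := flow_n_exists gam (x + n%:~R * gam) u.
have hk' : birkhoff gam f (n + k) x <= u + birkhoff gam f n x < birkhoff gam f (n + k + 1) x.
  by rewrite -addrA !birkhoffD -birkhoffD; move: hk; rewrite !birkhoffD; lra.
rewrite (sflow0_eq hk) (sflow0_eq hk'); congr pair.
  by rewrite intrD mulrDl addrA.
by rewrite birkhoffD; ring.
Qed.

Lemma sflow0_int gam x u k :
  sflow gam f 0 (x + k%:~R, u) = sflow gam f 0 (x, u).
Proof.
have [n hn] := flow_n_exists gam x u.
have hn' : birkhoff gam f n (x + k%:~R) <= u < birkhoff gam f (n + 1) (x + k%:~R).
  by rewrite !birkhoff_periodic.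
rewrite (sflow0_eq hn) (sflow0_eq hn') birkhoff_periodic//.
by rewrite addrAC fracDz.
Qed.

Lemma sflow0_frac gam x u : sflow gam f 0 (frac x, u) = sflow gam f 0 (x, u).
Proof. by rewrite /frac -mulrNz sflow0_int. Qed.

Lemma sflow_phase gam t p : phase f (sflow gam f t p).
Proof.
rewrite sflowE; have [n hn] := flow_n_exists gam p.1 (p.2 + t).
rewrite (sflow0_eq hn); split => /=; first exact: frac_in01.
by rewrite periodic1_frac//; move: hn; rewrite birkhoffS; lra.
Qed.

Lemma sflow_id gam p : phase f p -> sflow gam f 0 p = p.
Proof.
case: p => x y [/= hx hy]; rewrite (@sflow0_eq _ _ _ 0).
  by rewrite birkhoff0 subr0 mul0r addr0 frac_id.
by rewrite birkhoffS birkhoff0 mul0r addr0 add0r.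
Qed.

Lemma sflowD gam s t p : sflow gam f s (sflow gam f t p) = sflow gam f (t + s) p.
Proof.
rewrite (sflowE _ (t + s)) (sflowE _ t).
have [n hn] := flow_n_exists gam p.1 (p.2 + t).
rewrite (sflow0_eq hn) sflowE/= sflow0_frac sflow0_shift; congr (sflow _ _ _ (_, _)).
by ring.
Qed.

End Flow.

Section Lift.
Context {R : realType}.

(* Pieces that are Lipschitz and vanish at their common endpoints glue into a
   Lipschitz function. *)
Lemma glue_lipschitz (F : R -> R) (s : int -> R) (N : R -> int) (L : R) :
  0 <= L -> (forall n k, n <= k -> s n <= s k) ->
  (forall u, s (N u) <= u < s (N u + 1)) ->
  (forall u v, N u = N v -> `|F u - F v| <= L * `|u - v|) ->
  (forall u, `|F u| <= L * (u - s (N u))) ->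
  (forall u, `|F u| <= L * (s (N u + 1) - u)) ->
  forall u v, `|F u - F v| <= L * `|u - v|.
Proof.
move=> L0 sm sN h1 h2 h3.
have key u v : u <= v -> `|F u - F v| <= L * `|u - v|.
  move=> uv; have [E|NE] := eqVneq (N u) (N v); first exact: h1.
  have NN : N u + 1 <= N v.
    suff : N u < N v by lia.
    rewrite ltNge; apply/negP => h.
    have /sm : N v + 1 <= N u by lia.
    by have := sN u; have := sN v; lra.
  have := sm _ _ NN => sNN.
  apply: (le_trans (ler_normB _ _)); apply: (le_trans (lerD (h3 u) (h2 v))).
  rewrite -mulrDr ler_wpM2l// distrC ger0_norm ?subr_ge0//; lra.
by move=> u v; have [/key//|/ltW/key] := leP u v; rewrite distrC [X in L * X]distrC.
Qed.

(** Vanishing on the base and at the roof makes [g] compatible with the gluing for every angle at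
    once, so that its lift is continuous whatever [gam] is. *)
Definition nice (f : R -> R) (L : R) (g : R * R -> R) :=
  [/\ forall p, `|g p| <= 1,
      forall x y, g (x + 1, y) = g (x, y),
      forall x y, ~~ (0 < y < f x) -> g (x, y) = 0 &
      forall x y x' y', `|g (x, y) - g (x', y')| <= L * (`|x - x'| + `|y - y'|)].

(** The pull-back of [g] by the projection described at [sflowE]. Estimates are made in the plane,
    where the flow has no jumps. *)
Definition lift (gam : R) (f : R -> R) (g : R * R -> R) (p : R * R) :=
  g (sflow gam f 0 p).

Context (f : R -> R) (m0 M0 Cf : R) (rf : roof f m0 M0 Cf).
Let m00 : 0 < m0. Proof. exact: roof_m0 rf. Qed.
Let fm0 x : m0 <= f x. Proof. exact: roof_ge rf x. Qed.
Let fLip x y : `|f x - f y| <= Cf * `|x - y|. Proof. exact: roof_lip rf x y. Qed.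
Let Cf0 : 0 <= Cf. Proof. exact: roof_C0 rf. Qed.
Context (g : R * R -> R) (L : R) (ng : nice f L g).
Implicit Types (gam x u t : R) (n k : int).

Lemma nice_L0 : 0 <= L.
Proof.
have [_ _ _ h] := ng; have := h 0 0 0 1.
rewrite subrr normr0 add0r sub0r normrN normr1 mulr1.
exact: le_trans.
Qed.

Lemma nice_frac x y : g (frac x, y) = g (x, y).
Proof. by have [_ h _ _] := ng; exact: (@periodic1_frac _ (fun x => g (x, y))). Qed.

Lemma lift_eq gam x u n :
  birkhoff gam f n x <= u < birkhoff gam f (n + 1) x ->
  lift gam f g (x, u) = g (x + n%:~R * gam, u - birkhoff gam f n x).
Proof. by move=> h; rewrite /lift (sflow0_eq rf h) nice_frac. Qed.

Lemma lift_le1 gam p : `|lift gam f g p| <= 1.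
Proof. by have [h _ _ _] := ng; exact: h. Qed.

Lemma lift_id gam p : phase f p -> lift gam f g p = g p.
Proof. by move=> h; rewrite /lift (sflow_id rf). Qed.

Lemma lift_shift gam x u n :
  lift gam f g (x + n%:~R * gam, u) = lift gam f g (x, u + birkhoff gam f n x).
Proof. by rewrite /lift (sflow0_shift rf). Qed.

Lemma lift_int gam x u k : lift gam f g (x + k%:~R, u) = lift gam f g (x, u).
Proof. by rewrite /lift (sflow0_int rf). Qed.

(** Between two returns the lift follows [g], and it vanishes at each return, so the pieces glue
    with the same constant. *)
Lemma lift_lip_u gam x u v :
  `|lift gam f g (x, u) - lift gam f g (x, v)| <= L * `|u - v|.
Proof.
have [g1 gp g0 gl] := ng.
pose N u := flow_n gam f 0 (x, u).
have HN w : birkhoff gam f (N w) x <= w < birkhoff gam f (N w + 1) x.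
  by have := flow_nP rf gam 0 (x, w); rewrite addr0.
apply: (@glue_lipschitz (fun u => lift gam f g (x, u)) (fun n => birkhoff gam f n x) N L) => //.
- exact: nice_L0.
- move=> n k nk; rewrite -subr_ge0; apply: le_trans (birkhoff_growth gam fm0 x nk).
  by rewrite mulr_ge0 ?(ltW m00)// ler0z subr_ge0.
- move=> {}u {}v E; have hv := HN v; rewrite -E in hv.
  rewrite (lift_eq (HN u)) (lift_eq hv).
  apply: (le_trans (gl _ _ _ _)); rewrite subrr normr0 add0r.
  by rewrite (_ : u - _ - (v - _) = u - v)//; ring.
- move=> {}u; rewrite (lift_eq (HN u)).
  have := gl (x + (N u)%:~R * gam) (u - birkhoff gam f (N u) x) (x + (N u)%:~R * gam) 0.
  rewrite (g0 _ 0) ?ltxx// !subr0 subrr normr0 add0r (@ger0_norm _ (u - _))//.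
  by have := HN u; lra.
- move=> {}u; rewrite (lift_eq (HN u)).
  have := gl (x + (N u)%:~R * gam) (u - birkhoff gam f (N u) x)
     (x + (N u)%:~R * gam) (f (x + (N u)%:~R * gam)).
  rewrite (g0 _ (f _)) ?ltxx ?andbF// !subr0 subrr normr0 add0r => h.
  apply: (le_trans h); rewrite distrC.
  have := HN u; rewrite birkhoffS => hu.
  rewrite ger0_norm; last lra.
  by rewrite ler_wpM2l ?nice_L0//; lra.
Qed.

(** The [i]-th point of the orbit moves by at most [|x' - x| + i * |gam' - gam|], whence a bound
    quadratic in [n] for the change of angle. *)
Lemma birkhoff_lip gam gam' x x' n :
  `|birkhoff gam' f n x' - birkhoff gam f n x| <=
  `|n%:~R| * (Cf * (`|x' - x| + `|n%:~R| * `|gam' - gam|)).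
Proof.
have key (c c' : nat -> R) (d : R) (k : nat) :
    (forall i, (i < k)%N -> `|c' i - c i| <= d) ->
    `|\sum_(0 <= i < k) c' i - \sum_(0 <= i < k) c i| <= k%:R * d.
  move=> h; rewrite -sumrB big_mkord.
  apply: (le_trans (ler_norm_sum _ _ _)).
  apply: (@le_trans _ _ (\sum_(i < k) d)); first by apply: ler_sum => i _; exact: h.
  by rewrite sumr_const card_ord -[leLHS]mulr_natl.
case: n => n.
  rewrite [X in X * _]ger0_norm ?ler0n//; apply: key => i ik.
  apply: (le_trans (fLip _ _)); rewrite ler_wpM2l//.
  rewrite (_ : _ - _ = (x' - x) + i%:R * (gam' - gam)); last by ring.
  apply: (le_trans (ler_normD _ _)); rewrite lerD2l normrM ler_wpM2r//.
  by rewrite !ger0_norm ?ler0n// -pmulrn ler_nat ltnW.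
rewrite /birkhoff -opprB opprK addrC NegzE mulrNz !normrN.
rewrite [X in X * _]ger0_norm ?ler0n//; apply: key => i ik.
apply: (le_trans (fLip _ _)); rewrite ler_wpM2l//.
rewrite (_ : _ - _ = (x' - x) - i.+1%:R * (gam' - gam)); last by ring.
apply: (le_trans (ler_normB _ _)); rewrite lerD2l normrM ler_wpM2r//.
by rewrite !ger0_norm ?ler0n// -pmulrn ler_nat.
Qed.

(** At bounded height the number [n] of returns is at most [B]. The same [n] is used at both base
    points: the change of the Birkhoff sum becomes a vertical displacement, and it remains to
    compare the points at height [y] above the two images. *)
Lemma lift_lip_x (U : R) : exists2 K : R, 0 <= K &
  forall gam gam' x x' u, `|u| <= U ->
  `|lift gam' f g (x', u) - lift gam f g (x, u)| <= K * (`|x' - x| + `|gam' - gam|).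
Proof.
have [g1 gp g0 gl] := ng; have L0 := nice_L0.
pose B := `|U| / m0 + 1.
have Cf1 : 0 <= 1 + Cf by rewrite addr_ge0.
have B1 : 1 <= B by rewrite lerDr divr_ge0// ltW.
have B0 : 0 <= B by lra.
exists (L * (B * (Cf * B)) + L * (1 + Cf) * B + L * B).
  by do 2?apply: addr_ge0; rewrite !mulr_ge0.
move=> gam gam' x x' u uU.
have [n hn] := flow_n_exists rf gam x u.
have nB : `|n%:~R| <= B :> R.
  apply: le_trans (flow_n_bound rf hn) _; rewrite lerD2r ler_wpM2r ?invr_ge0 ?(ltW m00)//.
  by rewrite (le_trans uU)// ler_norm.
set D := `|x' - x| + `|gam' - gam|.
pose dx := x' + n%:~R * gam' - (x + n%:~R * gam).
have dxB : `|dx| <= B * D.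
  rewrite /dx (_ : _ - _ = (x' - x) + n%:~R * (gam' - gam)); last by ring.
  apply: (le_trans (ler_normD _ _)); rewrite normrM /D mulrDr lerD ?ler_wpM2r//.
  by rewrite ler_peMl.
set y := u - birkhoff gam f n x.
have -> : lift gam' f g (x', u) - lift gam f g (x, u) =
   (lift gam' f g (x', u) - lift gam' f g (x', y + birkhoff gam' f n x')) +
   (lift gam' f g (x', y + birkhoff gam' f n x') - lift gam f g (x, u)) by ring.
have e1 : `|lift gam' f g (x', u) - lift gam' f g (x', y + birkhoff gam' f n x')| <=
   L * (B * (Cf * B)) * D.
  apply: (le_trans (lift_lip_u _ _ _ _)); rewrite -mulrA ler_wpM2l//.
  rewrite /y (_ : _ - _ = - (birkhoff gam' f n x' - birkhoff gam f n x)); last by ring.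
  rewrite normrN; apply: (le_trans (birkhoff_lip _ _ _ _ _)).
  rewrite -mulrA ler_pM// ?mulr_ge0 ?addr_ge0 ?mulr_ge0//.
  rewrite -mulrA ler_wpM2l// /D mulrDr lerD//; first by rewrite ler_peMl.
  by rewrite ler_wpM2r.
have y0f : 0 <= y < f (x + n%:~R * gam).
  by move: hn; rewrite birkhoffS /y; lra.
have e2 : `|lift gam' f g (x', y + birkhoff gam' f n x') - lift gam f g (x, u)| <=
    (L * (1 + Cf) * B + L * B) * D.
  rewrite -lift_shift (lift_eq hn) -/y.
  set z' := x' + n%:~R * gam'; set z := x + n%:~R * gam.
  have gz : `|g (z', y) - g (z, y)| <= L * `|dx|.
    by apply: (le_trans (gl _ _ _ _)); rewrite subrr normr0 addr0.
  have [yz|yz] := ltP y (f z').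
    have -> : lift gam' f g (z', y) = g (z', y).
      rewrite (@lift_eq _ _ _ 0) ?birkhoff0 ?subr0 ?mul0r ?addr0//.
      by rewrite birkhoffS birkhoff0 mul0r addr0 add0r; move: y0f yz; lra.
    apply: (le_trans gz); rewrite mulrDl -!mulrA.
    apply: ler_wpDl; first by rewrite !mulr_ge0// /D addr_ge0.
    by rewrite ler_wpM2l.
  (* Here [y] is under the roof at [z] but not at [z']. The lift is compared with its zero at
     [(z', f z')], and [g (z, y)] with [g (z', y) = 0]. *)
  have fz : f z - f z' <= Cf * `|dx|.
    by apply: (le_trans (ler_norm _)); rewrite distrC.
  have l0 : lift gam' f g (z', f z') = 0.
    rewrite (@lift_eq _ _ _ 1).
      by rewrite (birkhoffS _ _ 0) birkhoff0 mul0r addr0 add0r subrr g0// ltxx.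
    rewrite (birkhoffS _ _ 1) (birkhoffS _ _ 0) birkhoff0 mul0r addr0 add0r lexx/=.
    by rewrite ltrDl (lt_le_trans m00).
  have g0z : g (z', y) = 0 by apply: g0; rewrite negb_and -!leNgt yz orbT.
  rewrite g0z in gz.
  have -> : lift gam' f g (z', y) - g (z, y) =
     (lift gam' f g (z', y) - lift gam' f g (z', f z')) + (0 - g (z, y)).
    by rewrite l0; ring.
  apply: (le_trans (ler_normD _ _)); rewrite [leRHS]mulrDl; apply: lerD.
    apply: (le_trans (lift_lip_u _ _ _ _)); rewrite -!mulrA ler_wpM2l//.
    rewrite ger0_norm ?subr_ge0//.
    apply: (@le_trans _ _ (Cf * `|dx|)); first by move: y0f fz; rewrite -/z; lra.
    rewrite mulrDl mul1r; apply: ler_wpDl; first by rewrite !mulr_ge0// /D addr_ge0.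
    by rewrite ler_wpM2l.
  by apply: (le_trans gz); rewrite -mulrA ler_wpM2l.
apply: (le_trans (ler_normD _ _)).
rewrite -[X in _ <= X * _]addrA [leRHS]mulrDl; exact: lerD.
Qed.

End Lift.

Lemma lipschitz_continuous {R : realType} (h : R -> R) (C : R) :
  (forall x y, `|h x - h y| <= C * `|x - y|) -> continuous h.
Proof.
move=> hl x; apply/cvgrPdist_lt => e e0; near=> y.
apply: (le_lt_trans (hl x y)).
apply: (@le_lt_trans _ _ ((`|C| + 1) * `|x - y|)).
  by rewrite ler_wpM2r// (le_trans (ler_norm _))// lerDl.
rewrite mulrC -ltr_pdivlMr ?ltr_wpDl//.
by near: y; apply: (@nbhsx_ballx _ R x); rewrite divr_gt0// ltr_wpDl.
Unshelve. all: by end_near. Qed.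

(** * Invariant measures *)

Section LebesgueShift.
Context {R : realType}.
Local Notation m1 := (@lebesgue_measure R).

Lemma measurable_addr (c : R) : measurable_fun setT (fun x : R => x + c).
Proof. exact: measurable_funD. Qed.

Lemma lebesgue_shift (c : R) (A : set R) : measurable A ->
  m1 [set x | A (x + c)] = m1 A.
Proof.
move=> mA.
pose phi : measurableTypeR R -> measurableTypeR R := fun x => x + c.
have mphi : measurable_fun setT phi by exact: measurable_addr.
pose nu := pushforward m1 phi.
have := @lebesgue_measure_unique R (pushforward m1 phi) _ A mA.
move=> -> //.
move=> _ [[a b] _ <-]/=; rewrite /pushforward.
rewrite (_ : phi @^-1` _ = `]a - c, b - c]%classic); last first.
  by apply/seteqP; split => x; rewrite /phi/= !in_itv/=; lra.
rewrite !lebesgue_measure_itv/= !lte_fin ltrD2r.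
by case: ifP => // _; rewrite -!EFinB; congr EFin; ring.
Qed.

Lemma ge0_integral_shift (c : R) (A : set R) (H : R -> \bar R) :
  measurable A -> measurable_fun [set: R] H -> (forall x, (0 <= H x)%E) ->
  (\int[m1]_(x in [set x | A (x + c)%R]) H (x + c)%R = \int[m1]_(x in A) H x)%E.
Proof.
move=> mA mH H0.
pose phi : measurableTypeR R -> measurableTypeR R := fun x => x + c.
have mphi : measurable_fun setT phi by exact: measurable_addr.
have := @ge0_integral_pushforward _ _ _ _ R phi mphi m1 A H mA (measurable_funTS mH)
  (fun x _ => H0 x).
rewrite (_ : phi @^-1` A = [set x | A (x + c)%R])// => <-.
apply: eq_measure_integral => B mB _.
by rewrite /= /pushforward -[in RHS](lebesgue_shift c mB).
Qed.

Lemma measurable_frac : measurable_fun setT (@frac R).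
Proof.
move=> _ A mA; rewrite setTI.
rewrite (_ : _ @^-1` A = \bigcup_(n : int) ([set` `[n%:~R, (n + 1)%:~R[ ] `&`
    [set x : R | A (x + (- n%:~R))])).
  apply: countable_bigcupT_measurable => // n.
  apply: measurableI; first exact: measurable_itv.
  by rewrite -[X in measurable X]setTI; exact: measurable_addr.
apply/seteqP; split => x /=.
  by move=> Ax; exists (Num.floor x) => //; split => //=; rewrite in_itv/= floor_itv.
move=> [n _ []]; rewrite /= in_itv/= => h.
by rewrite /frac (floor_def h).
Qed.

(** The interval is cut at [1 - d]; the rotation translates the two pieces by [d] and by [d - 1],
    onto [[d, 1[] and [[0, d[]. *)
Lemma ge0_integral_rotation (c : R) (H : R -> \bar R) :
  measurable_fun [set: R] H -> (forall x, (0 <= H x)%E) ->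
  (\int[m1]_(x in `[0%R, 1%R[) H (frac (x + c)%R) = \int[m1]_(x in `[0%R, 1%R[) H x)%E.
Proof.
move=> mH H0; pose d := frac c.
have /andP[d0 d1] : 0 <= d < 1 by exact: frac_in01.
have fcE x : frac (x + c) = frac (x + d).
  by rewrite /d {3}/frac -mulrNz addrA fracDz.
have mf (e : R) : measurable_fun setT (fun x : R => H (x + e)).
  by apply: measurableT_comp => //; exact: measurable_addr.
rewrite (@itv_bndbnd_setU _ _ _ (BLeft (1 - d))); last 2 first.
  by rewrite bnd_simp subr_ge0 ltW.
  by rewrite bnd_simp gerBl.
rewrite ge0_integral_setU//=; last 2 first.
  apply: (measurable_funTS (D := `[0%R, 1 - d[ `|` `[1 - d, 1[)).
  apply: measurableT_comp => //; apply: measurableT_comp (measurable_addr c).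
  exact: measurable_frac.
  apply/disj_setPS => y /= [] /=; rewrite !in_itv/=; lra.
rewrite [X in (X + _ = _)%E](_ : _ = \int[m1]_(x in [set x | `[d, 1%R[%classic (x + d)%R]) H (x + d)%R)%E; last first.
  rewrite [X in _ = (\int[m1]_(x in X) _)%E](_ : _ = `[0, 1 - d[%classic); last first.
    by apply/seteqP; split => x; rewrite /= !in_itv/=; lra.
  apply: eq_integral => x; rewrite inE/= in_itv/= => h.
  by rewrite fcE frac_id//; lra.
rewrite [X in (_ + X = _)%E](_ : _ = \int[m1]_(x in [set x | `[0%R, d[%classic (x + (d - 1))%R]) H (x + (d - 1))%R)%E; last first.
  rewrite [X in _ = (\int[m1]_(x in X) _)%E](_ : _ = `[1 - d, 1[%classic); last first.
    by apply/seteqP; split => x; rewrite /= !in_itv/=; lra.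
  apply: eq_integral => x; rewrite inE/= in_itv/= => h.
  rewrite fcE; congr H.
  by rewrite -(fracDz (x + d) (-1)) frac_id ?rmorphN1//; lra.
rewrite !ge0_integral_shift// addeC -ge0_integral_setU//=; last 2 first.
  exact: measurable_funTS.
  apply/disj_setPS => y /= [] /=; rewrite !in_itv/=; lra.
have U (e : R) : 0 <= e <= 1 -> `[0, e[%classic `|` `[e, 1[%classic = `[0, 1[%classic :> set R.
  by move=> /andP[e0 e1]; rewrite -itv_bndbnd_setU// bnd_simp.
by rewrite !U//; lra.
Qed.

End LebesgueShift.

Notation plane R := (measurableTypeR R * measurableTypeR R)%type.

Definition vol (R : realType) : {measure set plane R -> \bar R} :=
  (@lebesgue_measure R \x @lebesgue_measure R)%E.

Section Skew.
Context {R : realType}.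
Local Notation m1 := (@lebesgue_measure R).
Local Notation mu := (@vol R).

Definition strip : set (R * R) := [set p | 0 <= p.1 < 1].

Lemma measurable_strip : measurable strip.
Proof.
rewrite (_ : strip = `[0, 1[%classic `*` setT); first exact: measurableX.
by apply/seteqP; split => -[x y]; rewrite /strip/= in_itv/=; tauto.
Qed.

(** On the points with a given number of returns, the flow at a given time is such a map
    ([flow_map]). *)
Definition skew (c : R) (s : R -> R) (p : R * R) : R * R := (frac (p.1 + c), p.2 + s p.1).

Lemma measurable_skew c s : measurable_fun setT s -> measurable_fun setT (skew c s).
Proof.
move=> ms; apply: measurable_fun_pair.
  apply: measurableT_comp; first exact: measurable_frac.
  by apply: measurable_funD => //; exact: measurable_fst.
apply: measurable_funD; first exact: measurable_snd.
by apply: measurableT_comp => //; exact: measurable_fst.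
Qed.

(** By Fubini over the base: the fibres are translated and the base is rotated, and both operations
    preserve Lebesgue measure. *)
Lemma vol_skew c s (A : set (R * R)) : measurable_fun setT s -> measurable A ->
  A `<=` strip -> mu (strip `&` skew c s @^-1` A) = mu A.
Proof.
move=> ms mA As.
have E (B : set (R * R)) : measurable B -> B `<=` strip ->
    (mu B = \int[m1]_(x in `[0%R, 1%R[) m1 (xsection B x))%E.
  move=> mB Bs; rewrite /vol /= /product_measure1 [RHS]integral_mkcond.
  apply: eq_integral => x _ /=; rewrite patchE; case: ifPn => // xn.
  rewrite (_ : xsection B x = set0) ?measure0//.
  apply/seteqP; split => // y; rewrite /xsection/= inE => /Bs; rewrite /strip/= => h.
  by move: xn; rewrite notin_setE/= in_itv/=.
have mS : measurable (strip `&` skew c s @^-1` A).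
  apply: measurableI; first exact: measurable_strip.
  by rewrite -[X in measurable X]setTI; exact: measurable_skew.
rewrite (E _ mS (@subIsetl _ _ _)) (E _ mA As).
pose H x := m1 (xsection A x).
have mH : measurable_fun setT H by exact: measurable_fun_xsection.
rewrite -(@ge0_integral_rotation R c H)//.
apply: eq_integral => x; rewrite inE/= in_itv/= => x01.
rewrite /H -[RHS](lebesgue_shift (s x)); last exact: measurable_xsection.
congr (m1 _); apply/seteqP; split => y; rewrite /xsection/= !inE/=.
  by move=> [].
by move=> h; split.
Qed.

Lemma vol_rect (a b c d : R) : a <= b -> c <= d ->
  mu ([set p | a <= p.1 < b] `&` [set p | c <= p.2 < d]) = ((b - a) * (d - c))%:E.
Proof.
have len (e h : R) : e <= h -> m1 `[e, h[%classic = (h - e)%:E.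
  move=> eh; rewrite lebesgue_measure_itv/= lte_fin; case: ltP => // he.
  by rewrite (_ : h = e) ?subrr//; apply/eqP; rewrite eq_le he eh.
move=> /len ab /len cd; rewrite EFinM -ab -cd.
rewrite (_ : _ `&` _ = `[a, b[%classic `*` `[c, d[%classic).
  exact: product_measure1E.
by apply/seteqP; split => -[x y] /=; rewrite !in_itv/=.
Qed.

Lemma vol_axis1 : mu [set p | p.1 = 0] = 0%E.
Proof.
rewrite (_ : [set p | p.1 = 0] = [set 0] `*` setT); last first.
  by apply/seteqP; split => -[x y] /=; [move=> ->|move=> []].
transitivity (m1 [set 0%R] * m1 setT)%E; first exact: product_measure1E.
by rewrite lebesgue_measure_set1 mul0e.
Qed.

Lemma vol_axis2 : mu [set p | p.2 = 0] = 0%E.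
Proof.
rewrite (_ : [set p | p.2 = 0] = setT `*` [set 0]); last first.
  by apply/seteqP; split => -[x y] /=; [move=> ->|move=> []].
transitivity (m1 setT * m1 [set 0%R])%E; first exact: product_measure1E.
by rewrite lebesgue_measure_set1 mule0.
Qed.

Lemma vol_fst_null (N : set R) : measurable N -> m1 N = 0%E ->
  mu [set p | N p.1] = 0%E.
Proof.
move=> mN N0; rewrite (_ : [set p | N p.1] = N `*` setT); last first.
  by apply/seteqP; split => -[x y] /=; [move=> ?|move=> []].
transitivity (m1 N * m1 setT)%E; first exact: product_measure1E.
by rewrite N0 mul0e.
Qed.

(** The test functions vanish on the axes, where the indicator they approximate may be [1]; their
    convergence is obtained off this null set. *)
Lemma ae_off_axes (Q : R * R -> Prop) :
  (forall x y, x != 0 -> y != 0 -> Q (x, y)) -> {ae mu, forall p, Q p}.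
Proof.
move=> hQ.
have ma1 : measurable ([set p : plane R | p.1 = 0]).
  rewrite (_ : mkset _ = [set 0] `*` setT); first exact: measurableX.
  by apply/seteqP; split => -[x y] /=; [move=> ->|move=> []].
have ma2 : measurable ([set p : plane R | p.2 = 0]).
  rewrite (_ : mkset _ = setT `*` [set 0]); first exact: measurableX.
  by apply/seteqP; split => -[x y] /=; [move=> ->|move=> []].
exists ([set p | p.1 = 0] `|` [set p | p.2 = 0]); split.
- exact: measurableU.
- exact: (null_set_setU ma1 ma2 vol_axis1 vol_axis2).
move=> [x y] /= nQ; apply: contrapT => /not_orP[x0 y0]; apply: nQ.
by apply: hQ; exact/eqP.
Qed.

End Skew.
#[global] Opaque vol.

Section FlowMeasure.
Context {R : realType} (f : R -> R) (m0 M0 Cf : R) (rf : roof f m0 M0 Cf).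
Local Notation mu := (@vol R).
Local Notation X := (phase f).
Implicit Types (gam t : R).

Lemma roof_measurable : measurable_fun [set: R] f.
Proof.
by apply: continuous_measurable_fun; exact: lipschitz_continuous (roof_lip rf).
Qed.

Lemma birkhoff_measurable gam n : measurable_fun [set: R] (birkhoff gam f n).
Proof.
apply: continuous_measurable_fun.
apply: (@lipschitz_continuous _ _ (`|n%:~R| * Cf)) => x y.
apply: (le_trans (birkhoff_lip rf _ _ _ _ _)).
by rewrite subrr normr0 mulr0 addr0 mulrA.
Qed.

Lemma measurable_le2 (u v : R * R -> R) : measurable_fun [set: R * R] u ->
  measurable_fun [set: R * R] v -> measurable [set p | u p <= v p].
Proof.
by move=> mu_ mv; rewrite -[X in measurable X]setTI; exact: measurable_fun_le.
Qed.

Lemma measurable_lt2 (u v : R * R -> R) : measurable_fun [set: R * R] u ->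
  measurable_fun [set: R * R] v -> measurable [set p | u p < v p].
Proof.
move=> mu_ mv; rewrite (_ : [set p | _] = ~` [set p | v p <= u p]); last first.
  by apply/seteqP; split => p /=; rewrite ltNge => /negP.
by apply: measurableC; exact: measurable_le2.
Qed.

Lemma measurable_fst_comp (h : R -> R) : measurable_fun [set: R] h ->
  measurable_fun [set: R * R] (fun p => h p.1).
Proof. by move=> mh; apply: measurableT_comp => //; exact: measurable_fst. Qed.

Lemma measurable_phase : measurable X.
Proof.
rewrite (_ : X = [set p | 0 <= p.1] `&` [set p | p.1 < 1] `&`
   ([set p | 0 <= p.2] `&` [set p | p.2 < f p.1])); last first.
  apply/seteqP; split => p; rewrite /phase/=.
    by move=> [/andP[-> ->] /andP[-> ->]].
  by move=> [[-> ->] [-> ->]].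
have mf := measurable_fst_comp roof_measurable.
by repeat apply: measurableI; (apply: measurable_le2 || apply: measurable_lt2) => //;
  (exact: measurable_fst || exact: measurable_snd).
Qed.

Definition flow_piece gam t (n : int) : set (R * R) :=
  [set p | birkhoff gam f n p.1 <= p.2 + t < birkhoff gam f (n + 1) p.1].

Lemma measurable_flow_piece gam t n : measurable (flow_piece gam t n).
Proof.
have ms : measurable_fun [set: R * R] (fun p : R * R => p.2 + t).
  by apply: measurable_funD => //; exact: measurable_snd.
rewrite (_ : flow_piece _ _ _ = [set p | birkhoff gam f n p.1 <= p.2 + t] `&`
    [set p | p.2 + t < birkhoff gam f (n + 1) p.1]).
  apply: measurableI; [apply: measurable_le2|apply: measurable_lt2] => //;
  apply: measurable_fst_comp; exact: birkhoff_measurable.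
by apply/seteqP; split => p /=; [move=> /andP[-> ->]|move=> [? ?]; apply/andP].
Qed.

Definition flow_map gam t (n : int) : R * R -> R * R :=
  skew (n%:~R * gam) (fun x => t - birkhoff gam f n x).

Lemma measurable_flow_shift gam t n :
  measurable_fun [set: R] (fun x => t - birkhoff gam f n x).
Proof. by apply: measurable_funB => //; exact: birkhoff_measurable. Qed.

Lemma sflow_pieceE gam t n p : flow_piece gam t n p ->
  sflow gam f t p = flow_map gam t n p.
Proof.
move=> h; rewrite sflowE (sflow0_eq rf h) /flow_map /skew.
by rewrite addrA.
Qed.

Lemma flow_piece_cover gam t p : exists n, flow_piece gam t n p.
Proof. exact: (flow_n_exists rf). Qed.

Lemma flow_piece_triv gam t : trivIset [set: int] (flow_piece gam t).
Proof.
move=> n k _ _ [p [hn hk]]; exact: (flow_n_uniq rf hn hk).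
Qed.

Lemma measurable_sflow gam t : measurable_fun [set: R * R] (sflow gam f t).
Proof.
move=> _ A mA; rewrite setTI.
rewrite (_ : _ @^-1` A = \bigcup_(n : int) (flow_piece gam t n `&` flow_map gam t n @^-1` A)).
  apply: countable_bigcupT_measurable => // n; apply: measurableI.
    exact: measurable_flow_piece.
  rewrite -[X in measurable X]setTI; apply: measurable_skew => //.
  exact: measurable_flow_shift.
apply/seteqP; split => p /=.
  by have [n hn] := flow_piece_cover gam t p; rewrite (sflow_pieceE hn) => h; exists n.
by move=> [n _ [hn /=]]; rewrite (sflow_pieceE hn).
Qed.

Lemma measure_bigcup_int (F G : int -> set (R * R)) :
  (forall n, measurable (F n)) -> (forall n, measurable (G n)) ->
  trivIset setT F -> trivIset setT G -> (forall n, mu (F n) = mu (G n)) ->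
  mu (\bigcup_n F n) = mu (\bigcup_n G n).
Proof.
move=> mF mG tF tG FG.
(* The integer index is renumbered by [pickle]; codes of no integer contribute the empty set. *)
pose F' (H : int -> set (R * R)) k := if pickle_inv k is Some n then H n else set0.
have E H : \bigcup_n H n = \bigcup_k F' H k.
  apply/seteqP; split => p.
    by move=> [n _ h]; exists (pickle n); [exact: I|rewrite /F' pickleK_inv].
  by move=> [k _]; rewrite /F'; case: pickle_inv => [n h|[]]; exists n.
have mF' H : (forall n, measurable (H n)) -> forall k, setT k -> measurable (F' H k).
  by move=> mH k _; rewrite /F'; case: pickle_inv.
have tF' H : trivIset setT H -> trivIset setT (F' H).
  move=> tH i j _ _ [p []]; rewrite /F'.
  case Ei : (pickle_inv i) => [n|//]; case Ej : (pickle_inv j) => [k|//] hn hk.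
  have nk : n = k by apply: tH => //; exists p.
  have := @pickle_invK int i; have := @pickle_invK int j.
  by rewrite Ei Ej /= nk => -> ->.
rewrite !E.
have EF := measure_bigcup mu _ _ (mF' _ mF) (tF' _ tF).
have EG := measure_bigcup mu _ _ (mF' _ mG) (tF' _ tG).
transitivity (\sum_(0 <= i <oo | i \in setT) mu (F' F i))%E; first exact: EF.
transitivity (\sum_(0 <= i <oo | i \in setT) mu (F' G i))%E; last exact: esym EG.
by apply: eq_eseriesr => k _; rewrite /F'; case: pickle_inv.
Qed.

(** The phase space is cut by the number [n] of returns. On each piece the flow is a skew map, and
    the image in [A] consists of the points making [- n] returns under the backward flow, so the
    images are disjoint as well. *)
Lemma vol_sflow gam t (A : set (R * R)) : measurable A -> A `<=` X ->
  mu (X `&` sflow gam f t @^-1` A) = mu A.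
Proof.
move=> mA AX.
have mX := measurable_phase.
pose F n := X `&` flow_piece gam t n `&` flow_map gam t n @^-1` A.
pose G n := A `&` flow_piece gam (- t) (- n).
have mfm n : measurable (flow_map gam t n @^-1` A).
  rewrite -[X in measurable X]setTI; apply: measurable_skew => //.
  exact: measurable_flow_shift.
have mF n : measurable (F n).
  by apply: measurableI => //; apply: measurableI => //; exact: measurable_flow_piece.
have mG n : measurable (G n).
  by apply: measurableI => //; exact: measurable_flow_piece.
have FE : X `&` sflow gam f t @^-1` A = \bigcup_n F n.
  apply/seteqP; split => p /=.
    have [n hn] := flow_piece_cover gam t p.
    by rewrite (sflow_pieceE hn) => -[h1 h2]; exists n.
  by move=> [n _ [[h1 h2] h3]]; rewrite (sflow_pieceE h2).
have GE : A = \bigcup_n G n.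
  apply/seteqP; split => p /=; last by move=> [n _ []].
  have [n hn] := flow_piece_cover gam (- t) p.
  by move=> Ap; exists (- n) => //; rewrite /G opprK.
rewrite FE [in RHS]GE; apply: measure_bigcup_int => //.
- move=> i j _ _ [p [[[_ h1] _] [[_ h2] _]]].
  by apply: (flow_piece_triv (gam := gam) (t := t)) => //; exists p.
- move=> i j _ _ [p [[_ h1] [_ h2]]]; apply: oppr_inj.
  by apply: (flow_piece_triv (gam := gam) (t := - t)) => //; exists p.
move=> n.
have GX : G n `<=` strip by move=> p [/AX[]].
rewrite -(@vol_skew _ (n%:~R * gam) _ _ (measurable_flow_shift gam t n) (mG n) GX).
congr (mu _).
have e1 x : birkhoff gam f (- n) (frac (x + n%:~R * gam)) = - birkhoff gam f n x.
  rewrite (periodic1_frac (f := birkhoff gam f (- n))) ?birkhoffN// => z.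
  by have := birkhoff_periodic gam (- n) 1 z (roof_per rf).
have e2 x : birkhoff gam f (- n + 1) (frac (x + n%:~R * gam)) = - birkhoff gam f n x + f x.
  rewrite birkhoffS e1; congr (_ + _).
  rewrite {1}/frac -[- _%:~R]mulrNz addrAC periodic1_int; last exact: roof_per rf.
  by rewrite rmorphN/= mulNr addrK.
apply/seteqP; split => -[x y].
  move=> [[[/= x01 y0] h2] h3]; split; first exact: x01.
  split; first exact: h3.
  by rewrite /flow_piece /flow_map /skew/= e1 e2; lra.
move=> [/= x01 [h3]]; rewrite /flow_piece /flow_map /skew/= e1 e2 => h.
have [_ /=] := AX _ h3; rewrite periodic1_frac; last exact: roof_per rf.
move=> h4; split; last exact: h3.
split; first by split => //=; lra.
by rewrite /flow_piece/= birkhoffS; lra.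
Qed.

Lemma roof_M0 : 0 < M0.
Proof. exact: lt_le_trans (roof_m0 rf) (le_trans (roof_ge rf 0) (roof_le rf 0)). Qed.

Lemma vol_phase_lty : (mu X < +oo)%E.
Proof.
have h : X `<=` [set p | 0 <= p.1 < 1] `&` [set p | 0 <= p.2 < M0].
  move=> p [h1 h2]; split => //=; have := roof_le rf p.1; lra.
apply: (@le_lt_trans _ _ (mu ([set p | 0 <= p.1 < 1] `&` [set p | 0 <= p.2 < M0]))).
  apply: le_measure => //; rewrite inE; first exact: measurable_phase.
  have := measurableX (measurable_itv `[(0 : R), 1[) (measurable_itv `[0, M0[).
  by congr (measurable _); apply/seteqP; split => -[x y] /=; rewrite !in_itv/=.
by rewrite vol_rect ?(ltW roof_M0)// ltry.
Qed.

Definition area : R := fine (mu X).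

Lemma vol_phaseE : mu X = area%:E.
Proof. by rewrite /area fineK// ge0_fin_numE// vol_phase_lty. Qed.

Lemma area_gt0 : 0 < area.
Proof.
have m00 := roof_m0 rf.
rewrite -lte_fin -vol_phaseE.
have h : [set p | 0 <= p.1 < 1] `&` [set p | 0 <= p.2 < m0] `<=` X.
  move=> p [h1 h2]; split => //=; have := roof_ge rf p.1; move: h2 => /=; lra.
apply: (@lt_le_trans _ _ (mu ([set p | 0 <= p.1 < 1] `&` [set p | 0 <= p.2 < m0]))).
  by rewrite vol_rect ?(ltW m00)// lte_fin subr0 mul1r subr0.
apply: le_measure => //; rewrite inE; last exact: measurable_phase.
have := measurableX (measurable_itv `[(0 : R), 1[) (measurable_itv `[0, m0[).
by congr (measurable _); apply/seteqP; split => -[x y] /=; rewrite !in_itv/=.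
Qed.

End FlowMeasure.

(** * Square-integrable functions *)

Section InnerProduct.
Import HBNNSimple.
Context d (T : measurableType d) (R : realType) (mu : {measure set T -> \bar R}).
Context (D : set T) (mD : measurable D) (finD : (mu D < +oo)%E).
Implicit Types (g h k : T -> R) (c : R).

Definition sq_integrable g := measurable_fun D g /\ mu.-integrable D (EFin \o (fun p => g p ^+ 2)).

Definition inner g h : R := Rintegral mu D (fun p => g p * h p).

Definition sqnorm g : R := inner g g.

Lemma sqint_bounded g C : measurable_fun D g -> (forall p, D p -> `|g p| <= C) -> sq_integrable g.
Proof.
move=> mg gC; split => //.
apply: measurable_bounded_integrable => //; first exact: measurable_funX.
exists (C ^+ 2); split; first exact: num_real.
move=> x Cx p Dp; rewrite /= normrX (le_trans _ (ltW Cx))//.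
rewrite lerXn2r ?nnegrE//; last exact: gC.
exact: le_trans (normr_ge0 _) (gC _ Dp).
Qed.

Lemma sqint_cst c : sq_integrable (fun=> c).
Proof. by apply: (@sqint_bounded _ `|c|). Qed.

Lemma sqint_integrableM g h : sq_integrable g -> sq_integrable h ->
  mu.-integrable D (EFin \o (fun p => g p * h p)).
Proof.
move=> [mg ig] [mh ih].
have := integrableD mD ig ih; apply: le_integrable => //.
  by apply/measurable_EFinP; exact: measurable_funM.
move=> p Dp /=; rewrite lee_fin normrM [leRHS]ger0_norm ?addr_ge0 ?sqr_ge0//.
have := sqr_ge0 (`|g p| - `|h p|); rewrite sqrrB !real_normK ?num_real//.
rewrite mulr2n; have : 0 <= `|g p| * `|h p| by rewrite mulr_ge0.
move: (`|g p| * `|h p|) => z; lra.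
Qed.

Lemma sqint_integrable g : sq_integrable g -> mu.-integrable D (EFin \o g).
Proof.
move=> sg; have := sqint_integrableM sg (sqint_cst 1).
by apply: eq_integrable => // p _ /=; rewrite mulr1.
Qed.

Lemma sqint_eq g h : {in D, g =1 h} -> sq_integrable g -> sq_integrable h.
Proof.
move=> gh [mg ig]; split; first exact: eq_measurable_fun mg.
by apply: eq_integrable ig => // p /gh /= ->.
Qed.

Lemma sqintD c g h : sq_integrable g -> sq_integrable h -> sq_integrable (fun p => c * g p + h p).
Proof.
move=> sg sh; have [mg ig] := sg; have [mh ih] := sh.
have mm : measurable_fun D (fun p => c * g p + h p).
  by apply: measurable_funD => //; apply: measurable_funM.
split => //.
have i1 := integrableZl mD (c ^+ 2) ig.
have i2 := integrableZl mD (2 * c) (sqint_integrableM sg sh).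
have := integrableD mD (integrableD mD i1 i2) ih.
apply: eq_integrable => // p _ /=; rewrite -!EFinM -!EFinD; congr EFin; ring.
Qed.

Lemma sqintZ c g : sq_integrable g -> sq_integrable (fun p => c * g p).
Proof.
move=> sg; have := sqintD c sg (sqint_cst 0).
by apply: sqint_eq => p _; rewrite addr0.
Qed.

Lemma sqintB g h : sq_integrable g -> sq_integrable h -> sq_integrable (fun p => g p - h p).
Proof.
move=> sg sh; have := sqintD (-1) sh sg.
by apply: sqint_eq => p _; rewrite mulN1r addrC.
Qed.

Lemma ip_eq g g' h h' : {in D, g =1 g'} -> {in D, h =1 h'} -> inner g h = inner g' h'.
Proof. by move=> gg hh; apply: eq_Rintegral => p pD; rewrite gg// hh. Qed.

Lemma ipC g h : inner g h = inner h g.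
Proof. by apply: eq_Rintegral => p _; rewrite mulrC. Qed.

Lemma ipDl c g h k : sq_integrable g -> sq_integrable h -> sq_integrable k ->
  inner (fun p => c * g p + h p) k = c * inner g k + inner h k.
Proof.
move=> sg sh sk; rewrite /inner.
have i1 := sqint_integrableM sg sk; have i2 := sqint_integrableM sh sk.
rewrite -RintegralZl// -RintegralD//; last exact: (integrableZl mD c i1).
by apply: eq_Rintegral => p _; ring.
Qed.

Lemma ipDr c g h k : sq_integrable g -> sq_integrable h -> sq_integrable k ->
  inner k (fun p => c * g p + h p) = c * inner k g + inner k h.
Proof. by move=> sg sh sk; rewrite ipC ipDl// !(ipC k). Qed.

Lemma ipBl g h k : sq_integrable g -> sq_integrable h -> sq_integrable k ->
  inner (fun p => g p - h p) k = inner g k - inner h k.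
Proof.
move=> sg sh sk.
rewrite (@ip_eq _ (fun p => -1 * h p + g p) _ k) ?ipDl ?mulN1r 1?addrC//.
by move=> p _; rewrite mulN1r addrC.
Qed.

Lemma ipBr g h k : sq_integrable g -> sq_integrable h -> sq_integrable k ->
  inner k (fun p => g p - h p) = inner k g - inner k h.
Proof. by move=> sg sh sk; rewrite ipC ipBl// !(ipC k). Qed.

Lemma ipZl c g k : sq_integrable g -> sq_integrable k -> inner (fun p => c * g p) k = c * inner g k.
Proof.
move=> sg sk; rewrite (@ip_eq _ (fun p => c * g p + 0) _ k)//; last first.
  by move=> p _; rewrite addr0.
rewrite ipDl//; last exact: sqint_cst.
rewrite [X in _ + X](_ : _ = 0) ?addr0//.
rewrite /inner (@eq_Rintegral _ _ _ _ _ (fun=> 0)) ?Rintegral_cst ?mul0r//.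
by move=> p _; rewrite mul0r.
Qed.

Lemma sqn_ge0 g : 0 <= sqnorm g.
Proof. by apply: Rintegral_ge0 => p _; rewrite -expr2 sqr_ge0. Qed.

Lemma sqnD c g h : sq_integrable g -> sq_integrable h ->
  sqnorm (fun p => c * g p + h p) = c ^+ 2 * sqnorm g + 2 * c * inner g h + sqnorm h.
Proof.
move=> sg sh; have sgh := sqintD c sg sh.
by rewrite /sqnorm ipDl// !ipDr// (ipC h g); ring.
Qed.

Lemma cauchy_schwarz g h : sq_integrable g -> sq_integrable h -> inner g h ^+ 2 <= sqnorm g * sqnorm h.
Proof.
move=> sg sh.
have key c : 0 <= c ^+ 2 * sqnorm g + 2 * c * inner g h + sqnorm h.
  by rewrite -sqnD//; exact: sqn_ge0.
have := sqn_ge0 g; rewrite le_eqVlt => /predU1P[g0|g0].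
  rewrite -g0 mul0r leNgt; apply/negP => i0.
  have i00 : inner g h != 0 by apply: contraTneq i0 => ->; rewrite expr0n ltxx.
  (* With [sqnorm g = 0] the quadratic is affine in [c], and this value of [c] makes it [-1]. *)
  have := key (- (sqnorm h + 1) / (2 * inner g h)); rewrite -g0 mulr0 add0r.
  rewrite (_ : 2 * _ * inner g h = - (sqnorm h + 1)); last by field.
  lra.
have := key (- inner g h / sqnorm g).
rewrite (_ : _ + _ = (sqnorm g * sqnorm h - inner g h ^+ 2) / sqnorm g); last by field; rewrite gt_eqF.
by rewrite pmulr_lge0 ?invr_gt0// subr_ge0.
Qed.

Definition norm2 g := Num.sqrt (sqnorm g).

Lemma nrm_ge0 g : 0 <= norm2 g. Proof. exact: sqrtr_ge0. Qed.

Lemma nrm_sqr g : norm2 g ^+ 2 = sqnorm g. Proof. by rewrite sqr_sqrtr// sqn_ge0. Qed.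

Lemma ip_le_nrm g h : sq_integrable g -> sq_integrable h -> `|inner g h| <= norm2 g * norm2 h.
Proof.
move=> sg sh; rewrite -(@ler_pXn2r _ 2)// ?nnegrE ?mulr_ge0 ?nrm_ge0//.
by rewrite exprMn !nrm_sqr real_normK ?num_real// cauchy_schwarz.
Qed.

Lemma nrmB_le g h : sq_integrable g -> sq_integrable h -> norm2 g <= norm2 h + norm2 (fun p => g p - h p).
Proof.
move=> sg sh; have sB := sqintB sg sh.
rewrite -(@ler_pXn2r _ 2)// ?nnegrE ?addr_ge0 ?nrm_ge0//.
rewrite nrm_sqr (_ : sqnorm g = sqnorm (fun p => 1 * (g p - h p) + h p)); last first.
  by apply: ip_eq => p _; rewrite mul1r subrK.
rewrite sqnD// -!nrm_sqr sqrrD.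
have := ip_le_nrm sB sh; have := ler_norm (inner (fun p => g p - h p) h).
rewrite mulr2n; lra.
Qed.

Lemma sqn_bounded g C : 0 <= C -> measurable_fun D g -> (forall p, D p -> `|g p| <= C) ->
  sqnorm g <= C ^+ 2 * fine (mu D).
Proof.
move=> C0 mg gC; have sg := sqint_bounded mg gC.
rewrite -Rintegral_cst//; apply: le_Rintegral => //.
- exact: sqint_integrableM.
- have := sqint_integrable (sqint_cst (C ^+ 2)); exact.
move=> p Dp; rewrite -expr2 -[leLHS]ger0_norm ?sqr_ge0// normrX.
by rewrite lerXn2r ?nnegrE//; exact: gC.
Qed.

Lemma sqint_dominated (phi : nat -> T -> R) g h :
  (forall n, measurable_fun D (phi n)) -> measurable_fun D g -> sq_integrable h ->
  (forall n p, D p -> `|g p - phi n p| <= `|h p|) ->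
  {ae mu, forall p, D p -> phi ^~ p @ \oo --> g p} ->
  (fun n => sqnorm (fun p => g p - phi n p)) @ \oo --> (0 : R).
Proof.
move=> mphi mg [mh ih] dom cv.
have mphi2 n : measurable_fun D (fun p => ((g p - phi n p) ^+ 2)%:E).
  by apply/measurable_EFinP; apply: measurable_funX; exact: measurable_funB.
have m0 : measurable_fun D (cst 0%E : T -> \bar R) by exact: measurable_cst.
have cv2 : {ae mu, forall p, D p -> (fun n => ((g p - phi n p) ^+ 2)%:E) @ \oo --> 0%E}.
  apply: filterS cv => p cp Dp; apply: cvg_EFin; first by near=> n.
  have h1 : (fun n => g p - phi n p) @ \oo --> g p - g p.
    by apply: cvgB (cp Dp); exact: cvg_cst.
  have h2 : (fun n => (g p - phi n p) * (g p - phi n p)) @ \oo --> (g p - g p) * (g p - g p).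
    exact: cvgM.
  move: h2; rewrite subrr mulr0; apply: cvg_trans.
  by apply: near_eq_cvg; near=> n; rewrite /= expr2.
have dom2 : {ae mu, forall p n, D p -> (`|((g p - phi n p) ^+ 2)%:E| <= (h p ^+ 2)%:E)%E}.
  apply: aeW => p n Dp; rewrite /= lee_fin normrX -[leRHS]ger0_norm ?sqr_ge0// normrX.
  by rewrite lerXn2r ?nnegrE//; exact: dom.
have [_ _] := dominated_convergence mD mphi2 m0 cv2 ih dom2.
rewrite integral0 => /fine_cvg; apply: cvg_trans.
apply: near_eq_cvg; near=> n => /=; rewrite /sqnorm /inner /Rintegral.
by congr fine; apply: eq_integral => p _; rewrite expr2.
Unshelve. all: by end_near. Qed.

(** From indicators the property passes to simple functions by linearity, to nonnegative functions
    by monotone approximation, and to all functions by positive and negative parts. *)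
Lemma sqint_ind_indic (P : (T -> R) -> Prop) :
  (forall A, measurable A -> P (\1_A : T -> R)) ->
  (forall c g h, sq_integrable g -> sq_integrable h -> P g -> P h -> P (fun p => c * g p + h p)) ->
  (forall g (phi : nat -> T -> R), sq_integrable g -> (forall n, sq_integrable (phi n)) ->
     (forall n, P (phi n)) ->
     (fun n => sqnorm (fun p => g p - phi n p)) @ \oo --> (0 : R) -> P g) ->
  forall g, sq_integrable g -> P g.
Proof.
move=> Pi Pl Pc.
have si A : measurable A -> sq_integrable (\1_A : T -> R).
  move=> mA; apply: (@sqint_bounded _ 1); first exact: measurable_indic.
  by move=> p _; rewrite indicE; case: (p \in A); rewrite ?normr1 ?normr0 ?ler01.
have P0 : P (fun=> 0).
  have := Pl (-1) _ _ (si _ measurableT) (si _ measurableT) (Pi _ measurableT) (Pi _ measurableT).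
  by congr P; apply/funext => p; rewrite mulN1r addNr.
have Psf (s : {nnsfun T >-> R}) : P s /\ sq_integrable s.
  have E : (s : T -> R) = fun p => \sum_(y <- finmap.enum_fset (fset_set (range s))) y * \1_(s @^-1` [set y]) p.
    by apply/funext => p; rewrite fimfunE fsbig_finite.
  rewrite E; elim: (finmap.enum_fset (fset_set (range s))) => [|y l [Pl1 sl1]].
    have -> : (fun p : T => \sum_(y <- [::]) y * \1_(s @^-1` [set y]) p) = fun=> 0 :> R.
      by apply/funext => p; rewrite big_nil.
    by split => //; exact: sqint_cst.
  have -> : (fun p : T => \sum_(z <- y :: l) z * \1_(s @^-1` [set z]) p) =
      fun p => y * \1_(s @^-1` [set y]) p + \sum_(z <- l) z * \1_(s @^-1` [set z]) p.
    by apply/funext => p; rewrite big_cons.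
  have my : measurable (s @^-1` [set y]) by exact: measurable_sfunP.
  by split; [apply: Pl => //; [exact: si|exact: Pi]|apply: sqintD => //; exact: si].
have Pnn g : sq_integrable g -> (forall p, 0 <= g p) -> P g.
  move=> sg g0; have [mg ig] := sg.
  have mEg : measurable_fun D (EFin \o g) by exact/measurable_EFinP.
  have [phi [nd cphi]] := approximation mD mEg (fun p _ => g0 p).
  have cphi' p : D p -> phi ^~ p @ \oo --> g p by move=> Dp; exact: fine_cvg (cphi p Dp).
  have le n p : D p -> phi n p <= g p.
    move=> Dp; have := @nondecreasing_cvgn_le _ (phi ^~ p).
    rewrite (cvg_lim _ (cphi' p Dp))//; apply.
      by move=> a b ab; have /lefP := nd _ _ ab; exact.
    exact: cphi'.
  apply: (Pc g (fun n => phi n)) => //; [by move=> n; exact: (Psf _).2|by move=> n; exact: (Psf _).1|].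
  apply: (sqint_dominated (h := g)) => //.
  - by move=> n; apply: measurable_funTS; exact: measurable_funP.
  - move=> n p Dp; rewrite !ger0_norm// ?subr_ge0 ?le// gerBl.
    exact: fun_ge0.
  - by apply: aeW => p Dp; exact: cphi'.
move=> g sg; have [mg ig] := sg.
have sp : sq_integrable g^\+.
  split; first exact: measurable_funrpos.
  apply: le_integrable ig => //.
    by apply/measurable_EFinP; apply: measurable_funX; exact: measurable_funrpos.
  move=> p Dp /=; rewrite lee_fin !normrX lerXn2r ?nnegrE// /funrpos maxEle.
  by case: ifP => //; rewrite normr0.
have sn : sq_integrable g^\-.
  split; first exact: measurable_funrneg.
  apply: le_integrable ig => //.
    by apply/measurable_EFinP; apply: measurable_funX; exact: measurable_funrneg.
  move=> p Dp /=; rewrite lee_fin !normrX lerXn2r ?nnegrE// /funrneg maxEle.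
  by case: ifP => _; rewrite ?normr0// normrN.
have := Pl (-1) _ _ sn sp (Pnn _ sn (funrneg_ge0 g)) (Pnn _ sp (funrpos_ge0 g)).
congr P; apply/funext => p.
by rewrite mulN1r addrC -[in RHS](funrposBneg g).
Qed.

End InnerProduct.

(** * Test functions and their density *)

Lemma min_lip {R : realType} (a b c d e : R) : `|a - c| <= e -> `|b - d| <= e ->
  `|Num.min a b - Num.min c d| <= e.
Proof.
rewrite !ler_norml => /andP[h1 h2] /andP[h3 h4].
by case: (leP a b) => ?; case: (leP c d) => ?; apply/andP; split; lra.
Qed.

Lemma max_lip {R : realType} (a b c d e : R) : `|a - c| <= e -> `|b - d| <= e ->
  `|Num.max a b - Num.max c d| <= e.
Proof.
rewrite !ler_norml => /andP[h1 h2] /andP[h3 h4].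
by case: (leP a b) => ?; case: (leP c d) => ?; apply/andP; split; lra.
Qed.

Section Bump.
Context {R : realType} (f : R -> R) (m0 M0 Cf : R) (rf : roof f m0 M0 Cf).
Implicit Types (a c x y : R) (k : nat).

(** The cap [Num.min a 1] makes it vanish at both ends of the period, so that it is continuous on
    the circle. *)
Definition tent a x : R :=
  Num.max 0 (Num.min (frac x) (Num.min a 1 - frac x)).

Definition height c x y : R := Num.max 0 (Num.min y (Num.min (c - y) (f x - y))).

(** [k] times a Lipschitz function that is positive exactly on the interior of the part [x < a],
    [y < c] of the phase space, truncated at [1]: for large [k] it is close to the indicator of that
    part. *)
Definition bump a c k (p : R * R) : R :=
  Num.min 1 (k%:R * Num.min (tent a p.1) (height c p.1 p.2)).

Lemma tent_ge0 a x : 0 <= tent a x. Proof. by rewrite /tent le_max lexx. Qed.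

Lemma height_ge0 c x y : 0 <= height c x y. Proof. by rewrite /height le_max lexx. Qed.

Lemma tent_lip a x x' : `|tent a x - tent a x'| <= `|x - x'|.
Proof.
rewrite -[leRHS]mul1r.
have a1 : Num.min a 1 <= 1 by rewrite ge_min lexx orbT.
apply: (@glue_lipschitz _ (tent a) (fun n => n%:~R) (fun x => Num.floor x)) => //.
- by move=> n k; rewrite ler_int.
- by move=> u; rewrite floor_itv.
- move=> u v E; rewrite mul1r; apply: max_lip; first by rewrite subrr normr0.
  apply: min_lip; rewrite /frac E; first by rewrite opprB addrA subrK.
  rewrite (_ : _ - _ - _ = v - u); last by ring.
  by rewrite distrC.
- move=> u; rewrite mul1r ger0_norm ?tent_ge0// /tent -/(frac u).
  have := frac_in01 u; rewrite ge_max ge_min lexx /= => /andP[-> _].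
  by [].
- move=> u; rewrite mul1r ger0_norm ?tent_ge0// /tent.
  have := frac_in01 u; rewrite ge_max ge_min /frac intrD => h.
  apply/andP; split; first lra.
  by apply/orP; right; lra.
Qed.

Lemma bump_nice a c k : nice f (k%:R * (1 + Cf)) (bump a c k).
Proof.
have C0 := roof_C0 rf.
split.
- move=> p; rewrite ger0_norm ?ge_min ?lexx// /bump le_min ler01/=.
  by rewrite mulr_ge0// le_min tent_ge0 height_ge0.
- move=> x y; rewrite /bump/= /tent /height (roof_per rf).
  by have /= -> := fracDz x 1.
- move=> x y h; rewrite /bump /height/=.
  rewrite (_ : Num.max 0 _ = 0).
    rewrite (_ : Num.min (tent a x) 0 = 0); last by apply/min_idPr; exact: tent_ge0.
    by rewrite mulr0; apply/min_idPr.
  apply/max_idPl; rewrite !ge_min; move: h; rewrite negb_and -!leNgt => /orP[->//|h].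
  by apply/orP; right; apply/orP; right; rewrite subr_le0.
- move=> x y x' y'; rewrite /bump/=.
  have e0 : 0 <= k%:R * (1 + Cf) * (`|x - x'| + `|y - y'|).
    by rewrite !mulr_ge0// ?addr_ge0.
  apply: min_lip; first by rewrite subrr normr0.
  rewrite -mulrBr normrM normr_nat -mulrA ler_wpM2l//.
  have n1 := normr_ge0 (x - x'); have n2 := normr_ge0 (y - y').
  have e1 : `|x - x'| <= (1 + Cf) * (`|x - x'| + `|y - y'|) by nra.
  have e2 : `|y - y'| <= (1 + Cf) * (`|x - x'| + `|y - y'|) by nra.
  apply: min_lip; first exact: le_trans (tent_lip _ _ _) e1.
  apply: max_lip; first by rewrite subrr normr0 (le_trans _ e1).
  apply: min_lip => //; apply: min_lip.
    by rewrite (_ : c - y - (c - y') = y' - y) 1?distrC//; ring.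
  rewrite (_ : f x - y - _ = (f x - f x') - (y - y')); last by ring.
  apply: (le_trans (ler_normB _ _)); have := roof_lip rf x x'; nra.
Qed.

(** Parameters strictly below [a] and [c] keep the functions zero wherever the indicator is zero,
    and they can be rational while [a] and [c] are arbitrary reals. *)
Lemma bump_cvg a c (an cn : nat -> R) x y : phase f (x, y) -> x != 0 -> y != 0 ->
  (forall n, an n < a) -> (forall n, cn n < c) -> an @ \oo --> a -> cn @ \oo --> c ->
  (fun n => bump (an n) (cn n) n (x, y)) @ \oo --> (\1_([set p : R * R | p.1 < a /\ p.2 < c]) (x, y) : R).
Proof.
move=> [/= /andP[x0 x1] /andP[y0 yf]] xn0 yn0 ana cnc ca cc.
have {}x0 : 0 < x by rewrite lt_neqAle eq_sym xn0.
have {}y0 : 0 < y by rewrite lt_neqAle eq_sym yn0.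
have fx : frac x = x by apply: frac_id; rewrite ltW.
rewrite indicE; case: (boolP (_ \in _)) => [|]; rewrite ?notin_setE ?inE/=.
  move=> [xa yc].
  (* Built from the distances of the point to the faces of the region, halved where the face moves
     with [n]. For large [n] the tent and the height are at least [d], and [n >= 1 / d] reaches the
     truncation. *)
  pose d := Num.min (Num.min x (Num.min ((a - x) / 2) (1 - x))) (Num.min y (Num.min ((c - y) / 2) (f x - y))).
  have d0 : 0 < d by rewrite !lt_min x0 y0 !subr_gt0 x1 yf !divr_gt0 ?subr_gt0.
  apply: cvg_near_cst; near=> n.
  have h1 : (a + x) / 2 < an n by near: n; apply: (cvgr_gt _ ca); lra.
  have h2 : (c + y) / 2 < cn n by near: n; apply: (cvgr_gt _ cc); lra.
  have h3 : d^-1 <= n%:R by near: n; exact: nbhs_infty_ger.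
  have dx : d <= x by rewrite /d !ge_min lexx.
  have da : d <= (a - x) / 2 by rewrite /d !ge_min lexx !orbT.
  have d1 : d <= 1 - x by rewrite /d !ge_min lexx !orbT.
  have dy : d <= y by rewrite /d !ge_min lexx !orbT.
  have dc : d <= (c - y) / 2 by rewrite /d !ge_min lexx !orbT.
  have df : d <= f x - y by rewrite /d !ge_min lexx !orbT.
  apply/min_idPl; rewrite /=.
  apply: (@le_trans _ _ (n%:R * d)); first by rewrite -ler_pdivrMr// div1r.
  rewrite ler_wpM2l// le_min /tent /height fx !le_max; apply/andP; split; apply/orP; right.
    by rewrite le_min dx/= lerBrDl le_min; clear -h1 da d1; lra.
  by rewrite !le_min dy df andbT/=; clear -h2 dc; lra.
move=> h; apply: cvg_near_cst; near=> n.
rewrite /bump/=; suff -> : Num.min (tent (an n) x) (height (cn n) x y) = 0.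
  by rewrite mulr0; apply/min_idPr.
have [xa|xa] := leP a x.
  have -> : tent (an n) x = 0.
    apply/max_idPl; rewrite !ge_min fx subr_le0; apply/orP; right.
    by rewrite ge_min (ltW (lt_le_trans (ana n) xa)).
  by apply/min_idPl; exact: height_ge0.
have yc : c <= y by rewrite leNgt; apply/negP => yc; apply: h.
have -> : height (cn n) x y = 0.
  apply/max_idPl; rewrite !ge_min subr_le0; apply/orP; right.
  by rewrite (ltW (lt_le_trans (cnc n) yc)).
by apply/min_idPr; exact: tent_ge0.
Unshelve. all: by end_near. Qed.

End Bump.

Section Density.
Context {R : realType} (f : R -> R) (m0 M0 Cf : R) (rf : roof f m0 M0 Cf).
Local Notation mu := (@vol R).
Local Notation X := (phase f).
Local Notation sqint := (@sq_integrable _ (plane R) R mu X).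
Local Notation sqn := (@sqnorm _ (plane R) R mu X).

Lemma phase_measurable : measurable (X : set (plane R)).
Proof. exact: (measurable_phase rf). Qed.

Lemma phase_lty : (mu X < +oo)%E. Proof. exact: (vol_phase_lty rf). Qed.

Lemma bump_measurable a c k : measurable_fun [set: plane R] (bump f a c k).
Proof.
have m1 : measurable_fun [set: plane R] (fun p => p.1) by exact: measurable_fst.
have m2 : measurable_fun [set: plane R] (fun p => p.2) by exact: measurable_snd.
have mf : measurable_fun [set: plane R] (fun p => f p.1).
  by apply: measurableT_comp m1; exact: (roof_measurable rf).
have mfr : measurable_fun [set: plane R] (fun p => frac p.1).
  by apply: measurableT_comp m1; exact: measurable_frac.
apply: measurable_minr; first exact: measurable_cst.
apply: measurable_funM; first exact: measurable_cst.
apply: measurable_minr; apply: measurable_maxr; try exact: measurable_cst.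
  by apply: measurable_minr => //; apply: measurable_funB => //; exact: measurable_cst.
by apply: measurable_minr => //; apply: measurable_minr; apply: measurable_funB.
Qed.

Lemma phase_sqint_indic (A : set (plane R)) : measurable A -> sqint (\1_A : R * R -> R).
Proof.
move=> mA; apply: (sqint_bounded phase_measurable phase_lty (C := 1)).
  exact: measurable_indic.
by move=> p _; rewrite indicE; case: (_ \in _); rewrite ?normr1 ?normr0.
Qed.

Context (P : (R * R -> R) -> Prop).
Context (Pl : forall c g h, sqint g -> sqint h -> P g -> P h -> P (fun p => c * g p + h p)).
Context (Pc : forall g (phi : nat -> R * R -> R), sqint g -> (forall n, sqint (phi n)) ->
     (forall n, P (phi n)) ->
     (fun n => sqn (fun p => g p - phi n p)) @ \oo --> (0 : R) -> P g).

Let P_ae (phi : nat -> R * R -> R) (A : set (plane R)) : measurable A ->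
  (forall n, measurable_fun X (phi n : plane R -> R)) ->
  (forall n p, `|phi n p| <= 1) -> (forall n, P (phi n)) ->
  {ae mu, forall p, X p -> phi ^~ p @ \oo --> (\1_A p : R)} ->
  P (\1_A : R * R -> R).
Proof.
move=> mA mphi phi1 Pphi cv.
have sphi n : sqint (phi n).
  by apply: (@sqint_bounded _ _ _ _ _ phase_measurable phase_lty _ 1); [exact: mphi|move=> p _; exact: phi1].
apply: (Pc (phase_sqint_indic mA) sphi Pphi).
apply: (@sqint_dominated _ _ _ _ _ phase_measurable _ _ (fun=> 2)) => //.
- exact: (sqint_cst phase_measurable phase_lty).
- move=> n p _; rewrite [leRHS]ger0_norm//; apply: (le_trans (ler_normB _ _)).
  rewrite (_ : 2 = 1 + 1)//; apply: lerD => //.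
  by rewrite indicE; case: (p \in A); rewrite ?normr1 ?normr0 ?ler01.
Qed.

(** Dynkin's argument transported by a map [E] from sets of [T'] to sets of the plane: [E] is the
    product with a fixed factor when one coordinate is treated at a time, and the identity for the
    product structure. *)
Let P_indic_dynkin (T' : Type) (G : set (set T')) (E : set T' -> set (plane R)) :
  setI_closed G ->
  (forall S, <<s G >> S -> measurable (E S)) ->
  (forall S, E (~` S) = E setT `\` E S) ->
  (forall F : (set T')^nat, E (\bigcup_k F k) = \bigcup_k E (F k)) ->
  (forall F : (set T')^nat, trivIset setT F -> trivIset setT (fun k => E (F k))) ->
  (forall S, S `<=` setT -> E S `<=` E setT) ->
  P (\1_(E setT) : R * R -> R) ->
  (forall S, G S -> P (\1_(E S) : R * R -> R)) ->
  forall S, <<s G >> S -> P (\1_(E S) : R * R -> R).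
Proof.
move=> GI mE EC EU Et Es PT PG S sS.
suff: <<s G >> `<=` [set A | <<s G >> A /\ P (\1_(E A) : R * R -> R)] by move=> /(_ _ sS)[].
have [s0 sC sU] := smallest_sigma_algebra setT G.
have sT : <<s G >> setT by have := sC _ s0; rewrite setD0.
apply: lambda_system_subset => //; last first.
- by move=> A GA; split; [exact: sub_sigma_algebra|exact: PG].
- apply/dynkin_lambda_system; split => //.
  + move=> B [mB PB]; split; first by rewrite -setTD; exact: sC.
    have -> : (\1_(E (~` B)) : R * R -> R) = fun p => -1 * \1_(E B) p + \1_(E setT) p.
      apply/funext => p; rewrite EC !indicE in_setD.
      case: (boolP (p \in E B)) => [pB|_]; last by rewrite andbT mulr0 add0r.
      rewrite andbF (_ : p \in E setT = true) ?mulr1 ?addNr//.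
      by apply/mem_set; apply: (Es B) => //; exact: set_mem.
    by apply: Pl => //; apply: phase_sqint_indic; exact: mE.
  + move=> F tF Hm; split.
      by apply: sU => k; have [] := Hm k.
    have mEF k : measurable (E (F k)) by apply: mE; have [] := Hm k.
    pose phi n : R * R -> R := fun p => \sum_(k < n) \1_(E (F k)) p.
    have sphi n : sqint (phi n) /\ P (phi n).
      elim: n => [|n [IH1 IH2]].
        have -> : phi 0%N = fun p => -1 * \1_(E setT) p + \1_(E setT) p.
          by apply/funext => p; rewrite /phi big_ord0 mulN1r addNr.
        have sET := phase_sqint_indic (mE _ sT).
        by split; [exact: (sqintD phase_measurable)|exact: Pl].
      have -> : phi n.+1 = fun p => 1 * phi n p + \1_(E (F n)) p.
        by apply/funext => p; rewrite /phi big_ord_recr/= mul1r.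
      have sn := phase_sqint_indic (mEF n); have [_ Pn] := Hm n.
      by split; [exact: (sqintD phase_measurable)|exact: Pl].
    have phiE n p : phi n p = \1_(\big[setU/set0]_(k < n) E (F k)) p.
      rewrite /phi; elim: n => [|n IH]; first by rewrite !big_ord0 indic0.
      rewrite !big_ord_recr/= IH !indicE in_setU.
      case: (boolP (p \in E (F n))) => [pn|_]; last by rewrite orbF addr0.
      rewrite orbT (_ : p \in _ = false) ?add0r//; apply/negbTE; rewrite notin_setE.
      rewrite -(bigcup_mkord _ (fun k => E (F k))) => -[k kn pk].
      have : k = n by apply: (Et _ tF) => //; exists p; split => //; exact: set_mem.
      by move=> E'; move: kn; rewrite E' /= ltnn.
    rewrite EU; apply: (@P_ae phi).
    * exact: bigcup_measurable.
    * by move=> n; have [[]] := sphi n.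
    * move=> n p; rewrite phiE indicE; case: (p \in _); rewrite ?normr1 ?normr0 ?ler01//.
    * by move=> n; have [] := sphi n.
    * apply: aeW => p _; rewrite indicE.
      case: (boolP (p \in _)) => [|]; rewrite ?notin_setE ?inE.
        move=> [k _ pk]; apply: cvg_near_cst; near=> n.
        rewrite phiE indicE (_ : p \in _ = true)//; apply/mem_set.
        rewrite -(bigcup_mkord _ (fun k => E (F k))); exists k => //=; near: n; exact: nbhs_infty_gt.
      move=> h; apply: cvg_near_cst; near=> n.
      rewrite phiE indicE (_ : p \in _ = false)//; apply/negbTE; rewrite notin_setE.
      by move=> h'; apply: h; rewrite -(bigcup_mkord _ (fun k => E (F k))) in h'; case: h' => k _ ?; exists k.
Unshelve. all: by end_near. Qed.

Let P_eq_on (A B : set (plane R)) : measurable A -> measurable B ->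
  (forall p, X p -> A p <-> B p) -> P (\1_A : R * R -> R) -> P (\1_B : R * R -> R).
Proof.
move=> mA mB AB PA; apply: (@P_ae (fun=> \1_A)) => //.
- by move=> _ p; rewrite indicE; case: (p \in A); rewrite ?normr1 ?normr0 ?ler01.
- apply: aeW => p /AB h; rewrite (_ : \1_B p = \1_A p); first exact: cvg_cst.
  by rewrite !indicE; congr ((_ : bool)%:R); apply/idP/idP; rewrite !inE => /h.
Qed.

Context (Pbump : forall (a c : rat) (k : nat), P (bump f (ratr a) (ratr c) k)).

Let quadrant_measurable (a c : R) : measurable ([set p : plane R | p.1 < a /\ p.2 < c]).
Proof.
rewrite (_ : mkset _ = `]-oo, a[%classic `*` `]-oo, c[%classic); first exact: measurableX.
by apply/seteqP; split => -[x y] /=; rewrite !in_itv.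
Qed.

Let rat_approx (a : R) : exists an : nat -> rat,
  (forall n, ratr (an n) < a) /\ (fun n => ratr (an n) : R) @ \oo --> a.
Proof.
have h n : exists q : rat, a - n.+1%:R^-1 < ratr q < a.
  have /rat_in_itvoo[q] : a - n.+1%:R^-1 < a by rewrite gtrBl invr_gt0.
  by rewrite in_itv/= => hq; exists q.
have [an han] := choice h; exists an; split; first by move=> n; case/andP: (han n).
apply: (@squeeze_cvgr _ _ _ _ (fun n => a - n.+1%:R^-1) (fun=> a)).
- by near=> n; case/andP: (han n) => h1 h2; rewrite !ltW.
- rewrite -[X in _ --> X]subr0; apply: cvgB; first exact: cvg_cst.
  exact: cvg_harmonic.
- exact: cvg_cst.
Unshelve. all: by end_near. Qed.

Let P_quadrant (a c : R) : P (\1_([set p : plane R | p.1 < a /\ p.2 < c]) : R * R -> R).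
Proof.
have [an [ana ca]] := rat_approx a; have [cn [cnc cc]] := rat_approx c.
apply: (@P_ae (fun n => bump f (ratr (an n)) (ratr (cn n)) n)) => //.
- by move=> n; apply: measurable_funTS; exact: bump_measurable.
- by move=> n p; have [h _ _ _] := bump_nice rf (ratr (an n)) (ratr (cn n)) n; exact: h.
apply: ae_off_axes => x y x0 y0 Xp.
exact: bump_cvg.
Qed.

Let ray_measurable (S : set R) : <<s RGenInftyO.G (R:=R) >> S ->
  measurable (S : set (measurableTypeR R)).
Proof. by move=> h; rewrite (RGenInftyO.measurableE R); exact: h. Qed.

Let P_rect1 (A : set (measurableTypeR R)) (c : R) : measurable A ->
  P (\1_(A `*` `]-oo, c[%classic) : R * R -> R).
Proof.
move=> mA; move: (mA); rewrite (RGenInftyO.measurableE R) => sA.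
apply: (@P_indic_dynkin _ (@RGenInftyO.G R) (fun S => S `*` `]-oo, c[%classic)) sA.
- move=> _ _ [x ->] [y ->]; exists (Num.min x y).
  by apply/seteqP; split => z /=; rewrite !in_itv/= lt_min => /andP.
- by move=> S /ray_measurable mS; exact: measurableX.
- move=> S; apply/seteqP; split => -[x y] /=; first by move=> [h1 h2]; split => // -[].
  by move=> [[_ h1] h2]; split => // h3; apply: h2.
- move=> F; apply/seteqP; split => -[x y] /=.
    by move=> [[k _ h] h2]; exists k.
  by move=> [k _ [h1 h2]]; split => //; exists k.
- move=> F tF i j _ _ [[x y] [[/= h1 _] [h2 _]]]; apply: tF => //; by exists x.
- by move=> S _ [x y] [_ h].
(* On the phase space [x < 1], so the whole line may be replaced by the ray below [1]. *)
- apply: (P_eq_on (quadrant_measurable 1 c)) (P_quadrant 1 c); first exact: measurableX.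
  move=> [x y] [/= /andP[_ x1] _]; rewrite in_itv/=; tauto.
- move=> S [a ->]; apply: (P_eq_on (quadrant_measurable a c)) (P_quadrant a c).
    exact: measurableX.
  by move=> [x y] _ /=; rewrite !in_itv.
Qed.

Let P_rect2 (A B : set (measurableTypeR R)) : measurable A -> measurable B ->
  P (\1_(A `*` B) : R * R -> R).
Proof.
move=> mA mB; move: (mB); rewrite (RGenInftyO.measurableE R) => sB.
apply: (@P_indic_dynkin _ (@RGenInftyO.G R) (fun S => A `*` S)) sB.
- move=> _ _ [x ->] [y ->]; exists (Num.min x y).
  by apply/seteqP; split => z /=; rewrite !in_itv/= lt_min => /andP.
- by move=> S /ray_measurable mS; exact: measurableX.
- move=> S; apply/seteqP; split => -[x y] /=; first by move=> [h1 h2]; split => // -[].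
  by move=> [[h0 h1] h2]; split => // h3; apply: h2.
- move=> F; apply/seteqP; split => -[x y] /=.
    by move=> [h2 [k _ h]]; exists k.
  by move=> [k _ [h1 h2]]; split => //; exists k.
- move=> F tF i j _ _ [[x y] [[/= _ h1] [_ h2]]]; apply: tF => //; by exists y.
- by move=> S _ [x y] [h _].
- apply: (P_eq_on _ _ _ (@P_rect1 A M0 mA)); [exact: measurableX|exact: measurableX|].
  move=> [x y] [/= _ /andP[_ yf]]; rewrite in_itv/=.
  by have := lt_le_trans yf (roof_le rf x); tauto.
- by move=> S [a ->]; exact: P_rect1.
Qed.

Lemma sqint_ind_bump g : sqint g -> P g.
Proof.
apply: (sqint_ind_indic phase_measurable phase_lty) => // A mA.
move: (mA); rewrite measurable_prod_measurableType => sA.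
apply: (@P_indic_dynkin _ _ (fun S => S)) sA => //.
- move=> _ _ [A1 mA1 [B1 mB1 <-]] [A2 mA2 [B2 mB2 <-]].
  exists (A1 `&` A2); first exact: measurableI.
  exists (B1 `&` B2); first exact: measurableI.
  by rewrite setXI.
- by move=> S; rewrite -measurable_prod_measurableType.
- by move=> S; rewrite setTD.
- by rewrite -setXTT; apply: P_rect2.
- by move=> _ [A1 mA1 [B1 mB1 <-]]; exact: P_rect2.
Qed.

End Density.

(** * Koopman operators and correlations *)

Section Koopman.
Context {R : realType} (f : R -> R) (m0 M0 Cf : R) (rf : roof f m0 M0 Cf).
Local Notation mu := (@vol R).
Local Notation X := (phase f).
Local Notation sqint := (@sq_integrable _ (plane R) R mu X).
Local Notation sqn := (@sqnorm _ (plane R) R mu X).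
Local Notation nrm := (@norm2 _ (plane R) R mu X).
Local Notation ip := (@inner _ (plane R) R mu X).
Local Notation one := (fun _ : R * R => 1 : R).
Implicit Types (gam s t : R) (g h k : R * R -> R).

Let mX : measurable (X : set (plane R)). Proof. exact: (phase_measurable rf). Qed.
Let finX : (mu X < +oo)%E. Proof. exact: (phase_lty rf). Qed.

Definition koopman gam t g : R * R -> R := fun p => g (sflow gam f t p).

Lemma koopD gam s t g : koopman gam s (koopman gam t g) = koopman gam (s + t) g.
Proof. by apply/funext => p; rewrite /koopman (sflowD rf). Qed.

Lemma koop0 gam g p : X p -> koopman gam 0 g p = g p.
Proof. by move=> Xp; rewrite /koopman (sflow_id rf). Qed.

Lemma koop_comb gam t (c : R) g h :
  koopman gam t (fun p => c * g p + h p) = fun p => c * koopman gam t g p + koopman gam t h p.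
Proof. by []. Qed.

(** Points off the phase space go to [(-1, 0)], which is also off it, so that the preimage of a
    subset of the phase space stays inside the phase space. *)
Definition flow_in gam t (p : plane R) : plane R :=
  if p \in X then sflow gam f t p else (-1, 0).

Let flow_in_measurable gam t : measurable_fun [set: plane R] (flow_in gam t).
Proof.
apply: measurable_fun_ifT; last exact: measurable_cst.
  apply: (measurable_fun_bool true) => //.
  rewrite setTI (_ : _ @^-1` _ = X)//.
  by apply/seteqP; split => p /=; [move=> h; exact/set_mem|move/mem_set].
exact: (measurable_sflow rf gam t).
Qed.

Let flow_in_preimage gam t : flow_in gam t @^-1` X = X.
Proof.
apply/seteqP; split => p; rewrite /flow_in/=; case: ifPn.
- by rewrite inE.
- by move=> _ [/= h _]; exfalso; move: h; lra.
- by move=> _ _; exact: (sflow_phase rf).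
- by rewrite notin_setE.
Qed.

Let flow_in_preimage_sub gam t (A : set (R * R)) : A `<=` X ->
  flow_in gam t @^-1` A = X `&` [set p | A (sflow gam f t p)].
Proof.
move=> AX; apply/seteqP; split => p /=; rewrite /flow_in.
  case: ifPn => [|_ /AX [/= h _]]; first by rewrite inE.
  by exfalso; move: h; lra.
by move=> [/mem_set -> ].
Qed.

Lemma ge0_integral_koop gam t (F : R * R -> \bar R) :
  measurable_fun (X : set (plane R)) F -> (forall p, (0 <= F p)%E) ->
  (\int[mu]_(p in X) F (sflow gam f t p) = \int[mu]_(p in X) F p)%E.
Proof.
move=> mF F0.
have := @ge0_integral_pushforward _ _ _ _ R _ (flow_in_measurable gam t) mu X F mX mF (fun p _ => F0 p).
rewrite flow_in_preimage => E.
transitivity (\int[mu]_(p in X) (F \o flow_in gam t) p)%E.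
  by apply: eq_integral => p pX /=; rewrite /flow_in pX.
rewrite -E; apply: eq_measure_integral => A mA AX.
rewrite -[in RHS](vol_sflow rf gam t mA AX) /= /pushforward; congr (mu _).
exact: flow_in_preimage_sub.
Qed.

Lemma koop_measurable gam t g : measurable_fun (X : set (plane R)) g ->
  measurable_fun (X : set (plane R)) (koopman gam t g).
Proof.
move=> mg _ A mA.
have mgA := mg mX A mA.
have := measurable_sflow rf gam t measurableT mgA; rewrite setTI => h.
have := measurableI _ _ mX h; congr (measurable _).
apply/seteqP; split => p; rewrite /koopman/=; first by move=> [h1 [h2 h3]].
by move=> [h1 h2]; split => //; split => //; exact: (sflow_phase rf).
Qed.

Lemma sqint_koop gam t g : sqint g -> sqint (koopman gam t g).
Proof.
move=> [mg ig]; split; first exact: koop_measurable.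
apply/integrableP; split.
  by apply/measurable_EFinP; apply: measurable_funX; exact: koop_measurable.
have mF : measurable_fun (X : set (plane R)) (fun p => `|(g p ^+ 2)%:E|)%E.
  by apply: measurableT_comp => //; apply/measurable_EFinP; exact: measurable_funX.
have := ge0_integral_koop gam t mF (fun p => abse_ge0 _).
move/integrableP : ig => [_]; rewrite /koopman/= => h E.
by rewrite E.
Qed.

Lemma Rintegral_koop gam t g : measurable_fun (X : set (plane R)) g ->
  Rintegral mu X (koopman gam t g) = Rintegral mu X g.
Proof.
move=> mg; congr fine; rewrite integralE [RHS]integralE; congr (_ - _)%E.
  have mp : measurable_fun (X : set (plane R)) ((EFin \o g)^\+)%E.
    by apply: measurable_funepos; exact/measurable_EFinP.
  have := ge0_integral_koop gam t mp (funepos_ge0 _) => <-.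
  by apply: eq_integral => p _; rewrite !funeposE.
have mp : measurable_fun (X : set (plane R)) ((EFin \o g)^\-)%E.
  by apply: measurable_funeneg; exact/measurable_EFinP.
have := ge0_integral_koop gam t mp (funeneg_ge0 _) => <-.
by apply: eq_integral => p _; rewrite !funenegE.
Qed.

Lemma ip_koop gam t g h : sqint g -> sqint h -> ip (koopman gam t g) (koopman gam t h) = ip g h.
Proof.
move=> [mg _] [mh _]; rewrite /ip -[RHS](Rintegral_koop gam t)//; exact: measurable_funM.
Qed.

Lemma sqn_koop gam t g : sqint g -> sqn (koopman gam t g) = sqn g.
Proof. by move=> sg; exact: ip_koop. Qed.

Lemma nrm_koop gam t g : sqint g -> nrm (koopman gam t g) = nrm g.
Proof. by move=> sg; rewrite /nrm sqn_koop. Qed.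

Lemma sqint_one : sqint one. Proof. exact: (sqint_cst mX finX). Qed.

Lemma sqn_one : sqn one = area f.
Proof. by rewrite /sqn /ip mulr1 Rintegral_cst// mul1r. Qed.

(** The inner products are not normalised, whence the division by the area in the product of the
    means. *)
Definition correlation gam t g h : R :=
  ip (koopman gam t g) h - ip g one * ip one h / area f.

Lemma correl_combl gam t (c : R) g h k : sqint g -> sqint h -> sqint k ->
  correlation gam t (fun p => c * g p + h p) k = c * correlation gam t g k + correlation gam t h k.
Proof.
move=> sg sh sk; rewrite /correlation koop_comb !(ipDl mX)//; try exact: sqint_koop; try exact: sqint_one.
by ring.
Qed.

Lemma correl_combr gam t (c : R) g h k : sqint g -> sqint h -> sqint k ->
  correlation gam t k (fun p => c * g p + h p) = c * correlation gam t k g + correlation gam t k h.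
Proof.
move=> sg sh sk; rewrite /correlation !(ipDr mX)//; try exact: sqint_koop; try exact: sqint_one.
by ring.
Qed.

Lemma correl_le gam t g h : sqint g -> sqint h -> `|correlation gam t g h| <= 2 * (nrm g * nrm h).
Proof.
move=> sg sh; apply: (le_trans (ler_normB _ _)); rewrite mulr2n mulrDl !mul1r lerD//.
  by rewrite -(nrm_koop gam t sg) (ip_le_nrm mX)//; exact: sqint_koop.
have a0 := area_gt0 rf.
rewrite normrM normfV (gtr0_norm a0) ler_pdivrMr// normrM.
have h1 := ip_le_nrm mX sg sqint_one; have h2 := ip_le_nrm mX sqint_one sh.
have e : nrm one * nrm one = area f by rewrite -expr2 nrm_sqr sqn_one.
rewrite -e [leRHS](_ : _ = (nrm g * nrm one) * (nrm one * nrm h)); last by ring.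
exact: ler_pM.
Qed.

Lemma ip_koop_one gam t g : sqint g -> ip (koopman gam t g) one = ip g one.
Proof. by move=> sg; rewrite -[RHS](ip_koop gam t sg sqint_one). Qed.

Lemma ip_one_koop gam t g : sqint g -> ip one (koopman gam t g) = ip one g.
Proof. by move=> sg; rewrite ipC ip_koop_one// ipC. Qed.

Lemma correl_koopl gam t s g h : sqint g ->
  correlation gam t (koopman gam s g) h = correlation gam (t + s) g h.
Proof. by move=> sg; rewrite /correlation koopD ip_koop_one. Qed.

Lemma correl_koopr gam t s g h : sqint g -> sqint h ->
  correlation gam t g (koopman gam s h) = correlation gam (t - s) g h.
Proof.
move=> sg sh; rewrite /correlation ip_one_koop//; congr (_ - _).
rewrite -(ip_koop gam s (sqint_koop gam (t - s) sg) sh) koopD.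
by rewrite addrCA subrr addr0.
Qed.

Lemma correl_approx gam t g g' h : sqint g -> sqint g' -> sqint h ->
  `|correlation gam t g h - correlation gam t g' h| <= 2 * (nrm (fun p => g p - g' p) * nrm h).
Proof.
move=> sg sg' sh.
have -> : correlation gam t g h - correlation gam t g' h = correlation gam t (fun p => g p - g' p) h.
  rewrite (_ : (fun p => g p - g' p) = fun p => -1 * g' p + g p); last first.
    by apply/funext => p; rewrite mulN1r addrC.
  by rewrite correl_combl// mulN1r addrC.
by apply: correl_le => //; exact: sqintB.
Qed.

Lemma nrm_cvg0 (phi : nat -> R * R -> R) g :
  (fun n => sqn (fun p => g p - phi n p)) @ \oo --> (0 : R) ->
  forall e, 0 < e -> exists n, nrm (fun p => g p - phi n p) < e.
Proof.
move=> h e e0.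
have e20 : 0 < e ^+ 2 by rewrite exprn_gt0.
have /cvgrPdist_lt /(_ _ e20) [N _ /(_ N (leqnn N))/=] := h.
rewrite sub0r normrN ger0_norm ?sqn_ge0// => hN.
exists N; rewrite -(@ltr_pXn2r _ 2)// ?nnegrE ?nrm_ge0 ?(ltW e0)//.
by rewrite nrm_sqr.
Qed.

Lemma correlC_approx gam t g h h' : sqint g -> sqint h -> sqint h' ->
  `|correlation gam t g h - correlation gam t g h'| <= 2 * (nrm g * nrm (fun p => h p - h' p)).
Proof.
move=> sg sh sh'.
have -> : correlation gam t g h - correlation gam t g h' = correlation gam t g (fun p => h p - h' p).
  rewrite (_ : (fun p => h p - h' p) = fun p => -1 * h' p + h p); last first.
    by apply/funext => p; rewrite mulN1r addrC.
  by rewrite correl_combr// mulN1r addrC.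
by apply: correl_le => //; exact: sqintB.
Qed.

End Koopman.

(** * Convergence to zero of averages over time *)

Section Cesaro.
Context {R : realType}.
Local Notation m1 := (@lebesgue_measure R).
Implicit Types (a b : R -> R) (e s t T : R).

Definition ucont a := forall e, 0 < e -> exists2 d : R, 0 < d &
  forall t s, `|s| < d -> `|a (t + s) - a t| < e.

(** Extended integrals and the absence of division spare integrability conditions; [cesaro0P]
    relates this form to the limit of the averages. *)
Definition cesaro0 a := forall e, 0 < e -> exists2 T0 : R, 0 < T0 &
  forall T, T0 <= T -> (\int[m1]_(t in `[0%R, T]) `|a t|%:E <= (e * T)%:E)%E.

Lemma ucont_measurable a : ucont a -> measurable_fun [set: R] a.
Proof.
move=> ua; apply: continuous_measurable_fun => t.
apply/cvgrPdist_lt => e /ua [d d0 h]; exists d => //= x; rewrite /ball_ /= => xd.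
by rewrite distrC -[x](subrKC t); apply: h; rewrite distrC.
Qed.

Lemma ucontD a b : ucont a -> ucont b -> ucont (fun t => a t + b t).
Proof.
move=> ua ub e e0; have e2 : 0 < e / 2 by lra.
have [d d0 hd] := ua _ e2; have [d' d'0 hd'] := ub _ e2.
exists (Num.min d d'); first by rewrite lt_min d0.
move=> t s; rewrite lt_min => /andP[/(hd t) h1 /(hd' t) h2].
rewrite opprD addrACA; apply: (le_lt_trans (ler_normD _ _)); move: h1 h2; lra.
Qed.

Lemma ucont_norm a : ucont a -> ucont (fun t => `|a t|).
Proof.
move=> ua e /ua [d d0 h]; exists d => // t s sd.
exact: le_lt_trans (ler_dist_dist _ _) (h t s sd).
Qed.

Let mabs a : measurable_fun [set: R] a ->
  measurable_fun [set: R] (fun t => `|a t|%:E).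
Proof. by move=> ma; apply/measurable_EFinP; apply: measurableT_comp. Qed.

Let int_cst (c T : R) : 0 <= T -> (\int[m1]_(t in `[0%R, T]) c%:E = (c * T)%:E)%E.
Proof.
move=> T0; rewrite integral_cst//= lebesgue_measure_itv/= lte_fin EFinM.
move: T0; rewrite le_eqVlt => /orP[/eqP <-|->]; last by rewrite sube0.
by rewrite ltxx.
Qed.

Lemma cesaro0_comb (c : R) a b : measurable_fun [set: R] a -> measurable_fun [set: R] b ->
  cesaro0 a -> cesaro0 b -> cesaro0 (fun t => c * a t + b t).
Proof.
move=> ma mb ca cb e e0.
have c1 : 0 < `|c| + 1 by have := normr_ge0 c; lra.
have e1 : 0 < e / 2 / (`|c| + 1) by rewrite divr_gt0//; lra.
have e2 : 0 < e / 2 by lra.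
have [T0 T00 h0] := ca _ e1; have [T1 T10 h1] := cb _ e2.
exists (Num.max T0 T1); first by rewrite lt_max T00.
move=> T; rewrite ge_max => /andP[TT0 TT1].
have T'0 : 0 < T by exact: lt_le_trans TT0.
apply: (@le_trans _ _ (\int[m1]_(t in `[0%R, T]) (`|c|%:E * `|a t|%:E + `|b t|%:E))%E).
  apply: ge0_le_integral => //.
  - apply: measurable_funTS; apply: mabs.
    by apply: measurable_funD => //; exact: measurable_funM.
  - apply: measurable_funTS; apply: emeasurable_funD; last exact: mabs.
    by apply: measurable_funeM; exact: mabs.
  - by move=> x _; rewrite -EFinM -EFinD lee_fin -normrM ler_normD.
rewrite ge0_integralD//; first last.
- by apply: measurable_funTS; exact: mabs.
- by apply: measurable_funTS; apply: measurable_funeM; exact: mabs.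
rewrite ge0_integralZl_EFin//; last by apply: measurable_funTS; exact: mabs.
apply: (@le_trans _ _ (`|c|%:E * (e / 2 / (`|c| + 1) * T)%:E + (e / 2 * T)%:E)%E).
  by rewrite leeD//; [rewrite lee_wpmul2l//; exact: h0|exact: h1].
rewrite -EFinM -EFinD lee_fin.
rewrite (_ : e * T = (`|c| + 1) * (e / 2 / (`|c| + 1) * T) + e / 2 * T); last first.
  by field; rewrite gt_eqF.
rewrite lerD2r ler_wpM2r//; last by lra.
by rewrite mulr_ge0//; exact: ltW.
Qed.

Lemma cesaro0_norm a : cesaro0 a -> cesaro0 (fun t => `|a t|).
Proof.
move=> ca e /ca [T0 T00 h]; exists T0 => // T /h; apply: le_trans.
by under eq_integral do rewrite normr_id.
Qed.

Lemma cesaro0_cst0 : cesaro0 (fun=> 0).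
Proof.
move=> e e0; exists 1 => // T T1.
rewrite integral0_eq; first by rewrite lee_fin mulr_ge0//; lra.
by move=> x _; rewrite normr0.
Qed.

Lemma cesaro0_approx a : measurable_fun [set: R] a ->
  (forall e, 0 < e -> exists b, [/\ measurable_fun [set: R] b, cesaro0 b &
     forall t, `|a t| <= `|b t| + e]) -> cesaro0 a.
Proof.
move=> ma h e e0; have e2 : 0 < e / 2 by lra.
have [b [mb cb hb]] := h _ e2; have [T0 T00 h0] := cb _ e2.
exists T0 => // T TT0; have T'0 : 0 <= T by move: T00 TT0; lra.
apply: (@le_trans _ _ (\int[m1]_(t in `[0%R, T]) (`|b t|%:E + (e / 2)%:E))%E).
  apply: ge0_le_integral => //.
  - by apply: measurable_funTS; exact: mabs.
  - apply: emeasurable_funD => //; apply: measurable_funTS; exact: mabs.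
  - by move=> x _; rewrite -EFinD lee_fin.
rewrite ge0_integralD//; [|by apply: measurable_funTS; exact: mabs|by move=> x _; rewrite lee_fin; lra].
rewrite int_cst// (_ : e * T = e / 2 * T + e / 2 * T); last by lra.
by rewrite EFinD leeD//; exact: h0.
Qed.

Lemma cesaro0P a (C : R) : measurable_fun [set: R] a -> (forall t, `|a t| <= C) ->
  ((fun T => T^-1 * Rintegral m1 `[0, T] (fun t => `|a t|)) x @[x --> +oo] --> (0 : R)) <->
  cesaro0 a.
Proof.
move=> ma aC.
have fin T : 0 <= T -> ((\int[m1]_(t in `[0%R, T]) `|a t|%:E)%E \is a fin_num).
  move=> T0; rewrite ge0_fin_numE ?integral_ge0//.
  apply: (@le_lt_trans _ _ (\int[m1]_(t in `[0%R, T]) C%:E)%E); last first.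
    by rewrite int_cst// ltry.
  apply: ge0_le_integral => //; first by apply: measurable_funTS; exact: mabs.
  by move=> x _; rewrite lee_fin.
have key T e : 0 < T -> (\int[m1]_(t in `[0%R, T]) `|a t|%:E <= (e * T)%:E)%E =
    (`|T^-1 * Rintegral m1 `[0, T] (fun t => `|a t|)| <= e).
  move=> T0; rewrite normrM ger0_norm ?invr_ge0 ?(ltW T0)// [T^-1 * _]mulrC ler_pdivrMr//.
  rewrite ger0_norm; last by apply: fine_ge0; exact: integral_ge0.
  by rewrite -lee_fin fineK// fin// ltW.
split.
  move=> /cvgrPdist_le h e e0; have [M [Mr hM]] := h e e0.
  have [h1 h2] : 0 <= Num.max M 0 /\ M <= Num.max M 0 by rewrite !le_max !lexx orbT.
  exists (Num.max M 0 + 1); first by move: h1; lra.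
  move=> T TM.
  have [MT T0] : M < T /\ 0 < T by split; move: TM h1 h2; lra.
  by rewrite key//; have := hM T MT; rewrite sub0r normrN.
move=> h; apply/cvgrPdist_le => e e0; have [T0 T00 h0] := h e e0.
exists T0; split; first exact: num_real.
move=> T /= TT0; rewrite sub0r normrN -key; first exact/h0/ltW.
exact: lt_trans TT0.
Qed.

(** The window [[s, T + s]] covers [[0, T]] except for [[0, s]], where [|a|] is at most [C]. *)
Lemma integral_window_shift a (C s T : R) : measurable_fun [set: R] a ->
  (forall t, `|a t| <= C) -> 0 <= s -> 0 <= T ->
  (\int[m1]_(t in `[0%R, T]) `|a t|%:E <=
   (C * s)%:E + \int[m1]_(t in `[0%R, T]) `|a (t + s)%R|%:E)%E.
Proof.
move=> ma aC s0 T0.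
have C0 : 0 <= C by exact: le_trans (aC 0).
have mF := mabs ma.
rewrite [X in (_ + X)%E](_ : _ = \int[m1]_(t in `[s, (T + s)%R]) `|a t|%:E)%E; last first.
  rewrite -(@ge0_integral_shift _ s `[s, T + s] (fun t => `|a t|%:E))//.
  congr (integral _ _ _); apply/seteqP; split => x /=; rewrite !in_itv/=; lra.
apply: (@le_trans _ _ (\int[m1]_(t in `[0%R, s] `|` `]s, (T + s)%R]) `|a t|%:E)%E).
  apply: ge0_subset_integral => //; first exact: measurableU.
    exact: measurable_funTS.
  move=> x /=; rewrite !in_itv/= => /andP[x0 xT].
  by case: (leP x s) => xs; [left|right]; rewrite ?x0//=; move: xT s0; lra.
rewrite ge0_integral_setU//; last 2 first.
- exact: measurable_funTS.
- by apply/disj_setPS => y /= [] /=; rewrite !in_itv/=; lra.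
apply: leeD; last first.
  apply: ge0_subset_integral => //; first exact: measurable_funTS.
  by move=> x /=; rewrite !in_itv/=; lra.
apply: (@le_trans _ _ (\int[m1]_(t in `[0%R, s]) C%:E)%E).
  apply: ge0_le_integral => //; first exact: measurable_funTS.
  by move=> x _; rewrite lee_fin.
by rewrite int_cst.
Qed.

(* Shifting the time window by [x] changes the average over [[0, T]] by
   [O(x / T)], so the average of [`|a|] is that of the mean of its translates. *)
Lemma cesaro0_translates a (C : R) : measurable_fun [set: R] a ->
  (forall t, `|a t| <= C) ->
  (forall e, 0 < e -> exists s : seq R, [/\ (0 < size s)%N, all (fun x => 0 <= x) s &
    forall t, \sum_(x <- s) `|a (t + x)| <= e * (size s)%:R]) -> cesaro0 a.
Proof.
move=> ma aC h e e0; have e2 : 0 < e / 2 by lra.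
have C0 : 0 <= C by exact: le_trans (aC 0).
have [s [s0 sge hs]] := h _ e2.
set J : R := (size s)%:R; have J0 : 0 < J by rewrite ltr0n.
pose K := C * \sum_(x <- s) x.
have K0 : 0 <= K.
  by rewrite mulr_ge0// big_seq sumr_ge0// => x; exact: (allP sge).
have KJ : 0 <= 2 * K / J / e.
  by apply: divr_ge0; [apply: divr_ge0; [exact: mulr_ge0|exact: ltW]|exact: ltW].
(* Shifting the window by all elements of [s] costs [K] in total; for such [T] this is at most half
   of the allowed [e * J * T]. *)
exists (2 * K / J / e + 1); first by move: KJ; lra.
move=> T hT; have T0 : 0 <= T.
  by move: hT KJ; lra.
set I := (\int[m1]_(t in `[0%R, T]) `|a t|%:E)%E.
have I0 : (0 <= I)%E by exact: integral_ge0.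
have step (u : seq R) : all (fun x => 0 <= x) u ->
   ((size u)%:R%:E * I <= (C * \sum_(x <- u) x)%:E +
     \int[m1]_(t in `[0%R, T]) (\sum_(x <- u) `|a (t + x)%R|)%:E)%E.
  elim: u => [|x u IH] /=.
    rewrite mul0e big_nil mulr0 add0e integral_ge0// => t _.
    by rewrite big_nil.
  move=> /andP[x0 /IH {}IH].
  rewrite -natr1 EFinD ge0_muleDl// mul1e big_cons mulrDr.
  under eq_integral do rewrite big_cons EFinD.
  have mx y : measurable_fun [set: R] (fun t => `|a (t + y)|%:E).
    by apply: (mabs (a := fun t => a (t + y))); apply: measurableT_comp => //; exact: measurable_addr.
  rewrite ge0_integralD//; last 3 first.
  - by apply: measurable_funTS; exact: mx.
  - by move=> t _; rewrite lee_fin sumr_ge0.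
  - apply: measurable_funTS; apply/measurable_EFinP; apply: measurable_sum => y.
    by apply/measurable_EFinP; exact: mx.
  rewrite EFinD addeACA [leRHS]addeC addeC.
  rewrite [leRHS]addeC; apply: leeD => //.
  exact: integral_window_shift.
have := step s sge; rewrite -/K -/J => hh.
have : (J%:E * I <= K%:E + (e / 2 * J * T)%:E)%E.
  apply: (le_trans hh); rewrite leeD2l//.
  apply: (@le_trans _ _ (\int[m1]_(t in `[0%R, T]) (e / 2 * J)%:E)%E).
    apply: ge0_le_integral => //.
    - by move=> t _; rewrite lee_fin sumr_ge0.
    - apply: measurable_funTS; apply/measurable_EFinP; apply: measurable_sum => y.
      apply: measurableT_comp => //; apply: measurableT_comp => //; exact: measurable_addr.
    - by move=> t _; rewrite lee_fin.
  by rewrite int_cst.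
rewrite -EFinD => h1.
rewrite -(@lee_pmul2l _ J%:E)//; apply: (le_trans h1).
rewrite lee_fin.
have : K <= e / 2 * J * T.
  have : 2 * K / J / e <= T by move: hT; lra.
  by rewrite !ler_pdivrMr//; lra.
by lra.
Qed.

(** If [|a|] stayed above [e] along the progression, uniform continuity would keep it above [e / 2]
    on an interval of fixed length after each point, and the averages could not tend to zero. *)
Lemma cesaro0_sample a (tau0 tau e : R) : ucont a -> cesaro0 a ->
  0 <= tau0 -> 0 < tau -> 0 < e ->
  forall m0, exists2 m, (m0 <= m)%N & `|a (tau0 + m%:R * tau)| < e.
Proof.
move=> ua ca tau00 tau_0 e0 m0; apply/not_exists2P => hno.
have big m : (m0 <= m)%N -> e <= `|a (tau0 + m%:R * tau)|.
  by move=> mm; case: (hno m) => // /negP; rewrite -leNgt.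
have e2 : 0 < e / 2 by lra.
have [d' d'0 hd'] := ua _ e2.
(* Shorter than [tau], so that the intervals are disjoint. *)
pose d := Num.min (d' / 2) (tau / 2).
have d0 : 0 < d by rewrite lt_min !divr_gt0.
have dd' : d < d' by apply: (@le_lt_trans _ _ (d' / 2)); [rewrite ge_min lexx|lra].
have dtau : d < tau by apply: (@le_lt_trans _ _ (tau / 2)); [rewrite ge_min lexx orbT|lra].
have mF := mabs (ucont_measurable ua).
pose T n : R := tau0 + (m0 + n)%:R * tau.
have lower n : (((e / 2 * d) * n%:R)%:E <= \int[m1]_(t in `[0%R, T n]) `|a t|%:E)%E.
  elim: n => [|n IH]; first by rewrite mulr0 integral_ge0.
  have TS : T n.+1 = T n + tau by rewrite /T addnS -natr1; ring.
  have Tn0 : 0 <= T n by rewrite /T addr_ge0// mulr_ge0// ltW.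
  apply: (@le_trans _ _ (\int[m1]_(t in `[0%R, T n] `|` `](T n), (T n + d)%R]) `|a t|%:E)%E); last first.
    apply: ge0_subset_integral => //; [exact: measurableU|exact: measurable_funTS|].
    by move=> x /= []; rewrite !in_itv/= TS; move: tau_0 dtau Tn0; lra.
  rewrite ge0_integral_setU//; last 2 first.
  - exact: measurable_funTS.
  - by apply/disj_setPS => y /= [] /=; rewrite !in_itv/=; lra.
  rewrite -[n.+1%:R]natr1 mulrDr mulr1 EFinD leeD//.
  apply: (@le_trans _ _ (\int[m1]_(t in `](T n), (T n + d)%R]) (cst (e / 2)%:E t))%E).
    rewrite integral_cst//= lebesgue_measure_itv/= lte_fin ltrDl d0 -EFinB -EFinM lee_fin.
    by rewrite (_ : T n + d - T n = d)//; ring.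
  apply: ge0_le_integral => //; [by move=> x _; rewrite lee_fin; lra|exact: measurable_funTS|].
  move=> x /=; rewrite in_itv/= lee_fin => /andP[x1 x2].
  have := hd' (T n) (x - T n); rewrite subrKC => /(_ _).
  have h1 : `|x - T n| < d' by rewrite ger0_norm; move: dd' x1 x2; lra.
  move=> /(_ h1); have := big (m0 + n)%N (leq_addr _ _); rewrite -/(T n).
  have := ler_distD 0 (a (T n)) (a x); rewrite !subr0 sub0r normrN.
  have := ler_normB (a x) (a x - a (T n)); rewrite opprB addrCA subrr addr0.
  by lra.
(* Half of [e / 2 * d / tau], the limit of the lower bounds for the averages. *)
have e3 : 0 < e / 2 * d / (2 * tau) by rewrite divr_gt0// mulr_gt0.
have [T0 T00 hT] := ca _ e3.
have [n hn] : exists n : nat, T0 <= T n /\ tau0 + m0%:R * tau < n%:R * tau.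
  pose Z := (tau0 + m0%:R * tau + T0) / tau.
  exists (Num.truncn Z).+1.
  have Zn : Z < (Num.truncn Z).+1%:R by exact: truncnS_gt.
  move: Zn; rewrite /Z ltr_pdivrMr// /T natrD => Zn.
  have : 0 <= m0%:R * tau by rewrite mulr_ge0// ltW.
  by split; move: Zn T00; nra.
have := le_trans (lower n) (hT _ hn.1); rewrite lee_fin => h2.
have [_ h1] := hn; move: h2; rewrite /T natrD => h2.
have h3 : (e / 2 * d) * n%:R * (2 * tau) <= (e / 2 * d) * (tau0 + (m0%:R + n%:R) * tau).
  move: h2; rewrite [X in _ <= X](_ : _ = (e / 2 * d) * (tau0 + (m0%:R + n%:R) * tau) / (2 * tau)); last first.
    by field; rewrite gt_eqF.
  by rewrite ler_pdivlMr//; lra.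
have ed : 0 < e / 2 * d by rewrite mulr_gt0.
move: h3; rewrite -mulrA ler_pM2l//; lra.
Qed.

End Cesaro.

(** * Weak mixing in terms of functions *)

Section Mixing.
Context {R : realType} (f : R -> R) (m0 M0 Cf : R) (rf : roof f m0 M0 Cf).
Local Notation mu := (@vol R).
Local Notation X := (phase f).
Local Notation sqint := (@sq_integrable _ (plane R) R mu X).
Local Notation sqn := (@sqnorm _ (plane R) R mu X).
Local Notation nrm := (@norm2 _ (plane R) R mu X).
Local Notation ip := (@inner _ (plane R) R mu X).
Local Notation one := (fun _ : R * R => 1 : R).
Local Notation koop := (koopman f).
Local Notation correl := (correlation f).
Implicit Types (gam s t : R) (g h k : R * R -> R).

Let mX : measurable (X : set (plane R)). Proof. exact: (phase_measurable rf). Qed.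
Let finX : (mu X < +oo)%E. Proof. exact: (phase_lty rf). Qed.

Let sum_half (a b e : R) : a <= e / 2 -> b < e / 2 -> a + b < e.
Proof. by lra. Qed.

Let norm_tri (a b c e : R) : `|a - b| <= c -> c <= e -> `|a| <= `|b| + e.
Proof. by have := ler_normD (a - b) b; rewrite subrK; lra. Qed.

Lemma nrmZ c g : sqint g -> nrm (fun p => c * g p) = `|c| * nrm g.
Proof.
move=> sg; rewrite /norm2 /sqnorm (ipZl mX)//; last exact: sqintZ.
rewrite ipC (ipZl mX)// mulrA -expr2 sqrtrM ?sqr_ge0//.
by rewrite sqrtr_sqr.
Qed.

Lemma nrmD c g h : sqint g -> sqint h ->
  nrm (fun p => c * g p + h p) <= `|c| * nrm g + nrm h.
Proof.
move=> sg sh; rewrite -nrmZ// addrC.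
have := nrmB_le mX (sqintD mX c sg sh) sh.
by rewrite (_ : (fun p => _ - h p) = fun p => c * g p)//; apply/funext => p; rewrite addrK.
Qed.

Lemma nrmBC g h : nrm (fun p => g p - h p) = nrm (fun p => h p - g p).
Proof.
rewrite /norm2 /sqnorm /inner; congr (Num.sqrt (Rintegral _ _ _)).
by apply/funext => p; rewrite -mulrNN !opprB.
Qed.

Lemma nice_sqint L g : nice f L g -> measurable_fun [set: plane R] g -> sqint g.
Proof.
move=> [g1 _ _ _] mg; apply: (sqint_bounded mX finX (C := 1)) => //.
exact: measurable_funTS.
Qed.

Lemma nice_koop_le L g gam s p : nice f L g -> X p ->
  `|koop gam s g p - g p| <= L * `|s|.
Proof.
move=> ng Xp; rewrite /koopman sflowE -(lift_id rf g gam Xp).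
have := lift_lip_u rf ng gam p.1 (p.2 + s) p.2.
by rewrite addrAC subrr add0r -surjective_pairing.
Qed.

Lemma nice_koop_nrm L g gam s : nice f L g -> measurable_fun [set: plane R] g ->
  nrm (fun p => koop gam s g p - g p) <= L * `|s| * Num.sqrt (area f).
Proof.
move=> ng mg; have sg := nice_sqint ng mg.
have L0 := nice_L0 ng.
have Ls : 0 <= L * `|s| by rewrite mulr_ge0.
rewrite -[X in X * _](@ger0_norm _ (L * `|s|))// -sqrtr_sqr -sqrtrM ?sqr_ge0//.
apply: ler_wsqrtr; apply: (sqn_bounded mX finX) => //.
  have [m1 _] := sqint_koop rf gam s sg.
  by apply: measurable_funB => //; exact: measurable_funTS.
by move=> p; exact: nice_koop_le.
Qed.

(** Lipschitz test functions move by [O(|s|)], and the property passes to limits in norm because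
    Koopman operators are isometries. *)
Lemma koop_continuous gam g : sqint g -> forall e, 0 < e ->
  exists2 d : R, 0 < d & forall s, `|s| < d -> nrm (fun p => koop gam s g p - g p) < e.
Proof.
apply: (sqint_ind_bump rf (P := fun g => forall e, 0 < e ->
  exists2 d : R, 0 < d & forall s, `|s| < d -> nrm (fun p => koop gam s g p - g p) < e)).
- move=> c {}g h sg sh Pg Ph e e0.
  have c1 : 0 < `|c| + 1 by have := normr_ge0 c; lra.
  have e1 : 0 < e / 2 / (`|c| + 1) by rewrite divr_gt0//; lra.
  have e2 : 0 < e / 2 by lra.
  have [d d0 hd] := Pg _ e1; have [d' d'0 hd'] := Ph _ e2.
  exists (Num.min d d'); first by rewrite lt_min d0.
  move=> s; rewrite lt_min => /andP[/hd h1 /hd' h2].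
  rewrite (_ : (fun p => _ - _) = fun p => c * (koop gam s g p - g p) + (koop gam s h p - h p)); last first.
    by apply/funext => p; rewrite /koopman; ring.
  have s1 := sqintB mX (sqint_koop rf gam s sg) sg.
  have s2 := sqintB mX (sqint_koop rf gam s sh) sh.
  apply: (le_lt_trans (nrmD c s1 s2)).
  have : `|c| * nrm (fun p => koop gam s g p - g p) <= e / 2.
    apply: (@le_trans _ _ ((`|c| + 1) * (e / 2 / (`|c| + 1)))).
      by apply: ler_pM; rewrite ?nrm_ge0 ?(ltW h1)// lerDl.
    by rewrite mulrC divfK// gt_eqF.
  by move=> h3; exact: sum_half.
- move=> {}g phi sg sphi Pphi hphi e e0.
  have e3 : 0 < e / 3 by lra.
  have [n hn] := nrm_cvg0 hphi e3.
  have [d d0 hd] := Pphi n _ e3; exists d => // s /hd hs.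
  have sB := sqintB mX sg (sphi n).
  have s1 := sqint_koop rf gam s sB.
  have s2 := sqintB mX (sqint_koop rf gam s (sphi n)) (sphi n).
  rewrite (_ : (fun p => _ - _) = fun p => 1 * koop gam s (fun p => g p - phi n p) p +
    (-1 * (g p - phi n p) + (koop gam s (phi n) p - phi n p))); last first.
    by apply/funext => p; rewrite /koopman; ring.
  apply: (le_lt_trans (nrmD 1 s1 (sqintD mX (-1) sB s2))).
  have := nrmD (-1) sB s2.
  rewrite (nrm_koop rf)// normrN normr1 !mul1r; move: hn hs.
  by move: (nrm _) (nrm _) (nrm _) => ? ? ? ? ?; lra.
- move=> a c k e e0; set L := k%:R * (1 + Cf).
  have nb := bump_nice rf (ratr a) (ratr c) k; rewrite -/L in nb.
  have L0 := nice_L0 nb.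
  have V0 := sqrtr_ge0 (area f).
  have LV : 0 < L * Num.sqrt (area f) + 1 by have := mulr_ge0 L0 V0; lra.
  exists (e / (L * Num.sqrt (area f) + 1)); first by rewrite divr_gt0.
  move=> s; rewrite ltr_pdivlMr// => hs.
  apply: le_lt_trans (nice_koop_nrm gam s nb (bump_measurable rf _ _ _)) _.
  by have := normr_ge0 s; move: hs; rewrite mulrDr mulr1 mulrCA mulrA; lra.
Qed.

Lemma correl_ucont gam g h : sqint g -> sqint h -> ucont (fun t => correl gam t g h).
Proof.
move=> sg sh e e0.
have h1 : 0 < 2 * nrm h + 1 by move: (nrm_ge0 mu X h); move: (nrm h) => ?; lra.
have e1 : 0 < e / (2 * nrm h + 1) by rewrite divr_gt0.
have [d d0 hd] := koop_continuous gam sg e1.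
exists d => // t s /hd; rewrite ltr_pdivlMr// => hs.
rewrite -(correl_koopl rf)//.
apply: (le_lt_trans (correl_approx rf gam t (sqint_koop rf gam s sg) sg sh)).
by move: (nrm_ge0 mu X (fun p => koop gam s g p - g p)) hs; move: (nrm _) (nrm h) => ? ? ?; lra.
Qed.

Lemma correl_measurable gam g h : sqint g -> sqint h ->
  measurable_fun [set: R] (fun t => correl gam t g h).
Proof. by move=> sg sh; apply: ucont_measurable; exact: correl_ucont. Qed.

(* [Nul a] stands for convergence to [0] of [a], in the Cesaro sense or along a
   sequence of times; [B] is a class of functions whose closed span is [L^2]. *)
Lemma correl_null_ind gam (Nul : (R -> R) -> Prop) (B : (R * R -> R) -> Prop) :
  (forall (c : R) (a b : R -> R), measurable_fun [set: R] a -> measurable_fun [set: R] b ->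
     Nul a -> Nul b -> Nul (fun t => c * a t + b t)) ->
  (forall (a : R -> R), measurable_fun [set: R] a ->
     (forall e : R, 0 < e -> exists b : R -> R, [/\ measurable_fun [set: R] b, Nul b &
        forall t, `|a t| <= `|b t| + e]) -> Nul a) ->
  (forall P : (R * R -> R) -> Prop,
     (forall c g h, sqint g -> sqint h -> P g -> P h -> P (fun p => c * g p + h p)) ->
     (forall g (phi : nat -> R * R -> R), sqint g -> (forall n, sqint (phi n)) ->
        (forall n, P (phi n)) ->
        (fun n => sqn (fun p => g p - phi n p)) @ \oo --> (0 : R) -> P g) ->
     (forall g, B g -> P g) -> forall g, sqint g -> P g) ->
  (forall g, B g -> sqint g) ->
  (forall g h, B g -> B h -> Nul (fun t => correl gam t g h)) ->
  forall g h, sqint g -> sqint h -> Nul (fun t => correl gam t g h).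
Proof.
move=> lin lim ind sB base.
have close (u : R * R -> R) (e : R) (phi : nat -> R * R -> R) g : sqint u -> 0 < e ->
    (fun n => sqn (fun p => g p - phi n p)) @ \oo --> (0 : R) ->
    exists n, 2 * (nrm (fun p => g p - phi n p) * nrm u) <= e.
  move=> su e0 hphi.
  have u1 : 0 < 2 * nrm u + 1 by move: (nrm_ge0 mu X u); move: (nrm u) => ?; lra.
  have e1 : 0 < e / (2 * nrm u + 1) by rewrite divr_gt0.
  have [n] := nrm_cvg0 hphi e1; rewrite ltr_pdivlMr// => hn; exists n.
  by move: (nrm_ge0 mu X (fun p => g p - phi n p)) hn; move: (nrm _) (nrm u) => ? ? ?; lra.
have first h : B h -> forall g, sqint g -> Nul (fun t => correl gam t g h).
  move=> Bh; have sh := sB _ Bh; apply: ind => [c g k sg sk Ng Nk|g phi sg sphi Nphi hphi|g Bg].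
  - rewrite (_ : (fun t => _) = fun t => c * correl gam t g h + correl gam t k h).
      by apply: lin => //; exact: correl_measurable.
    by apply/funext => t; rewrite (correl_combl rf).
  - apply: lim; first exact: correl_measurable.
    move=> e e0; have [n hn] := close h e phi g sh e0 hphi.
    exists (fun t => correl gam t (phi n) h); split => //; first exact: correl_measurable.
    move=> t; exact: norm_tri (correl_approx rf gam t sg (sphi n) sh) hn.
  - exact: base.
move=> g h sg; move: h; apply: ind => [c h k sh sk Nh Nk|h phi sh sphi Nphi hphi|h Bh].
- rewrite (_ : (fun t => _) = fun t => c * correl gam t g h + correl gam t g k).
    by apply: lin => //; exact: correl_measurable.
  by apply/funext => t; rewrite (correl_combr rf).
- apply: lim; first exact: correl_measurable.
  move=> e e0; have [n hn] := close g e phi h sg e0 hphi.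
  exists (fun t => correl gam t g (phi n)); split => //; first exact: correl_measurable.
  move=> t; apply: norm_tri hn; rewrite [_ * nrm g]mulrC.
  exact: (correlC_approx rf gam t sg sh (sphi n)).
- exact: first.
Qed.

Lemma leb2E (A : set (R * R)) : @leb2 R A = mu A.
Proof. by []. Qed.

Lemma nmu_correl gam t (A B : set (R * R)) : measurable (A : set (plane R)) ->
  measurable (B : set (plane R)) -> A `<=` X -> B `<=` X ->
  nmu f [set p | B p /\ A (sflow gam f t p)] - nmu f A * nmu f B =
  correl gam t \1_A \1_B / area f.
Proof.
move=> mA mB AX BX; rewrite /nmu !leb2E -/(area f).
have V0 := area_gt0 rf.
have ind (C : set (plane R)) : measurable C -> C `<=` X ->
    Rintegral mu X (\1_C : R * R -> R) = fine (mu (C `&` X)).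
  move=> mC CX; rewrite /Rintegral integral_indic//.
have i1 : ip \1_A one = fine (mu (A `&` X)).
  by rewrite -ind// /inner; congr (Rintegral _ _ _); apply/funext => p; rewrite mulr1.
have i2 : ip one \1_B = fine (mu (B `&` X)).
  by rewrite -ind// /inner; congr (Rintegral _ _ _); apply/funext => p; rewrite mul1r.
have i3 : ip (koop gam t \1_A) \1_B = fine (mu ([set p | B p /\ A (sflow gam f t p)] `&` X)).
  rewrite -ind.
  - rewrite /inner; congr (Rintegral _ _ _); apply/funext => p.
    rewrite /koopman !indicE -natrM mulnb; congr (_%:R); congr nat_of_bool.
    apply/idP/idP => [/andP[]|]; rewrite !inE; first by [].
    by move=> [h1 h2]; apply/andP; rewrite !inE.
  - apply: measurableI => //.
    by have := measurable_sflow rf gam t measurableT mA; rewrite setTI.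
  - by move=> p [/BX].
rewrite /correlation i1 i2 i3 mulrBl; congr (_ - _).
by rewrite mulrACA mulrA.
Qed.

Lemma correl_bounded gam g h : sqint g -> sqint h ->
  exists C, forall t, `|correl gam t g h| <= C.
Proof.
by move=> sg sh; exists (2 * (nrm g * nrm h)) => t; exact: (correl_le rf).
Qed.

Lemma weak_mixingP gam : weak_mixing gam f <->
  forall g h, sqint g -> sqint h -> cesaro0 (fun t => correl gam t g h).
Proof.
have V0 := area_gt0 rf.
have key (A B : set (R * R)) : measurable (A : set (plane R)) ->
    measurable (B : set (plane R)) -> A `<=` X -> B `<=` X ->
    ((fun T : R => T^-1 * Rintegral (@lebesgue_measure R) `[0, T]
        (fun t => `| nmu f [set p | B p /\ A (sflow gam f t p)]
                     - nmu f A * nmu f B |)) x @[x --> +oo] --> (0 : R)) <->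
    cesaro0 (fun t => correl gam t \1_A \1_B / area f).
  move=> mA mB AX BX.
  have [C hC] := correl_bounded gam (phase_sqint_indic rf mA) (phase_sqint_indic rf mB).
  rewrite -(@cesaro0P _ _ (C / area f)).
  - have -> // : (fun t => `|nmu f [set p | B p /\ A (sflow gam f t p)] - nmu f A * nmu f B|) =
       (fun t => `|correl gam t \1_A \1_B / area f|).
    by apply/funext => t; rewrite nmu_correl.
  - apply: measurable_funM => //.
    exact: (correl_measurable gam (phase_sqint_indic rf mA) (phase_sqint_indic rf mB)).
  - by move=> t; rewrite normrM normfV (gtr0_norm V0) ler_pM2r ?invr_gt0.
have scale (a : R -> R) (c : R) : measurable_fun [set: R] a -> cesaro0 a ->
    cesaro0 (fun t => c * a t).
  move=> ma ca.
  have := cesaro0_comb c ma (measurable_cst (0 : R)) ca cesaro0_cst0.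
  by under eq_fun do rewrite addr0.
split=> [wm|h A B mA mB AX BX]; last first.
  apply/key => //.
  have m1 := correl_measurable gam (phase_sqint_indic rf mA) (phase_sqint_indic rf mB).
  have := scale _ (area f)^-1 m1 (h _ _ (phase_sqint_indic rf mA) (phase_sqint_indic rf mB)).
  by under eq_fun do rewrite mulrC.
apply: (@correl_null_ind gam (@cesaro0 R)
  (fun g => exists2 A : set (plane R), measurable A & g = \1_A)).
- by move=> *; exact: cesaro0_comb.
- exact: cesaro0_approx.
- move=> P P1 P2 P3; apply: (sqint_ind_indic mX finX) => // A mA.
  by apply: P3; exists A.
- by move=> _ [A mA ->]; exact: (phase_sqint_indic rf).
move=> _ _ [A mA ->] [B mB ->].
(* The definition of weak mixing speaks of subsets of the phase space; cutting by it changes no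
   inner product there. *)
have mAX := measurableI _ _ mA mX; have mBX := measurableI _ _ mB mX.
have := wm (A `&` X) (B `&` X) mAX mBX (@subIsetr _ _ _) (@subIsetr _ _ _).
move/(key _ _ mAX mBX (@subIsetr _ _ _) (@subIsetr _ _ _)) => ce.
have m1 := correl_measurable gam (phase_sqint_indic rf mAX) (phase_sqint_indic rf mBX).
have m2 : measurable_fun [set: R] (fun t => correl gam t \1_(A `&` X) \1_(B `&` X) / area f).
  by apply: measurable_funM.
have := scale _ (area f) m2 ce.
rewrite (_ : (fun t => _) = (fun t => correl gam t \1_A \1_B))//.
apply/funext => t; rewrite mulrC divfK ?gt_eqF//.
have indX (C : set (plane R)) : {in X, (\1_(C `&` X) : R * R -> R) =1 \1_C}.
  by move=> p pX; rewrite !indicE in_setI pX andbT.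
rewrite /correlation; congr (_ - _ * _ / _); apply: ip_eq => //; try exact: indX.
move=> p pX; rewrite /koopman; apply: indX; apply/mem_set; exact: (sflow_phase rf).
Qed.

End Mixing.

(** * Weak mixing from a sequence of times *)

Section MixingTimes.
Context {R : realType} (f : R -> R) (m0 M0 Cf : R) (rf : roof f m0 M0 Cf).
Local Notation mu := (@vol R).
Local Notation X := (phase f).
Local Notation sqint := (@sq_integrable _ (plane R) R mu X).
Local Notation sqn := (@sqnorm _ (plane R) R mu X).
Local Notation ip := (@inner _ (plane R) R mu X).
Local Notation one := (fun _ : R * R => 1 : R).
Local Notation koop := (koopman f).
Local Notation correl := (correlation f).
Implicit Types (gam t : R) (g h : R * R -> R) (s : seq R).

Let mX : measurable (X : set (plane R)). Proof. exact: (phase_measurable rf). Qed.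
Let finX : (mu X < +oo)%E. Proof. exact: (phase_lty rf). Qed.

(** The times are nonnegative since they become forward shifts of the averaging window in
    [cesaro0_translates]. *)
Definition mixing_times gam (tk : nat -> R) := (forall k, 0 <= tk k) /\
  forall g h, sqint g -> sqint h -> (fun k => correl gam (tk k) g h) @ \oo --> (0 : R).

Lemma mixing_times_bump gam tk : (forall k, 0 <= tk k) ->
  (forall (a c a' c' : rat) (k k' : nat), (fun n => correl gam (tk n)
     (bump f (ratr a) (ratr c) k) (bump f (ratr a') (ratr c') k')) @ \oo --> (0 : R)) ->
  mixing_times gam tk.
Proof.
move=> tk0 h; split => //.
apply: (correl_null_ind rf (gam := gam) (Nul := fun a => a \o tk @ \oo --> (0 : R))
  (B := fun g => exists (a c : rat) (k : nat), g = bump f (ratr a) (ratr c) k)).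
- move=> c a b _ _ ha hb; rewrite -(addr0 0) -[X in X + _](mulr0 c).
  by apply: cvgD hb; apply: cvgMr ha.
- move=> a _ ha; apply/cvgrPdist_lt => e e0; have e2 : 0 < e / 2 by lra.
  have [b [_ hb ab]] := ha _ e2.
  have /cvgrPdist_lt/(_ _ e2) := hb; apply: filterS => n /=.
  by rewrite !sub0r !normrN; have := ab (tk n); lra.
- move=> P P1 P2 P3; apply: (sqint_ind_bump rf) => // a c k.
  by apply: P3; exists a, c, k.
- move=> _ [a [c [k ->]]]; exact: (nice_sqint rf (bump_nice rf _ _ _) (bump_measurable rf _ _ _)).
- by move=> _ _ [a [c [k ->]]] [a' [c' [k' ->]]]; exact: h.
Qed.

Let comb (gam : R) g (c : R -> R) t (s : seq R) : R * R -> R :=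
  foldr (fun b v => fun p => c b * koop gam (t + b) g p + v p) (fun=> 0) s.

Let sqint_comb gam g c t s : sqint g -> sqint (comb gam g c t s).
Proof.
move=> sg; elim: s => [|b s IH] /=; first exact: (sqint_cst mX finX).
by apply: sqintD => //; exact: (sqint_koop rf).
Qed.

Let ip_comb gam g h c t s : sqint g -> sqint h ->
  ip (comb gam g c t s) h = \sum_(b <- s) c b * ip (koop gam (t + b) g) h.
Proof.
move=> sg sh; elim: s => [|b s IH] /=.
  rewrite big_nil /inner; under [X in Rintegral _ _ X]funext do rewrite mul0r.
  by rewrite /Rintegral integral0_eq.
rewrite big_cons (ipDl mX)//; first by rewrite IH.
- exact: (sqint_koop rf).
- exact: sqint_comb.
Qed.

(* Bessel's inequality for nearly orthogonal translates of [g]. *)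
Let sqn_comb gam g c t e s : sqint g -> 0 <= e -> (forall b, `|c b| <= 1) ->
  pairwise (fun a b => `|ip (koop gam (a - b) g) g| <= e) s ->
  sqn (comb gam g c t s) <= (size s)%:R * sqn g + (size s)%:R * (size s)%:R * (2 * e).
Proof.
move=> sg e0 c1; elim: s => [|a s IH] /=.
  move=> _; rewrite !mul0r addr0 /sqnorm /inner.
  by under [X in Rintegral _ _ X]funext do rewrite mul0r; rewrite /Rintegral integral0_eq.
move=> /andP[ha /IH {}IH].
have sk := sqint_koop rf gam (t + a) sg.
rewrite (sqnD mX)//; last exact: sqint_comb.
rewrite (sqn_koop rf)// ipC ip_comb//.
have cr : `|\sum_(b <- s) c b * ip (koop gam (t + b) g) (koop gam (t + a) g)| <= (size s)%:R * e.
  apply: (le_trans (ler_norm_sum _ _ _)); rewrite -sum1_size natr_sum mulr_suml.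
  rewrite big_seq [leRHS]big_seq; apply: ler_sum => b bs; rewrite mul1r.
  have -> : ip (koop gam (t + b) g) (koop gam (t + a) g) = ip (koop gam (a - b) g) g.
    rewrite ipC -(ip_koop rf gam (t + b) (sqint_koop rf gam (a - b) sg) sg) (koopD rf).
    by rewrite (_ : t + b + (a - b) = t + a)//; ring.
  have := allP ha b bs; apply: le_trans; rewrite normrM ler_piMl//.
have c2 : c a ^+ 2 <= 1.
  by rewrite -real_normK ?num_real// expr_le1.
have v0 := sqn_ge0 mu X g.
have S0 : 0 <= (size s)%:R :> R by [].
rewrite -[(size s).+1%:R]natr1.
move: IH cr c2 v0 S0 (c1 a).
move: (sqn _) (\sum_(b <- s) _) (sqn g) (c a) ((size s)%:R : R) => x y v z n IH cr c2 v0 n0 z1.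
have zy : z * y <= n * e.
  apply: (le_trans (ler_norm _)); rewrite normrM; apply: le_trans cr.
  by rewrite ler_piMl.
have zv : z ^+ 2 * v <= v by rewrite ler_piMl.
have -> : (n + 1) * v + (n + 1) * (n + 1) * (2 * e) =
  v + 2 * (n * e) + (n * v + n * n * (2 * e)) + 2 * (n * e + e) by ring.
have : 2 * z * y <= 2 * (n * e) by rewrite -mulrA; lra.
by have := mulr_ge0 n0 e0; lra.
Qed.

(** Each new time is taken so late that it decorrelates [g] from its translates by all the times
    already chosen. *)
Let nearly_orthogonal gam tk g e (J : nat) : mixing_times gam tk -> sqint g -> 0 < e ->
  exists s, [/\ size s = J, all (fun x => 0 <= x) s &
    pairwise (fun a b => `|correl gam (a - b) g g| <= e) s].
Proof.
move=> [tk0 mix] sg e0; elim: J => [|J [s [sJ s0 ps]]]; first by exists [::].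
have [N hN] : exists N, forall k, (N <= k)%N -> all (fun b => `|correl gam (tk k - b) g g| <= e) s.
  move=> {sJ s0 ps}; elim: s => [|b s [N hN]]; first by exists 0%N.
  have := mix g (koop gam b g) sg (sqint_koop rf gam b sg).
  move/cvgrPdist_le => /(_ _ e0)[N' _ hN'].
  exists (maxn N N') => k; rewrite geq_max /= => /andP[/hN -> /hN'].
  by rewrite /= sub0r normrN (correl_koopr rf)// => ->.
exists (tk N :: s); rewrite /= sJ tk0 s0 ps; split => //.
by rewrite andbT hN.
Qed.

(** With signs as coefficients, the sum of [|correl|] over the shifts in [s] is the inner product of
    [h] with a combination of [J] translates of the centred [g]. By near orthogonality its square
    norm is much smaller than [J^2], so Cauchy-Schwarz makes the mean over [s] small, uniformly in
    [t]. *)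
Lemma mixing_times_weak_mixing gam tk : mixing_times gam tk -> weak_mixing gam f.
Proof.
move=> mix; apply/(weak_mixingP rf) => g h sg sh.
have V0 := area_gt0 rf.
pose m := ip g one / area f.
pose g0 p := - m * one p + g p.
have s1 := sqint_one rf.
have sg0 : sqint g0 by exact: sqintD.
have mean0 : ip g0 one = 0.
  rewrite (ipDl mX)// -/(sqnorm _ _ _) (sqn_one rf) /m mulNr divfK ?gt_eqF//.
  by rewrite addNr.
have cE t k : correl gam t g0 k = ip (koop gam t g0) k.
  by rewrite /correlation mean0 mul0r mul0r subr0.
have cgE t : correl gam t g h = ip (koop gam t g0) h.
  rewrite -cE (correl_combl rf)// /correlation.
  have -> : ip (koop gam t one) h = ip one h by [].
  have -> : ip one one = area f by exact: (sqn_one rf).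
  by field; rewrite gt_eqF.
have [C hC] := correl_bounded rf gam sg sh.
apply: (cesaro0_translates (C := C)) => //; first exact: (correl_measurable rf).
move=> e e0; pose H := sqn h; pose v := sqn g0.
have H0 : 0 <= H := sqn_ge0 mu X h.
have v0 : 0 <= v := sqn_ge0 mu X g0.
(* After multiplication of Bessel's bound by [H], the off-diagonal part is at most half of
   [(e * J)^2] by this choice of [ep], and the diagonal part by the choice of [J]. *)
pose ep := e ^+ 2 / (4 * (H + 1)).
have e20 : 0 < e ^+ 2 by rewrite exprn_gt0.
have ep0 : 0 < ep by rewrite divr_gt0// mulr_gt0//; lra.
pose J := (Num.truncn (2 * v * H / e ^+ 2)).+1.
have JJ : 2 * v * H / e ^+ 2 < J%:R by exact: truncnS_gt.
have [s [sJ sge ps]] := nearly_orthogonal J mix sg0 ep0.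
exists s; rewrite sJ; split => // t.
pose c b := Num.sg (ip (koop gam (t + b) g0) h).
have c1 b : `|c b| <= 1.
  by rewrite /c normr_sg; case: (_ == _).
have ps' : pairwise (fun a b => `|ip (koop gam (a - b) g0) g0| <= ep) s.
  by move: ps; apply: sub_pairwise => a b; rewrite cE.
have := sqn_comb t sg0 (ltW ep0) c1 ps'; rewrite sJ -/v => hW.
have -> : \sum_(x <- s) `|correl gam (t + x) g h| = ip (comb gam g0 c t s) h.
  rewrite ip_comb//; apply: eq_bigr => x _.
  by rewrite cgE normrEsg.
have sW := sqint_comb gam c t s sg0.
apply: (le_trans (ler_norm _)).
rewrite -(@ler_pXn2r _ 2)// ?nnegrE//; last by rewrite mulr_ge0// ltW.
rewrite real_normK ?num_real//; apply: (le_trans (cauchy_schwarz mX sW sh)).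
rewrite -/H.
apply: (le_trans (ler_wpM2r H0 hW)).
have J0 : 0 <= J%:R :> R by [].
have h1 : 2 * v * H <= e ^+ 2 * J%:R.
  by move: JJ; rewrite ltr_pdivrMr// mulrC; lra.
have h2 : ep * (4 * H) <= e ^+ 2.
  rewrite /ep -mulrA [_^-1 * _]mulrC mulrA ler_pdivrMr; last lra.
  by rewrite ler_pM2l//; lra.
move: h1 h2 J0; rewrite exprMn; move: (J%:R : R) (e ^+ 2) => j E h1 h2 j0.
have : j * (2 * v * H) <= j * (E * j) by exact: ler_wpM2l.
have : (j * j) * (ep * (4 * H)) <= (j * j) * E by rewrite ler_wpM2l// mulr_ge0.
by rewrite expr2; lra.
Qed.

End MixingTimes.

(** * Fourier coefficients of periodic functions *)

Section PeriodicMean.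
Context {R : realType}.
Local Notation m1 := (@lebesgue_measure R).
Implicit Types (u v f : R -> R) (x a c th : R) (k l : int).

Definition pmean v : R := Rintegral m1 `[0, 1[ v.
Definition cper v := periodic1 v /\ continuous v.

Lemma cperD u v : cper u -> cper v -> cper (fun x => u x + v x).
Proof.
move=> [pu cu] [pv cv]; split=> x; first by rewrite pu pv.
by apply: cvgD; [exact: cu|exact: cv].
Qed.

Lemma cperM u v : cper u -> cper v -> cper (fun x => u x * v x).
Proof.
move=> [pu cu] [pv cv]; split=> x; first by rewrite pu pv.
by apply: cvgM; [exact: cu|exact: cv].
Qed.

Lemma cper_cst c : cper (fun=> c).
Proof. by split=> // x; exact: cvg_cst. Qed.

Lemma cperZ c v : cper v -> cper (fun x => c * v x).
Proof. by move=> cv; apply: cperM => //; exact: cper_cst. Qed.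

Lemma cper_shift c v : cper v -> cper (fun x => v (x + c)).
Proof.
move=> [pv cv]; split=> x; first by rewrite addrAC pv.
apply: (@continuous_comp _ _ _ (fun x => x + c) v); last exact: cv.
by apply: cvgD; [exact: cvg_id|exact: cvg_cst].
Qed.

Lemma cper_exp v n : cper v -> cper (fun x => v x ^+ n).
Proof.
move=> cv; elim: n => [|n IH]; first by under eq_fun do rewrite expr0; exact: cper_cst.
by under eq_fun do rewrite exprS; exact: cperM.
Qed.

Let itv_lty : (m1 `[0%R, 1%R[ < +oo)%E.
Proof. by rewrite lebesgue_measure_itv/= lte_fin ltr01 sube0 ltry. Qed.

Let bounded_integrable v (C : R) : measurable_fun [set: R] v -> (forall x, `|v x| <= C) ->
  m1.-integrable `[0, 1[ (EFin \o v).
Proof.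
move=> mv vC; apply: measurable_bounded_integrable => //.
- exact: measurable_funTS.
- by exists `|C|; split=> // y Cy x _ /=; apply: (le_trans (vC x)); apply/ltW/(le_lt_trans _ Cy)/ler_norm.
Qed.

Lemma cper_bounded v : cper v -> exists C, forall x, `|v x| <= C.
Proof. by move=> [pv cv]; exact: periodic1_bounded. Qed.

Lemma cper_measurable v : cper v -> measurable_fun [set: R] v.
Proof. by move=> [_ cv]; exact: continuous_measurable_fun. Qed.

Lemma cper_integrable v : cper v -> m1.-integrable `[0, 1[ (EFin \o v).
Proof.
move=> cv; have [C hC] := cper_bounded cv.
by apply: bounded_integrable hC; exact: cper_measurable.
Qed.

Lemma pmeanD u v : cper u -> cper v -> pmean (fun x => u x + v x) = pmean u + pmean v.
Proof. by move=> cu cv; rewrite /pmean RintegralD//; exact: cper_integrable. Qed.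

Lemma pmeanZ c v : cper v -> pmean (fun x => c * v x) = c * pmean v.
Proof. by move=> cv; rewrite /pmean RintegralZl//; exact: cper_integrable. Qed.

Lemma pmean_cst c : pmean (fun=> c) = c.
Proof.
by rewrite /pmean Rintegral_cst//= lebesgue_measure_itv/= lte_fin ltr01 sube0 mulr1.
Qed.

Lemma pmean_le u v : cper u -> cper v -> (forall x, u x <= v x) -> pmean u <= pmean v.
Proof. by move=> cu cv uv; apply: le_Rintegral => //; exact: cper_integrable. Qed.

Lemma pmean_near v c d : cper v -> (forall x, `|v x - c| <= d) -> `|pmean v - c| <= d.
Proof.
move=> cv h; rewrite ler_distl -(pmean_cst (c - d)) -(pmean_cst (c + d)).
by apply/andP; split; apply: pmean_le => //; try exact: cper_cst;
  move=> x; have := h x; rewrite ler_distl => /andP[].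
Qed.

Lemma pmean_shift c v : cper v -> pmean (fun x => v (x + c)) = pmean v.
Proof.
move=> cv; have [C hC] := cper_bounded cv.
have C0 : 0 <= C by exact: le_trans (hC 0).
have cvC := cperD cv (cper_cst C).
(* [ge0_integral_rotation] is about nonnegative functions; adding the bound [C] reduces to that
   case. *)
have key : pmean (fun x => v (x + c) + C) = pmean (fun x => v x + C).
  rewrite /pmean /Rintegral; congr fine.
  rewrite -(@ge0_integral_rotation _ c (fun x => (v x + C)%:E)).
  - apply: eq_integral => x _; rewrite periodic1_frac//; exact: cv.1.
  - by apply/measurable_EFinP; exact: cper_measurable.
  - by move=> x; rewrite lee_fin; have := hC x; rewrite ler_norml => /andP[]; lra.
move: key; rewrite !pmeanD//; try exact: cper_cst; last exact: cper_shift.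
by move/addIr.
Qed.

Lemma pmean_sum n (F : nat -> R -> R) : (forall i, cper (F i)) ->
  cper (fun x => \sum_(0 <= i < n) F i x) /\
  pmean (fun x => \sum_(0 <= i < n) F i x) = \sum_(0 <= i < n) pmean (F i).
Proof.
move=> cF; elim: n => [|n [IH1 IH2]].
  rewrite (_ : (fun x => _) = fun=> 0); last by apply/funext => x; rewrite big_geq.
  by split; [exact: cper_cst|rewrite pmean_cst big_geq].
rewrite (_ : (fun x => _) = fun x => \sum_(0 <= i < n) F i x + F n x); last first.
  by apply/funext => x; rewrite big_nat_recr.
by split; [exact: cperD|rewrite pmeanD// IH2 big_nat_recr].
Qed.

(** The free phase [th] treats cosines and sines at once and makes the family stable under
    translation of [x]. *)
Definition cosk k th x : R := cos (pi *+ 2 * k%:~R * x + th).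

Lemma cos_int_periodic k (y : R) : cos (y + pi *+ 2 * k%:~R) = cos y.
Proof.
have nat_per (n : nat) z : cos (z + pi *+ 2 * n%:R) = cos z :> R.
  elim: n => [|n IH]; first by rewrite mulr0 addr0.
  by rewrite -natr1 mulrDr mulr1 addrA cosD2pi.
case: k => n; first exact: nat_per.
by rewrite NegzE intrN mulrN -[LHS](nat_per n.+1) subrK.
Qed.

Lemma cosk_cper k th : cper (cosk k th).
Proof.
split=> x; first by rewrite /cosk mulrDr mulr1 addrAC cos_int_periodic.
apply: (@continuous_comp _ _ _ (fun x => pi *+ 2 * k%:~R * x + th) cos); last exact: continuous_cos.
by apply: cvgD; [apply: cvgMr; exact: cvg_id|exact: cvg_cst].
Qed.

Lemma coskM k a l b x :
  cosk k a x * cosk l b x = (cosk (k + l) (a + b) x + cosk (k - l) (a - b) x) / 2.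
Proof.
rewrite /cosk !intrD mulrNz.
rewrite (_ : pi *+ 2 * (k%:~R + l%:~R) * x + (a + b) =
  (pi *+ 2 * k%:~R * x + a) + (pi *+ 2 * l%:~R * x + b)); last by ring.
rewrite (_ : pi *+ 2 * (k%:~R - l%:~R) * x + (a - b) =
  (pi *+ 2 * k%:~R * x + a) - (pi *+ 2 * l%:~R * x + b)); last by ring.
by move: (_ + a) (_ + b) => y z; rewrite cosD cosB; field.
Qed.

Lemma coskN k a x : cosk (- k) a x = cosk k (- a) x.
Proof.
by rewrite /cosk -[RHS]cosN; congr cos; rewrite mulrNz; ring.
Qed.

Lemma cosk0 a x : cosk 0 a x = cos a.
Proof. by rewrite /cosk mulr0 mul0r add0r. Qed.

(** Translation by half a period changes the sign. *)
Lemma pmean_cosk k a : k != 0 -> pmean (cosk k a) = 0.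
Proof.
move=> k0; have kr : k%:~R != 0 :> R by rewrite intr_eq0.
have := pmean_shift ((2 * k%:~R)^-1) (cosk_cper k a).
rewrite (_ : (fun x => _) = fun x => -1 * cosk k a x); last first.
  apply/funext => x; rewrite /cosk mulrDr.
  rewrite (_ : pi *+ 2 * k%:~R * (2 * k%:~R)^-1 = pi); last by field.
  by rewrite addrAC cosDpi mulN1r.
by rewrite pmeanZ//; [lra|exact: cosk_cper].
Qed.

Lemma pmean_coskM k a l b : k != 0 ->
  pmean (fun x => cosk k a x * cosk l b x) =
  ((if l == - k then cos (a + b) else 0) + (if l == k then cos (a - b) else 0)) / 2.
Proof.
move=> k0; under eq_fun do rewrite coskM mulrC.
rewrite pmeanZ; last by apply: cperD; exact: cosk_cper.
rewrite pmeanD; try exact: cosk_cper.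
rewrite [RHS]mulrC; congr (_ * (_ + _)).
  case: eqP => [->|/eqP h]; last by rewrite pmean_cosk//; lia.
  by rewrite subrr (_ : cosk 0 _ = fun=> cos (a + b)) ?pmean_cst//; apply/funext => x; rewrite cosk0.
case: eqP => [->|/eqP h]; last by rewrite pmean_cosk//; lia.
by rewrite subrr (_ : cosk 0 _ = fun=> cos (a - b)) ?pmean_cst//; apply/funext => x; rewrite cosk0.
Qed.

(** Its maximum [1] is attained only at the integers, so its powers concentrate there. *)
Let weight x : R := (1 + cosk 1 0 x) / 2.

Let weight_cper : cper weight.
Proof.
rewrite /weight; under eq_fun do rewrite mulrC.
by apply: cperZ; apply: cperD; [exact: cper_cst|exact: cosk_cper].
Qed.

Let weight01 x : 0 <= weight x <= 1.
Proof.
have := cos_geN1 (pi *+ 2 * 1%:~R * x + 0); have := cos_le1 (pi *+ 2 * 1%:~R * x + 0).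
by rewrite /weight /cosk; move: (cos _) => y; lra.
Qed.

(** By the product formula, multiplication by [weight] only combines moments at the frequencies [k],
    [1 + k] and [1 - k]. *)
Let weight_moment v n : cper v -> (forall k a, pmean (fun x => v x * cosk k a x) = 0) ->
  forall k a, pmean (fun x => v x * weight x ^+ n * cosk k a x) = 0.
Proof.
move=> cv h; elim: n => [|n IH] k a.
  by under eq_fun do rewrite expr0 mulr1; exact: h.
have cw : cper (fun x => v x * weight x ^+ n).
  by apply: cperM => //; exact: cper_exp.
have cc l b : cper (fun x => v x * weight x ^+ n * cosk l b x).
  by apply: cperM => //; exact: cosk_cper.
rewrite (_ : (fun x => _) = fun x => 2^-1 * (v x * weight x ^+ n * cosk k a x) +
  (4^-1 * (v x * weight x ^+ n * cosk (1 + k) (0 + a) x) +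
   4^-1 * (v x * weight x ^+ n * cosk (1 - k) (0 - a) x))); last first.
  apply/funext => x; have := coskM 1 0 k a x; rewrite exprSr {2}/weight => e.
  have -> : cosk (1 + k) (0 + a) x = 2 * (cosk 1 0 x * cosk k a x) - cosk (1 - k) (0 - a) x.
    by rewrite e; lra.
  by field.
rewrite !pmeanD ?pmeanZ ?IH//; try by repeat (apply: cperD || apply: cperZ).
by rewrite !mulr0 !addr0.
Qed.

(** If [v 0 > 0], the powers of [weight] concentrate near [0], where [v] is positive, and eventually
    force a positive mean of [v * weight ^ n], although all moments vanish. Translates of [f] and of
    [- f] then give both inequalities at every point. *)
Lemma fourier_unique f : cper f ->
  (forall k a, pmean (fun x => f x * cosk k a x) = 0) -> forall x, f x = 0.
Proof.
have key v : cper v -> (forall k a, pmean (fun x => v x * cosk k a x) = 0) -> v 0 <= 0.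
  move=> cv h; rewrite leNgt; apply/negP => v0.
  have [M hM] := cper_bounded cv.
  pose d := v 0 / 2; have d0 : 0 < d by rewrite divr_gt0.
  have [r0 r00 hr0] : exists2 r : R, 0 < r & forall x, `|x| < r -> d <= v x.
    have /cvgrPdist_lt/(_ _ d0)[r r0 hr] := cv.2 0.
    exists r => // x xr; have := hr x; rewrite /= sub0r normrN => /(_ xr).
    by rewrite ltr_distlC => /andP[]; rewrite /d; lra.
  pose r := Num.min r0 (1 / 4).
  have rr0 : r <= r0 by rewrite ge_min lexx.
  have r4 : r <= 1 / 4 by rewrite ge_min lexx orbT.
  have r_gt0 : 0 < r by rewrite lt_min r00; lra.
  have pi0 := pi_gt0 R.
  have pi20 : 0 < pi *+ 2 :> R by rewrite pmulrn_rgt0.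
  have wE x : weight x = (1 + cos (pi *+ 2 * x)) / 2.
    by rewrite /weight /cosk mulr1 addr0.
  (* [weight] is at least [A] within [r / 2] of [0], and at most [B < A] at distance [r] or more
     from the integers: the good part of the integral is of order [A ^ n], the bad part of order
     [B ^ n]. *)
  pose A := weight (r / 2); pose B := weight r.
  have in0pi (z : R) : 0 <= z <= 1 / 2 -> pi *+ 2 * z \in `[0, pi]%R.
    move=> /andP[z0 z1].
    have h1 : pi * z <= pi / 2 by rewrite ler_pM2l// -[leRHS]mul1r.
    rewrite in_itv/= mulrnAl mulr2n; apply/andP; split.
      by rewrite addr_ge0// mulr_ge0// ltW.
    by rewrite [leRHS]splitr lerD.
  have cosle (x y : R) : 0 <= x -> x <= y -> y <= 1 / 2 -> weight y <= weight x.
    move=> x0 xy y2; rewrite !wE ler_pM2r ?invr_gt0// lerD2l.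
    have h1 : pi *+ 2 * x \in `[0, pi]%R by apply: in0pi; lra.
    have h2 : pi *+ 2 * y \in `[0, pi]%R by apply: in0pi; lra.
    rewrite leNgt ltr_cos// -leNgt ler_pM2l//.
  have BA : B < A.
    rewrite /A /B !wE ltr_pM2r ?invr_gt0// ltrD2l ltr_cos.
    - by rewrite ltr_pM2l//; move: (r) r_gt0 => z z0; lra.
    - by apply: in0pi; move: (r) r_gt0 r4 => z z0 z4; lra.
    - by apply: in0pi; move: (r) r_gt0 r4 => z z0 z4; lra.
  have B0 : 0 <= B by have /andP[] := weight01 r.
  have A0 : 0 < A by exact: le_lt_trans BA.
  have wsym x : weight (1 - x) = weight x.
    have := coskN 1 0 x; rewrite oppr0 => e; rewrite /weight -e.
    have := (cosk_cper (-1) 0).1 (x - 1); rewrite subrK => ->.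
    have := coskN (-1) 0 (x - 1); rewrite opprK oppr0 => <-.
    by congr ((1 + _) / 2); rewrite /cosk; rewrite -[LHS]cosN; congr cos; ring.
  have lower n x : 0 <= x < 1 ->
     d * A ^+ n * \1_(`[0, (r / 2)[%classic) x - M * B ^+ n <= v x * weight x ^+ n.
    move=> /andP[x0 x1].
    have M0 : 0 <= M by exact: le_trans (hM 0).
    have MB : 0 <= M * B ^+ n by rewrite mulr_ge0// exprn_ge0.
    have /andP[w0 w1] := weight01 x.
    rewrite indicE; case: (ltP x (r / 2)) => xr.
      rewrite mem_set ?mulr1; last by rewrite /= in_itv/= x0.
      rewrite lerBlDr ler_wpDr//; apply: ler_pM; rewrite ?exprn_ge0 ?(ltW A0) ?(ltW d0)//.
        by apply: hr0; rewrite ger0_norm//; lra.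
      by rewrite lerXn2r ?nnegrE ?(ltW A0)//; apply: cosle; lra.
    rewrite memNset ?mulr0 ?sub0r; last by rewrite /= in_itv/= x0/= => h1; move: (lt_le_trans h1 xr); rewrite ltxx.
    have far : `|v x| <= M /\ 0 <= v x \/ weight x <= B.
      case: (ltP x r) => xr'.
        left; split=> //; apply: le_trans (hr0 x _); rewrite ?(ltW d0)// ger0_norm//; lra.
      case: (ltP (1 - x) r) => xr''.
        left; split=> //; have := hr0 (x - 1); rewrite -(cv.1 (x - 1)) subrK => /(_ _).
        move=> hh; apply: (le_trans (ltW d0)); apply: hh.
        by rewrite distrC ger0_norm; lra.
      right; case: (leP x (1 / 2)) => xh; first by apply: cosle; lra.
      by rewrite -wsym; apply: cosle; lra.
    case: far => [[_ vx]|wB].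
      by apply: (@le_trans _ _ 0); [lra|rewrite mulr_ge0// exprn_ge0].
    have : `|v x * weight x ^+ n| <= M * B ^+ n.
      rewrite normrM (ger0_norm (exprn_ge0 _ w0)); apply: ler_pM; rewrite ?exprn_ge0//.
      by rewrite lerXn2r ?nnegrE.
    by rewrite ler_norml => /andP[].
  have main n : d * A ^+ n * (r / 2) <= M * B ^+ n.
    have mom := weight_moment n cv h 0 0.
    have cvw : cper (fun x => v x * weight x ^+ n * cosk 0 0 x).
      by apply: cperM; [apply: cperM => //; exact: cper_exp|exact: cosk_cper].
    have mi : measurable_fun [set: R] (fun x => d * A ^+ n * \1_(`[0, (r / 2)[%classic) x - M * B ^+ n : R).
      apply: measurable_funB => //; apply: measurable_funM => //.
    have ii : m1.-integrable `[0, 1[ (EFin \o (fun x => d * A ^+ n * \1_(`[0, (r / 2)[%classic) x - M * B ^+ n : R)).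
      apply: (@bounded_integrable _ (`|d * A ^+ n| + `|M * B ^+ n|)) => // x.
      apply: (le_trans (ler_normB _ _)); rewrite lerD2r normrM ler_piMr//.
      by rewrite indicE; case: (_ \in _); rewrite ?normr1 ?normr0.
    have : Rintegral m1 `[0, 1[ (fun x => d * A ^+ n * \1_(`[0, (r / 2)[%classic) x - M * B ^+ n : R)
      <= pmean (fun x => v x * weight x ^+ n * cosk 0 0 x).
      apply: le_Rintegral => //; first exact: cper_integrable.
      by move=> x /=; rewrite in_itv/= => /lower; rewrite cosk0 cos0 mulr1.
    rewrite mom RintegralB//=.
    - rewrite Rintegral_cst//= lebesgue_measure_itv/= lte_fin ltr01 sube0 mulr1.
      rewrite RintegralZl//.
      + rewrite /Rintegral integral_indic// setIidl; last first.
          by move=> x /=; rewrite !in_itv/=; lra.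
        rewrite /= lebesgue_measure_itv/= lte_fin divr_gt0// sube0/=.
        by rewrite subr_le0.
      + apply: (@bounded_integrable _ 1) => // x.
        by rewrite indicE; case: (_ \in _); rewrite ?normr1 ?normr0.
    - apply: (@bounded_integrable _ `|d * A ^+ n|); first exact: measurable_funM.
      move=> x; rewrite normrM ler_piMr//.
      by rewrite indicE; case: (_ \in _); rewrite ?normr1 ?normr0.
    - by apply: (@bounded_integrable _ `|M * B ^+ n|).
  have q0 : 0 <= B / A by rewrite divr_ge0// ltW.
  have q1 : `|B / A| < 1 by rewrite ger0_norm// ltr_pdivrMr// mul1r.
  have M1 : 0 < `|M| + 1 by have := normr_ge0 M; lra.
  have e0 : 0 < d * (r / 2) / (`|M| + 1) by rewrite !divr_gt0// mulr_gt0// divr_gt0.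
  have /cvgrPdist_lt/(_ _ e0)[N _ /(_ N (leqnn N))] := cvg_expr q1.
  rewrite /= sub0r normrN ger0_norm ?exprn_ge0// expr_div_n ltr_pdivlMr// mulrAC ltr_pdivrMr ?exprn_gt0//.
  have := main N; have := ler_norm M; have Bn : 0 <= B ^+ N by rewrite exprn_ge0.
  move: (B ^+ N) Bn (A ^+ N) => b b0 a; nra.
move=> cf h x.
have shiftP u : cper u -> (forall k a, pmean (fun y => u y * cosk k a y) = 0) ->
    forall z, u z <= 0.
  move=> cu hu z; have := key (fun y => u (y + z)) (cper_shift z cu).
  rewrite add0r; apply => k a.
  rewrite -[RHS](hu k (a - pi *+ 2 * k%:~R * z)) -[RHS](pmean_shift z); last first.
    by apply: cperM => //; exact: cosk_cper.
  congr pmean; apply/funext => y; congr (_ * _); rewrite /cosk; congr cos; ring.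
apply/eqP; rewrite eq_le shiftP//= -oppr_le0.
apply: (shiftP (fun y => - f y)).
  by under eq_fun do rewrite -mulN1r; exact: cperZ.
move=> k a; rewrite (_ : (fun y => _) = fun y => -1 * (f y * cosk k a y)); last first.
  by apply/funext => y; rewrite mulN1r mulNr.
by rewrite pmeanZ ?h ?mulr0//; apply: cperM => //; exact: cosk_cper.
Qed.

Lemma sin_pi_irrational k x : irrational x -> k != 0 -> sin (pi * (k%:~R * x)) != 0 :> R.
Proof.
move=> ix k0; apply/eqP => s0; apply: ix.
pose y := k%:~R * x; pose n := Num.floor y.
have sn : sin (pi * (y - n%:~R)) = 0.
  have nat_per (m : nat) z : `|sin (z + pi * m%:R)| = `|sin z| :> R.
    elim: m => [|m IH]; first by rewrite mulr0 addr0.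
    by rewrite -natr1 mulrDr mulr1 addrA sinDpi normrN.
  have : `|sin (pi * (y - n%:~R))| = `|sin (pi * y)|.
    case: n => m.
      by rewrite -[LHS](nat_per m) -mulrDr subrK.
    by rewrite NegzE mulrNz opprK mulrDr nat_per.
  by rewrite /y s0 normr0 => /eqP; rewrite normr_eq0 => /eqP.
have yn : y = n%:~R.
  apply/eqP; rewrite -subr_eq0; apply/negPn/negP => h.
  have h1 : 0 < y - n%:~R < 1.
    rewrite lt_neqAle eq_sym h subr_ge0 floor_le_tmp/=.
    by have := floorD1_gt y; rewrite -/n intrD; lra.
  have := @sin_gt0_pi R (pi * (y - n%:~R)); rewrite sn ltxx => /(_ _).
  have pi0 := pi_gt0 R.
  by move=> hh; have : false by apply: hh; rewrite pmulr_rgt0 ?gtr_pMr//.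
exists (n%:Q / k%:Q) => //=.
rewrite rmorphM/= fmorphV/= !ratr_int -yn /y mulrAC mulfV ?mul1r//.
by rewrite intr_eq0.
Qed.

(* Induction on [E]: peel off the top frequency and solve the equation for it
   explicitly. *)
Lemma trig_coboundary b E f : irrational b -> cper f -> pmean f = 0 ->
  (forall k a, (E < absz k)%N -> pmean (fun x => f x * cosk k a x) = 0) ->
  exists2 u, cper u & forall x, f x = u (x + b) - u x.
Proof.
move=> ib; elim: E f => [|E IH] f cf f0 h.
  have f00 : forall x, f x = 0.
    apply: fourier_unique => // k a; case: (posnP (absz k)) => [/eqP|]; last exact: h.
    rewrite absz_eq0 => /eqP ->; under eq_fun do rewrite cosk0 mulrC.
    by rewrite pmeanZ// f0 mulr0.
  by exists (fun=> 0); [exact: cper_cst|move=> x; rewrite f00 subrr].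
pose K : int := E.+1; have K0 : K != 0 by [].
(* The cosine and sine coefficients at the top frequency; the phase [- (pi / 2)] turns the cosine
   into the sine. *)
pose c := pmean (fun x => f x * cosk K 0 x).
pose s := pmean (fun x => f x * cosk K (- (pi / 2)) x).
pose P x := 2 * c * cosk K 0 x + 2 * s * cosk K (- (pi / 2)) x.
have cP : cper P by apply: cperD; apply: cperZ; exact: cosk_cper.
(* From [sin (y + h) - sin (y - h) = 2 * cos y * sin h] with [h = pi * (K * b)]; the denominator is
   nonzero since [b] is irrational. *)
pose v x := 2 * c * (sin (pi *+ 2 * K%:~R * x - pi * (K%:~R * b)) / (2 * sin (pi * (K%:~R * b))))
  + 2 * s * (sin (pi *+ 2 * K%:~R * x - pi * (K%:~R * b) - pi / 2) / (2 * sin (pi * (K%:~R * b)))).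
have sK := sin_pi_irrational ib K0.
have vP x : P x = v (x + b) - v x.
  have one th : cosk K th x = (sin (pi *+ 2 * K%:~R * (x + b) - pi * (K%:~R * b) + th)
     - sin (pi *+ 2 * K%:~R * x - pi * (K%:~R * b) + th)) / (2 * sin (pi * (K%:~R * b))).
    rewrite /cosk (_ : _ * (x + b) - _ + th = (pi *+ 2 * K%:~R * x + th) + pi * (K%:~R * b)); last by ring.
    rewrite (_ : _ * x - _ + th = (pi *+ 2 * K%:~R * x + th) - pi * (K%:~R * b)); last by ring.
    by rewrite sinD sinB; field.
  rewrite /P one [in X in _ + X]one /v !addr0; ring.
have cv : cper v.
  have co th : cper (fun x => sin (pi *+ 2 * K%:~R * x - pi * (K%:~R * b) + th)).
    under eq_fun do rewrite -cosBpihalf -!addrA.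
    exact: cosk_cper.
  rewrite /v; under eq_fun do rewrite ![_ / (2 * _)]mulrC.
  apply: cperD; apply: cperZ; apply: cperZ; last exact: co.
  by under eq_fun do rewrite -[X in sin X]addr0; exact: co.
have [] := IH (fun x => f x - P x).
- under eq_fun do rewrite -mulN1r; apply: cperD => //; exact: cperZ.
- under eq_fun do rewrite -mulN1r.
  rewrite pmeanD ?pmeanZ//; last exact: cperZ.
  rewrite f0 /P pmeanD ?pmeanZ ?pmean_cosk//; try exact: cosk_cper; try by apply: cperZ; exact: cosk_cper.
  by ring.
- have fP k a : pmean (fun x => (f x - P x) * cosk k a x) =
      pmean (fun x => f x * cosk k a x) -
      (2 * c * pmean (fun x => cosk K 0 x * cosk k a x) +
       2 * s * pmean (fun x => cosk K (- (pi / 2)) x * cosk k a x)).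
    have c1 : cper (fun x => f x * cosk k a x) by apply: cperM => //; exact: cosk_cper.
    have c2 th : cper (fun x => cosk K th x * cosk k a x) by apply: cperM; exact: cosk_cper.
    rewrite (_ : (fun x => (f x - P x) * _) = fun x => f x * cosk k a x + -1 *
      (2 * c * (cosk K 0 x * cosk k a x) + 2 * s * (cosk K (- (pi / 2)) x * cosk k a x))); last first.
      by apply/funext => x; rewrite /P; ring.
    rewrite pmeanD//; last by apply: cperZ; apply: cperD; exact: cperZ.
    rewrite pmeanZ; last by apply: cperD; exact: cperZ.
    by rewrite pmeanD ?pmeanZ// ?mulN1r//; exact: cperZ.
  have top a : pmean (fun x => (f x - P x) * cosk K a x) = 0.
    rewrite fP !pmean_coskM// eqxx (_ : (K == - K) = false)//.
    have -> : pmean (fun x => f x * cosk K a x) = cos a * c - sin a * s.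
      rewrite (_ : (fun x => _) = fun x => cos a * (f x * cosk K 0 x) + - sin a * (f x * cosk K (- (pi / 2)) x)).
        have c1 th : cper (fun x => f x * cosk K th x) by apply: cperM => //; exact: cosk_cper.
        by rewrite pmeanD ?pmeanZ ?mulNr//; exact: cperZ.
      apply/funext => x; rewrite /cosk cosBpihalf addr0 cosD; ring.
    rewrite sub0r cosN (_ : cos (- (pi / 2) - a) = - sin a); first by field.
    by rewrite -opprD cosN addrC cosDpihalf.
  move=> k a; rewrite leq_eqVlt => /orP[/eqP Ek|]; last first.
    move=> Ek; rewrite fP h// !pmean_coskM//.
    have -> : (k == - K) = false by apply/eqP => kK; move: Ek; rewrite kK abszN ltnn.
    have -> : (k == K) = false by apply/eqP => kK; move: Ek; rewrite kK ltnn.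
    by rewrite !addr0 !mul0r !mulr0 addr0 subr0.
  have [->|->] : k = K \/ k = - K by rewrite /K; lia.
    exact: top.
  by under eq_fun do rewrite coskN; exact: top.
move=> u cu hu; exists (fun x => u x + v x); first exact: cperD.
by move=> x; have := hu x; have := vP x; lra.
Qed.

End PeriodicMean.

(** * Sums over rational orbits *)

Section RationalSums.
Context {R : realType}.
Implicit Types (v f : R -> R) (x a : R) (p q i j m n : nat) (k c : int).

Definition rsum q v x : R := \sum_(0 <= j < q) v (x + j%:R / q%:R).

(** As [p] is prime to [q], multiplication by [p] permutes the residues modulo [q]. *)
Lemma rsum_birkhoff v c p q x : periodic1 v -> (0 < q)%N -> coprime p q ->
  birkhoff (c%:~R + p%:R / q%:R) v q x = rsum q v x.
Proof.
move=> pv q0 pq; rewrite /birkhoff /rsum !big_mkord.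
pose h (i : 'I_q) : 'I_q := Ordinal (ltn_pmod (i * p) q0).
have inj_h : injective h.
  move=> i j [] /eqP e; apply/val_inj/eqP.
  wlog ij : i j e / (i <= j)%N.
    by move=> w; case/orP: (leq_total i j) => ij; [exact: w|rewrite eq_sym; apply: w => //; rewrite eq_sym].
  move: e; rewrite eq_sym eqn_mod_dvd ?leq_mul2r ?ij ?orbT// -mulnBl.
  rewrite Gauss_dvdl ?[coprime q p]coprime_sym// => d.
  have : (j - i < q)%N by rewrite (leq_ltn_trans (leq_subr _ _))// ltn_ord.
  by case: (posnP (j - i)) => [/eqP|h0 h1]; [rewrite subn_eq0 eqn_leq ij /= => ->|
    move: (dvdn_leq h0 d); rewrite leqNgt h1].
rewrite [RHS](reindex_inj inj_h)/=; apply: eq_bigr => i _.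
have qr : q%:R != 0 :> R by rewrite pnatr_eq0 -lt0n.
rewrite -(periodic1_int (i%:Z * c + ((i * p) %/ q)%N%:Z) (x + _ / q%:R) pv).
congr v; have := congr1 (fun z => z%:R : R) (divn_eq (i * p) q).
rewrite natrD !natrM intrD intrM -!pmulrn => e.
have -> : ((i * p) %% q)%:R = i%:R * p%:R - ((i * p) %/ q)%:R * q%:R :> R by rewrite e addrC addKr.
by field.
Qed.

Lemma rsum_period v q x : periodic1 v -> (0 < q)%N -> rsum q v (x + q%:R^-1) = rsum q v x.
Proof.
move=> pv q0; have qr : q%:R != 0 :> R by rewrite pnatr_eq0 -lt0n.
have h : v x + rsum q v (x + q%:R^-1) = rsum q v x + v x; last by move: h; lra.
transitivity (\sum_(0 <= j < q.+1) v (x + j%:R / q%:R)).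
  rewrite big_nat_recl// mul0r addr0; congr (_ + _); apply: eq_bigr => j _.
  by congr v; rewrite -[j.+1%:R]natr1; field.
by rewrite big_nat_recr//= mulfV// pv.
Qed.

Lemma rsum_period_int v q k x : periodic1 v -> (0 < q)%N ->
  rsum q v (x + k%:~R / q%:R) = rsum q v x.
Proof.
move=> pv q0.
have nat_per n y : rsum q v (y + n%:R / q%:R) = rsum q v y.
  elim: n => [|n IH]; first by rewrite mul0r addr0.
  by rewrite -natr1 mulrDl mul1r addrA rsum_period.
case: k => n; first exact: nat_per.
by rewrite NegzE intrN mulNr -[LHS](nat_per n.+1) subrK.
Qed.

(** The sum has period [1 / q], so [x'] can be brought into [[x, x + 1 / q]]. *)
Lemma rsum_reduce v q x x' : periodic1 v -> (0 < q)%N ->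
  exists2 d : R, 0 <= d <= q%:R^-1 & rsum q v x' = rsum q v (x + d).
Proof.
move=> pv q0; have qr : 0 < q%:R :> R by rewrite ltr0n.
pose n := Num.floor ((x' - x) * q%:R).
exists (x' - x - n%:~R / q%:R).
  pose z := (x' - x) * q%:R; have zE : x' - x = z / q%:R by rewrite /z mulfK// gt_eqF.
  have h1 := floor_le_tmp z; have h2 := floorD1_gt z; rewrite intrD in h2.
  rewrite zE -mulrBl divr_ge0 ?subr_ge0 ?(ltW qr)//= ler_pdivrMr// mulVf ?gt_eqF//.
  by move: h2; rewrite -/z -/n; lra.
rewrite -(rsum_period_int (- n) x' pv q0) intrN mulNr; congr rsum; ring.
Qed.

Lemma rsum_lip v q (L : R) : (forall x y, `|v x - v y| <= L * `|x - y|) ->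
  forall x y, `|rsum q v x - rsum q v y| <= q%:R * L * `|x - y|.
Proof.
move=> lv x y; rewrite /rsum -sumrB; apply: (le_trans (ler_norm_sum _ _ _)).
rewrite (_ : q%:R * L * `|x - y| = \sum_(0 <= j < q) L * `|x - y|); last first.
  by rewrite sumr_const_nat subn0 -[RHS]mulr_natl mulrA.
apply: ler_sum => j _; apply: (le_trans (lv _ _)).
by rewrite opprD addrACA subrr addr0.
Qed.

(** The Lipschitz constant [q * L] of the sum is compensated by its period [1 / q]. *)
Lemma rsum_osc v q (L : R) : periodic1 v -> (0 < q)%N ->
  (forall x y, `|v x - v y| <= L * `|x - y|) ->
  forall x y, `|rsum q v x - rsum q v y| <= L.
Proof.
move=> pv q0 lv x y; have [d /andP[d0 dq] ->] := rsum_reduce x y pv q0.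
apply: (le_trans (rsum_lip q lv _ _)).
rewrite opprD addrA subrr sub0r normrN ger0_norm//.
have L0 : 0 <= L by have := le_trans (normr_ge0 _) (lv 1 0); rewrite subr0 normr1 mulr1.
have qr : 0 < q%:R :> R by rewrite ltr0n.
apply: (@le_trans _ _ (q%:R * L * q%:R^-1)); first by rewrite ler_wpM2l// mulr_ge0// ltW.
by rewrite mulrAC mulfV ?gt_eqF// mul1r.
Qed.

Lemma rsum_cper v q : cper v -> cper (rsum q v).
Proof. by move=> cv; exact: (pmean_sum q (fun j => cper_shift _ cv)).1. Qed.

Lemma pmean_rsum v q : cper v -> pmean (rsum q v) = q%:R * pmean v.
Proof.
move=> cv; rewrite (pmean_sum q (fun j => cper_shift _ cv)).2.
under eq_bigr do rewrite pmean_shift//.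
by rewrite sumr_const_nat subn0 mulr_natl.
Qed.

Lemma rsum_taylor v v' q (C : R) :
  (forall x h, `|v (x + h) - v x - h * v' x| <= C * h ^+ 2) ->
  forall x h, `|rsum q v (x + h) - rsum q v x - h * rsum q v' x| <= q%:R * C * h ^+ 2.
Proof.
move=> tv x h; rewrite /rsum mulr_sumr -!sumrB; apply: (le_trans (ler_norm_sum _ _ _)).
rewrite (_ : q%:R * C * h ^+ 2 = \sum_(0 <= j < q) C * h ^+ 2); last first.
  by rewrite sumr_const_nat subn0 -[RHS]mulr_natl mulrA.
by apply: ler_sum => j _; have := tv (x + j%:R / q%:R) h; rewrite [x + _ + h]addrAC.
Qed.

(* Since [rsum q v] has period [1/q], Taylor's formula with step [1/q] bounds
   its derivative. *)
Lemma rsum_mean v v' q (C : R) : cper v -> (0 < q)%N ->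
  (forall x h, `|v (x + h) - v x - h * v' x| <= C * h ^+ 2) ->
  forall x, `|rsum q v x - q%:R * pmean v| <= 2 * C / q%:R.
Proof.
move=> cv q0 tv x; have qr : 0 < q%:R :> R by rewrite ltr0n.
have C0 : 0 <= C by have := le_trans (normr_ge0 _) (tv 0 1); rewrite expr1n mulr1.
have taylor := rsum_taylor q tv.
have der y : `|rsum q v' y| <= C.
  have := taylor y q%:R^-1; rewrite rsum_period//; last exact: cv.1.
  rewrite subrr sub0r normrN normrM ger0_norm ?invr_ge0 ?(ltW qr)// mulrC ler_pdivrMr//.
  by rewrite (_ : _ * q%:R = C)//; field; rewrite gt_eqF.
rewrite distrC -pmean_rsum//; apply: pmean_near; first exact: rsum_cper.
move=> y; have [d /andP[d0 dq] ->] := rsum_reduce x y cv.1 q0.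
have dr : q%:R * d <= 1 by rewrite -ler_pdivlMl// mulr1.
rewrite -[_ - _](subrK (d * rsum q v' x)); apply: (le_trans (ler_normD _ _)).
have h1 : d * `|rsum q v' x| <= C / q%:R by rewrite mulrC ler_pM.
have h2 := taylor x d.
have h3 : q%:R * C * d ^+ 2 <= C / q%:R.
  rewrite (_ : q%:R * C * d ^+ 2 = C * (q%:R * d * d)); last by ring.
  rewrite ler_wpM2l//; apply: le_trans dq; exact: ler_piMl.
rewrite normrM (ger0_norm d0); move: h1 h2 h3; rewrite -[2 * C / _]mulrA.
move: (C / q%:R) (`|_|) (d * _) (_ * d ^+ 2) => c1 c2 c3 c4; lra.
Qed.

(** A frequency divisible by [q] is unchanged by translations by [j / q], so the moment of
    [rsum q v] at [k] is [q] times that of [v]; for a constant it would vanish. *)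
Lemma rsum_nonconst v q k a : cper v -> (0 < q)%N -> (q%:Z %| k)%Z -> k != 0 ->
  pmean (fun x => v x * cosk k a x) != 0 ->
  forall c : R, exists x, rsum q v x != c.
Proof.
move=> cv q0 /dvdzP[l kE] k0 nz c; apply/not_existsP => h.
have hc x : rsum q v x = c by apply/eqP/negPn/negP; exact: h.
have qr : q%:R != 0 :> R by rewrite pnatr_eq0 -lt0n.
move/eqP: nz; apply; apply: (mulfI qr); rewrite mulr0.
transitivity (pmean (fun x => rsum q v x * cosk k a x)); last first.
  by under eq_fun do rewrite hc; rewrite pmeanZ ?pmean_cosk ?mulr0//; exact: cosk_cper.
have cj j : cper (fun x => v (x + j%:R / q%:R) * cosk k a (x + j%:R / q%:R)).
  exact: (cper_shift (j%:R / q%:R) (cperM cv (cosk_cper k a))).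
rewrite (_ : (fun x => rsum q v x * _) = fun x => \sum_(0 <= j < q)
   (v (x + j%:R / q%:R) * cosk k a (x + j%:R / q%:R))); last first.
  apply/funext => x; rewrite /rsum mulr_suml; apply: eq_bigr => j _; congr (_ * _).
  rewrite /cosk -[LHS](cos_int_periodic (l * j%:Z)); congr cos.
  rewrite kE !intrM -!pmulrn; by field.
rewrite (pmean_sum q cj).2; under eq_bigr do
  rewrite (pmean_shift _ (cperM cv (cosk_cper k a))).
by rewrite sumr_const_nat subn0 mulr_natl.
Qed.

End RationalSums.

(** * High frequencies of the roof function *)

Section HighFrequency.
Context {R : realType} (f : R -> R) (m0 M0 Cf : R) (rf : roof f m0 M0 Cf).
Local Notation mu := (@vol R).
Local Notation X := (phase f).
Local Notation sqint := (@sq_integrable _ (plane R) R mu X).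
Local Notation sqn := (@sqnorm _ (plane R) R mu X).
Local Notation ip := (@inner _ (plane R) R mu X).
Local Notation one := (fun _ : R * R => 1 : R).
Local Notation koop := (koopman f).
Local Notation correl := (correlation f).

Let mX : measurable (X : set (plane R)). Proof. exact: (phase_measurable rf). Qed.
Let finX : (mu X < +oo)%E. Proof. exact: (phase_lty rf). Qed.

Lemma roof_cper : cper f.
Proof. by split; [exact: (roof_per rf)|exact: (lipschitz_continuous (roof_lip rf))]. Qed.

Lemma pmean_roof_gt0 : 0 < pmean f.
Proof.
apply: (lt_le_trans (roof_m0 rf)); rewrite -(pmean_cst m0).
by apply: pmean_le; [exact: cper_cst|exact: roof_cper|exact: (roof_ge rf)].
Qed.

Section Eigenfunction.
Context (b : R) (u : R -> R) (cu : cper u).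
Context (fu : forall x, f x = pmean f + (u (x + b) - u x)).
Local Notation f0 := (pmean f).

Let birkhoff_cob (n : int) x : birkhoff b f n x = n%:~R * f0 + (u (x + n%:~R * b) - u x).
Proof.
have nat_cob (m : nat) y : birkhoff b f m y = m%:R * f0 + (u (y + m%:R * b) - u y).
  elim: m => [|m IH]; first by rewrite birkhoff0 !mul0r addr0 subrr addr0.
  have -> : m.+1%:Z = m%:Z + 1 by lia.
  rewrite birkhoffS IH fu -natr1 -pmulrn (_ : y + m%:R * b + b = y + (m%:R + 1) * b); ring.
case: n => m; first exact: nat_cob.
have := birkhoffN b f m.+1 (x - m.+1%:R * b); rewrite NegzE -pmulrn subrK => ->.
by rewrite nat_cob subrK intrN -pmulrn !mulNr; ring.
Qed.

Let th := pi *+ 2 / f0 : R.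
(** Real part of the eigenfunction [exp (i * th * (y + u x))], moved by the time [s]. A return
    lowers [y + u x] by [pmean f], hence the angle by [2 * pi]. *)
Let phi s (p : R * R) : R := cos (th * (p.2 + s + u p.1)).

Let f0_neq0 : f0 != 0. Proof. by rewrite gt_eqF// pmean_roof_gt0. Qed.

Let koop_phi s : koop b s (phi 0) = phi s.
Proof.
apply/funext => p; rewrite /koopman /phi /sflow/=.
rewrite periodic1_frac; last exact: cu.1.
set n := flow_n b f s p; rewrite birkhoff_cob.
rewrite -[RHS](cos_int_periodic (- n)); congr cos.
by rewrite /th intrN; field.
Qed.

Let phi_period s (m : nat) : phi (s + m%:R * f0) = phi s.
Proof.
apply/funext => p; rewrite /phi -[RHS](cos_int_periodic m); congr cos.
by rewrite /th -pmulrn; field.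
Qed.

Let phi_sqint s : sqint (phi s).
Proof.
apply: (sqint_bounded mX finX (C := 1)); last first.
  by move=> p _; rewrite ler_norml cos_geN1 cos_le1.
apply: measurable_funTS.
apply: (@measurableT_comp _ _ _ _ _ _ (cos : R -> R)).
  by apply: continuous_measurable_fun; exact: continuous_cos.
apply: measurable_funM => //; apply: measurable_funD.
  by apply: measurable_funD => //; exact: measurable_snd.
by apply: measurable_fst_comp; exact: cper_measurable.
Qed.

(** The autocorrelation of [phi 0] is periodic in time, so vanishing averages force it to be zero at
    all times [s >= 0]. The times [0] and half a period give opposite inner products with the same
    product of means, so [phi 0] has norm zero. *)
Lemma coboundary_not_weak_mixing : ~ weak_mixing b f.
Proof.
move/(weak_mixingP rf) => wm.
have zero s : 0 <= s -> correl b s (phi 0) (phi 0) = 0.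
  move=> s0; apply/eqP; rewrite -normr_le0; apply/ler_addgt0Pl => e e0; rewrite addr0.
  have [m _] := cesaro0_sample (correl_ucont rf b (phi_sqint 0) (phi_sqint 0))
    (wm _ _ (phi_sqint 0) (phi_sqint 0)) s0 pmean_roof_gt0 e0 0%N.
  by rewrite /correlation koop_phi phi_period -koop_phi => /ltW.
have f00 := pmean_roof_gt0.
have e0 := zero 0 (lexx 0).
have e2 := zero (f0 / 2) (divr_ge0 (ltW f00) (ler0n _ 2)).
have half : phi (f0 / 2) = fun p => -1 * phi 0 p.
  apply/funext => p; rewrite /phi mulN1r -cosDpi; congr cos.
  by rewrite /th; field.
have sq0 : sqn (phi 0) = 0.
  move: e0 e2; rewrite /correlation !koop_phi half (ipZl mX)// /sqnorm.
  by move: (ip _ _) (ip _ one * _ / _) => y z; lra.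
have sq1 : sqn (phi (f0 / 4)) = 0 by rewrite -koop_phi (sqn_koop rf).
have := sqn_one rf; have := area_gt0 rf.
(* A quarter of a period turns the cosine into a sine; both squares have integral zero although they
   add up to [1]. *)
have -> : sqn one = sqn (phi 0) + sqn (phi (f0 / 4)).
  have i1 s := sqint_integrableM mX (phi_sqint s) (phi_sqint s).
  rewrite /sqnorm /inner -RintegralD//; congr (Rintegral _ _ _); apply/funext => p.
  have -> : phi (f0 / 4) p = - sin (th * (p.2 + 0 + u p.1)).
    by rewrite -cosDpihalf /phi; congr cos; rewrite /th; field.
  by rewrite /phi mulrNN mulr1 -!expr2 cos2Dsin2.
by rewrite sq0 sq1; lra.
Qed.

End Eigenfunction.

Lemma high_frequency b E : irrational b -> weak_mixing b f ->
  exists k a, (E < absz k)%N /\ pmean (fun x => f x * cosk k a x) != 0.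
Proof.
move=> ib wm; apply: contrapT => hno.
have cf := roof_cper.
have zero k a : (E < absz k)%N -> pmean (fun x => f x * cosk k a x) = 0.
  by move=> Ek; apply/eqP/negPn/negP => h; apply: hno; exists k, a.
have cg : cper (fun x => f x + - pmean f) by apply: cperD => //; exact: cper_cst.
have g0 : pmean (fun x => f x + - pmean f) = 0.
  by rewrite pmeanD ?pmean_cst ?subrr//; exact: cper_cst.
have [|u cu hu] := trig_coboundary (E := E) ib cg g0.
  move=> k a Ek; have k0 : k != 0 by apply: contraTneq Ek => ->.
  rewrite (_ : (fun x => _) = fun x => f x * cosk k a x + - pmean f * cosk k a x); last first.
    by apply/funext => x; rewrite mulrDl.
  rewrite pmeanD ?pmeanZ ?zero ?pmean_cosk ?mulr0 ?addr0//; try exact: cosk_cper.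
    by apply: cperM => //; exact: cosk_cper.
  by apply: cperZ; exact: cosk_cper.
apply: (coboundary_not_weak_mixing cu _ wm) => x.
by rewrite -hu addrC subrK.
Qed.

End HighFrequency.

Section CesaroSums.
Context {R : realType}.
Implicit Types (F : nat -> R -> R).

Lemma ucont_cst (c : R) : ucont (fun=> c).
Proof. by move=> e e0; exists 1 => // t s _; rewrite subrr normr0. Qed.

Lemma ucont_sum F n : (forall i, ucont (F i)) -> ucont (fun t => \sum_(0 <= i < n) F i t).
Proof.
move=> uF; elim: n => [|n IH].
  by under eq_fun do rewrite big_geq//; exact: ucont_cst.
by under eq_fun do rewrite big_nat_recr//=; exact: ucontD.
Qed.

Lemma cesaro0_sum F n : (forall i, ucont (F i)) -> (forall i, cesaro0 (F i)) ->
  cesaro0 (fun t => \sum_(0 <= i < n) F i t).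
Proof.
move=> uF cF; elim: n => [|n IH].
  by under eq_fun do rewrite big_geq//; exact: cesaro0_cst0.
under eq_fun do rewrite big_nat_recr//= -[X in X + _]mul1r.
by apply: cesaro0_comb => //; apply: ucont_measurable => //; exact: ucont_sum.
Qed.

Lemma sum_nat_bound (a : nat -> R) n i : (forall i, 0 <= a i) -> (i < n)%N ->
  a i <= \sum_(0 <= j < n) a j.
Proof.
move=> a0 ni; rewrite (big_cat_nat (n := i))//= ?(ltnW ni)//.
rewrite [X in _ + X]big_ltn// addrCA ler_wpDr// addr_ge0// sumr_ge0//.
Qed.

End CesaroSums.

(** * Rigidity near rational angles *)

Section Rigidity.
Context {R : realType} (f : R -> R) (m0 M0 Cf : R) (rf : roof f m0 M0 Cf).
Context (C : R) (C0 : 0 < C).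
Context (taylor : forall x h, `|f (x + h) - f x - h * derive1 f x| <= C * h ^+ 2).
Local Notation mu := (@vol R).
Local Notation X := (phase f).
Local Notation sqint := (@sq_integrable _ (plane R) R mu X).
Local Notation nrm := (@norm2 _ (plane R) R mu X).
Local Notation ip := (@inner _ (plane R) R mu X).
Local Notation koop := (koopman f).
Local Notation correl := (correlation f).
Local Notation f0 := (pmean f).

Let mX : measurable (X : set (plane R)). Proof. exact: (phase_measurable rf). Qed.
Let finX : (mu X < +oo)%E. Proof. exact: (phase_lty rf). Qed.

Lemma lift_rational_period (c : int) (p q : nat) g x u : (0 < q)%N -> coprime p q ->
  lift (c%:~R + p%:R / q%:R) f g (x, u + rsum q f x) = lift (c%:~R + p%:R / q%:R) f g (x, u).
Proof.
move=> q0 pq; have qr : q%:R != 0 :> R by rewrite pnatr_eq0 -lt0n.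
rewrite -(rsum_birkhoff c x (roof_per rf) q0 pq) -(lift_shift rf).
rewrite -[RHS](lift_int rf _ _ _ _ (q%:Z * c + p%:Z)); congr lift; congr pair.
by rewrite intrD intrM -!pmulrn; field.
Qed.

Lemma koop_rational_near (c : int) (p q : nat) L g z : (0 < q)%N -> coprime p q ->
  nice f L g -> X z ->
  `|koop (c%:~R + p%:R / q%:R) (q%:R * f0) g z - g z| <= L * (2 * C / q%:R).
Proof.
move=> q0 pq ng Xz; have L0 := nice_L0 ng.
set gam := _ + _ / _; rewrite /koopman sflowE -(lift_id rf g gam Xz).
rewrite [X in _ - lift gam f g X]surjective_pairing -(lift_rational_period c g z.1 z.2 q0 pq).
apply: (le_trans (lift_lip_u rf ng gam z.1 _ _)); rewrite ler_wpM2l//.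
rewrite opprD addrACA subrr add0r distrC.
exact: (rsum_mean (roof_cper rf) q0 taylor).
Qed.

Lemma koop_rational_ip (c : int) (p q : nat) L g : (0 < q)%N -> coprime p q ->
  nice f L g -> measurable_fun [set: plane R] g ->
  `|ip (koop (c%:~R + p%:R / q%:R) (q%:R * f0) g) g - ip g g| <=
  L * 2 * C * Num.sqrt (area f) * nrm g / q%:R.
Proof.
move=> q0 pq ng mg; have sg := nice_sqint rf ng mg.
have L0 := nice_L0 ng.
set gam := _ + _ / _; set t := _ * f0; have sk := sqint_koop rf gam t sg.
rewrite -(ipBl mX)//; apply: (le_trans (ip_le_nrm mX (sqintB mX sk sg) sg)).
rewrite mulrAC ler_wpM2r ?nrm_ge0//.
have qr : 0 < q%:R :> R by rewrite ltr0n.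
have LC : 0 <= L * (2 * C / q%:R) by rewrite !mulr_ge0 ?invr_ge0// ltW.
rewrite [leRHS](_ : _ = (L * (2 * C / q%:R)) * Num.sqrt (area f)); last by ring.
rewrite -[X in X * _](@ger0_norm _ (L * (2 * C / q%:R)))// -sqrtr_sqr -sqrtrM ?sqr_ge0//.
apply: ler_wsqrtr; apply: (sqn_bounded mX finX) => //.
  by apply: measurable_funB; [exact: sk.1|exact: sg.1].
by move=> z Xz; exact: koop_rational_near.
Qed.

Let nice_seq (G : nat -> R * R -> R) := forall i, measurable_fun [set: plane R] (G i) /\
  exists L, nice f L (G i).

(** A fraction [r / s] is fixed in the interval shifted by [c]. Then [p / k = r / s - r / (s * k)]
    tends to it from below as [m] grows, and [p] is prime to [k] because each of its factors [r],
    [r], [m] divides [k - 1]. *)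
Lemma rigid_dense (b : R) (G : nat -> R * R -> R) n (e lo hi : R) :
  weak_mixing b f -> nice_seq G -> 0 < e -> lo < hi ->
  exists a t, [/\ lo < a < hi, 0 <= t & forall i j, (i < n)%N -> (j < n)%N ->
    `|ip (koop a t (G i)) (G i) - ip (G i) (G i)| < e /\ `|correl b t (G i) (G j)| < e].
Proof.
move=> /(weak_mixingP rf) wm nG e0 lohi.
have sG i : sqint (G i) by have [mi [L nL]] := nG i; exact: (nice_sqint rf nL mi).
have hL : forall i, exists L, nice f L (G i) by move=> i; have [] := nG i.
have {hL} [L nL] := choice hL.
pose c : int := Num.floor lo - 1.
have loc : 1 <= lo - c%:~R by have := floor_le_tmp lo; rewrite /c intrB; lra.
pose s := (Num.truncn ((hi - lo)^-1)).+1.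
have hs : (hi - lo)^-1 < s%:R by exact: truncnS_gt.
have s0 : 0 < s%:R :> R by rewrite ltr0n.
have hs' : s%:R^-1 < hi - lo.
  by rewrite -[ltRHS]invrK ltf_pV2// posrE invr_gt0 subr_gt0.
pose r := (Num.truncn ((lo - c%:~R) * s%:R)).+1.
have r1 : (lo - c%:~R) * s%:R < r%:R by exact: truncnS_gt.
have r2 : r%:R <= (lo - c%:~R) * s%:R + 1.
  rewrite /r -[X in X <= _]natr1 lerD2r.
  have h0 : 0 <= (lo - c%:~R) * s%:R by rewrite mulr_ge0 ?(ltW s0)//; lra.
  by have /andP[] := truncn_itv h0.
have r0 : 0 < r%:R :> R by rewrite ltr0n.
have rs1 : lo - c%:~R < r%:R / s%:R by rewrite ltr_pdivlMr.
have rs2 : r%:R / s%:R < hi - c%:~R.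
  rewrite ltr_pdivrMr//; apply: (le_lt_trans r2).
  have := hs'; rewrite -[X in X < _]mul1r ltr_pdivrMr//; lra.
pose eta := r%:R / s%:R - (lo - c%:~R); have eta0 : 0 < eta by rewrite subr_gt0.
pose B := \sum_(0 <= i < n) (L i * 2 * C * Num.sqrt (area f) * nrm (G i)).
have Bge i : 0 <= L i * 2 * C * Num.sqrt (area f) * nrm (G i).
  by rewrite !mulr_ge0 ?nrm_ge0 ?sqrtr_ge0 ?(nice_L0 (nL i)) ?(ltW C0).
(* From [mm] on, the first term keeps the angle above [lo], and the second makes the rigidity error,
   at most [B / k], less than [e]. *)
pose mm := (Num.truncn (r%:R / (s%:R * eta) + B / e)).+1.
have hmm : r%:R / (s%:R * eta) + B / e < mm%:R by exact: truncnS_gt.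
have B0 : 0 <= B / e by rewrite divr_ge0 ?sumr_ge0// ltW.
have re0 : 0 <= r%:R / (s%:R * eta) by rewrite divr_ge0 ?mulr_ge0// ltW.
(* One function of time dominating all pairs, so that a single [m] serves them all. *)
pose A t := \sum_(0 <= i < n) \sum_(0 <= j < n) `|correl b t (G i) (G j)|.
have uc i j : ucont (fun t => `|correl b t (G i) (G j)|).
  by apply: ucont_norm; exact: (correl_ucont rf).
have uA : ucont A by apply: ucont_sum => i; apply: ucont_sum => j; exact: uc.
have cA : cesaro0 A.
  apply: cesaro0_sum => i; first by apply: ucont_sum => j; exact: uc.
  by apply: cesaro0_sum => j; [exact: uc|apply: cesaro0_norm; exact: wm].
have f00 := pmean_roof_gt0 rf.
have srf : 0 < (s * r)%:R * f0 by rewrite mulr_gt0// natrM mulr_gt0.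
have [m hm Am] := cesaro0_sample uA cA (ltW f00) srf e0 mm.
pose k := (s * r * m).+1; pose p := (r * r * m)%N.
have cop : coprime p k.
  have e1 : coprime (s * r * m) k by exact: coprimenS.
  have : coprime (r * m) k.
    by move: e1; rewrite -mulnA coprimeMl => /andP[].
  by rewrite /p !coprimeMl => /andP[-> ->].
have k0 : (0 < k)%N by [].
have kr : 0 < k%:R :> R by rewrite ltr0n.
have km : mm%:R <= k%:R :> R.
  rewrite ler_nat /k; apply: (leq_trans hm); rewrite ltnW// ltnS leq_pmull// muln_gt0/=.
have pk : p%:R / k%:R = r%:R / s%:R - r%:R / (s%:R * k%:R) :> R.
  have kE : k%:R = s%:R * r%:R * m%:R + 1 :> R by rewrite /k -natr1 !natrM.
  have kn : s%:R * r%:R * m%:R + 1 != 0 :> R by rewrite -kE gt_eqF.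
  by rewrite kE /p !natrM; field; rewrite kn gt_eqF.
exists (c%:~R + p%:R / k%:R), (k%:R * f0); split; last 2 first.
- by rewrite mulr_ge0// ltW.
- move=> i j ni nj; split.
    have [mi _] := nG i.
    apply: (le_lt_trans (koop_rational_ip c k0 cop (nL i) mi)).
    rewrite ltr_pdivrMr//.
    have : B / e < k%:R by move: hmm km re0; lra.
    rewrite ltr_pdivrMr// [k%:R * e]mulrC => h; apply: le_lt_trans h.
    exact: (sum_nat_bound (a := fun i => L i * 2 * C * Num.sqrt (area f) * nrm (G i)) Bge ni).
  have -> : k%:R * f0 = f0 + m%:R * ((s * r)%:R * f0).
    by rewrite /k -natr1 !natrM; ring.
  apply: le_lt_trans Am; apply: le_trans (ler_norm _).
  have h1 := sum_nat_bound (a := fun j => `|correl b (f0 + m%:R * ((s * r)%:R * f0)) (G i) (G j)|)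
    (fun=> normr_ge0 _) nj.
  apply: (le_trans h1).
  apply: (sum_nat_bound (a := fun i => \sum_(0 <= j < n) `|correl b _ (G i) (G j)|)) => // i'.
  by rewrite sumr_ge0.
  have small : r%:R / (s%:R * k%:R) < eta.
    rewrite ltr_pdivrMr ?mulr_gt0//.
    have : r%:R / (s%:R * eta) < k%:R by move: hmm km B0; lra.
    by rewrite ltr_pdivrMr ?mulr_gt0//; lra.
  have : 0 < r%:R / (s%:R * k%:R) :> R by rewrite divr_gt0 ?mulr_gt0.
  by rewrite pk; move: small rs1 rs2; rewrite /eta; lra.
Qed.

End Rigidity.

(** * Equidistribution near rational angles *)

Section Cumulative.
Context {R : realType}.
Local Notation m1 := (@lebesgue_measure R).
Implicit Types (psi phi : R -> R) (u v w h r L : R) (m n k : nat).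

Definition unit_valued psi := measurable_fun [set: R] psi /\ forall u, 0 <= psi u <= 1.

Definition cumul psi w : R := Rintegral m1 `[0, w[ psi.

Lemma unit_valued_shift psi v : unit_valued psi -> unit_valued (fun u => psi (u + v)).
Proof.
move=> [mp p01]; split=> [|u]; last exact: p01.
by apply: measurableT_comp => //; exact: measurable_addr.
Qed.

Let itv_lty w : (m1 `[0%R, w[ < +oo)%E.
Proof. by rewrite lebesgue_measure_itv/=; case: ifP => _; rewrite ?sube0 ltry. Qed.

Let bounded_integrable psi (C w : R) : measurable_fun [set: R] psi -> (forall x, `|psi x| <= C) ->
  m1.-integrable `[0, w[ (EFin \o psi).
Proof.
move=> mv vC; apply: measurable_bounded_integrable => //.
- exact: itv_lty.
- exact: measurable_funTS.
- by exists `|C|; split=> // y Cy x _ /=; apply: (le_trans (vC x)); apply/ltW/(le_lt_trans _ Cy)/ler_norm.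
Qed.

Let unit_integrable psi w : unit_valued psi -> m1.-integrable `[0, w[ (EFin \o psi).
Proof.
move=> [mp p01]; apply: (bounded_integrable w (C := 1)) => // x.
by have /andP[h1 h2] := p01 x; rewrite ger0_norm.
Qed.

Lemma cumul_cst (c w : R) : 0 <= w -> cumul (fun=> c) w = c * w.
Proof.
move=> w0; rewrite /cumul Rintegral_cst//= lebesgue_measure_itv/= lte_fin.
by move: w0; rewrite le_eqVlt => /orP[/eqP <-|->]; rewrite ?ltxx ?sube0.
Qed.

Lemma cumul_near psi phi (d w : R) : unit_valued psi -> unit_valued phi -> 0 <= w ->
  (forall u, 0 <= u < w -> `|psi u - phi u| <= d) ->
  `|cumul psi w - cumul phi w| <= d * w.
Proof.
move=> up uq w0 h.
have half a b : unit_valued a -> unit_valued b ->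
    (forall u, 0 <= u < w -> `|a u - b u| <= d) -> cumul a w <= cumul b w + d * w.
  move=> ua ub hab; rewrite -[in d * w](cumul_cst d w0) /cumul -RintegralD//.
  - apply: le_Rintegral => //; first exact: unit_integrable.
      apply: (bounded_integrable w (C := 1 + `|d|)).
        by apply: measurable_funD => //; exact: ub.1.
      move=> x; apply: (le_trans (ler_normD _ _)); rewrite lerD2r.
      by have /andP[h1 h2] := ub.2 x; rewrite ger0_norm.
    move=> x /=; rewrite in_itv/= => /hab; rewrite ler_distl => /andP[_]; lra.
  - exact: unit_integrable.
  - by apply: (bounded_integrable w (C := `|d|)).
rewrite ler_distl; apply/andP; split; last exact: half.
rewrite lerBlDr; apply: half => // u hu; rewrite distrC; exact: h.
Qed.

Lemma cumul_eq psi phi w : unit_valued psi -> unit_valued phi -> 0 <= w ->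
  (forall u, 0 <= u < w -> psi u = phi u) -> cumul psi w = cumul phi w.
Proof.
move=> up uq w0 h; apply/eqP; rewrite -subr_eq0 -normr_le0.
have := @cumul_near psi phi 0 w up uq w0; rewrite mul0r; apply.
by move=> u /h ->; rewrite subrr normr0.
Qed.

Lemma cumul_ge0 psi w : unit_valued psi -> 0 <= cumul psi w.
Proof. by move=> [_ h]; apply: Rintegral_ge0 => x _; have /andP[] := h x. Qed.

Lemma cumul_le psi w : unit_valued psi -> 0 <= w -> cumul psi w <= w.
Proof.
move=> up w0; rewrite -[leRHS]mul1r -(cumul_cst 1 w0).
apply: le_Rintegral => //; first exact: unit_integrable.
  by apply: (bounded_integrable w (C := 1)) => // x; rewrite normr1.
by move=> x _; have /andP[] := up.2 x.
Qed.

Lemma cumulD psi u w : unit_valued psi -> 0 <= u -> 0 <= w ->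
  cumul psi (u + w) = cumul psi u + cumul (fun x => psi (x + u)) w.
Proof.
move=> up u0 w0.
have U : `[0, u[%classic `|` `[u, (u + w)[%classic = `[0, (u + w)[%classic :> set R.
  by rewrite -itv_bndbnd_setU// bnd_simp//; rewrite lerDl.
have -> : cumul (fun x => psi (x + u)) w = Rintegral m1 `[u, (u + w)[ psi.
  rewrite /cumul /Rintegral; congr fine.
  rewrite -(@ge0_integral_shift _ u `[u, (u + w)[ (fun x => (psi x)%:E))//.
  - congr (integral _ _ _); apply/seteqP; split => x /=; rewrite !in_itv/=; lra.
  - by apply/measurable_EFinP; exact: up.1.
  - by move=> x; have /andP[] := up.2 x.
rewrite /cumul -U Rintegral_setU//.
- by rewrite U; exact: unit_integrable.
- by apply/disj_setPS => y /= [] /=; rewrite !in_itv/=; lra.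
Qed.

Let cumul_mult psi r k w : unit_valued psi -> 0 < r -> (forall u, psi (u + r) = psi u) ->
  0 <= w -> cumul psi (k%:R * r + w) = k%:R * cumul psi r + cumul psi w.
Proof.
move=> up r0 pp w0; elim: k => [|k IH]; first by rewrite !mul0r !add0r.
have kw : 0 <= k%:R * r + w by rewrite addr_ge0// mulr_ge0// ltW.
have -> : k.+1%:R * r + w = r + (k%:R * r + w) by rewrite -natr1; ring.
rewrite cumulD ?(ltW r0)// (_ : (fun x => psi (x + r)) = psi); last exact/funext.
by rewrite IH -natr1; ring.
Qed.

Let cumul_full psi r v : unit_valued psi -> 0 < r -> (forall u, psi (u + r) = psi u) ->
  cumul (fun u => psi (u + v)) r = cumul psi r.
Proof.
move=> up r0 pp.
have pp_nat k u : psi (u + k%:R * r) = psi u.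
  elim: k => [|k IH]; first by rewrite mul0r addr0.
  by rewrite -natr1 mulrDl mul1r addrA pp.
have pos y : 0 <= y -> cumul (fun u => psi (u + y)) r = cumul psi r.
  move=> y0; have := cumulD up y0 (ltW r0).
  rewrite addrC -{1}[r]mul1r (cumul_mult 1)// mul1r addrC => /addrI; exact: esym.
pose n := (Num.truncn (- v / r)).+1.
have hn : - v / r < n%:R by exact: truncnS_gt.
rewrite -(pos (v + n%:R * r)).
  by congr cumul; apply/funext => u; rewrite addrA pp_nat.
by move: hn; rewrite ltr_pdivrMr//; lra.
Qed.

(** Whole periods contribute their exact mean; the last incomplete one costs at most [r]. *)
Let cumul_avg0 psi r w : unit_valued psi -> 0 < r -> (forall u, psi (u + r) = psi u) ->
  0 <= w -> `|cumul psi w - w * (cumul psi r / r)| <= r.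
Proof.
move=> up r0 pp w0.
pose k := Num.truncn (w / r).
have wr0 : 0 <= w / r by rewrite divr_ge0// ltW.
have /andP[k1 k2] := truncn_itv wr0; rewrite -/k in k1 k2.
pose y := w - k%:R * r.
have y0 : 0 <= y by move: k1; rewrite ler_pdivlMr// /y subr_ge0.
have yr : y < r by move: k2; rewrite ltr_pdivrMr// -natr1 mulrDl mul1r /y; lra.
have wE : w = k%:R * r + y by rewrite /y; ring.
rewrite [in cumul psi w]wE cumul_mult// [X in - (X * _)]wE.
rewrite [X in `|X|](_ : _ = cumul psi y - y * (cumul psi r / r)); last first.
  by field; rewrite gt_eqF.
have e0 : 0 <= cumul psi r / r by rewrite divr_ge0 ?cumul_ge0// ltW.
have e1 : cumul psi r / r <= 1 by rewrite ler_pdivrMr// mul1r cumul_le// ltW.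
have c0 := cumul_ge0 y up; have c1 := cumul_le up y0.
have h1 : y * (cumul psi r / r) <= y by rewrite ler_piMr.
have h2 := mulr_ge0 y0 e0.
by rewrite ler_norml; apply/andP; split; lra.
Qed.

Section Periodic.
Context psi L r (up : unit_valued psi) (r0 : 0 < r)
  (lp : forall u v, `|psi u - psi v| <= L * `|u - v|)
  (pp : forall u, psi (u + r) = psi u).

Let cumul_avg v w : 0 <= w ->
  `|cumul (fun u => psi (u + v)) w - w * (cumul psi r / r)| <= r.
Proof.
move=> w0; rewrite -(cumul_full v up r0 pp).
apply: (cumul_avg0 (unit_valued_shift v up)) => // u.
by rewrite addrAC pp.
Qed.

(** On each step of length [h], [psi] varies by at most [L * h]. *)
Let cumul_riemann v h m : 0 <= h ->
  `|\sum_(0 <= i < m) psi (v + i%:R * h) * h - cumul (fun u => psi (u + v)) (m%:R * h)|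
  <= m%:R * (L * h * h).
Proof.
move=> h0; elim: m => [|m IH].
  by rewrite big_geq// !mul0r sub0r normrN /cumul set_itvco0 Rintegral_set0 normr0.
have mh : 0 <= m%:R * h by rewrite mulr_ge0.
rewrite big_nat_recr//= -[m.+1%:R]natr1 mulrDl mul1r cumulD//; last exact: unit_valued_shift.
rewrite opprD addrACA mulrDl mul1r; apply: (le_trans (ler_normD _ _)); apply: lerD => //.
rewrite -[psi _ * h](cumul_cst _ h0).
have u2 : unit_valued (fun x => psi (x + m%:R * h + v)).
  by apply: (unit_valued_shift (psi := fun x => psi (x + v))); exact: unit_valued_shift.
apply: cumul_near => //; first by split=> // _; exact: up.2.
move=> u /andP[u0 uh]; apply: (le_trans (lp _ _)).
have L0 : 0 <= L by have := le_trans (normr_ge0 _) (lp 1 0); rewrite subr0 normr1 mulr1.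
rewrite ler_wpM2l//.
rewrite (_ : _ - _ = - u); last by ring.
by rewrite normrN ger0_norm// ltW.
Qed.

Let periodic_average_pos v h m : 0 < h ->
  `|\sum_(0 <= i < m) psi (v + i%:R * h) - m%:R * (cumul psi r / r)| <=
  m%:R * (L * h) + r / h.
Proof.
move=> h0; have mh : 0 <= m%:R * h by rewrite mulr_ge0// ltW.
rewrite -(ler_pM2r h0) -[X in _ * X <= _](gtr0_norm h0) -normrM.
rewrite mulrBl [in leRHS]mulrDl divfK ?gt_eqF// mulr_suml.
have h1 := cumul_riemann v m (ltW h0); have h2 := cumul_avg v mh.
rewrite (_ : m%:R * _ * h = m%:R * h * (cumul psi r / r)); last by ring.
rewrite -[X in `|X|](subrKA (cumul (fun u => psi (u + v)) (m%:R * h))).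
apply: (le_trans (ler_normD _ _)); apply: lerD => //.
by rewrite -mulrA.
Qed.

(* Weyl-type estimate for an arithmetic progression on a circle of length r. *)
Lemma periodic_average v h m : h != 0 ->
  `|\sum_(0 <= i < m) psi (v + i%:R * h) - m%:R * (cumul psi r / r)| <=
  m%:R * (L * `|h|) + r / `|h|.
Proof.
move=> hn; case: (ltrP 0 h) => [h0|hle].
  by rewrite (gtr0_norm h0); exact: periodic_average_pos.
have h0 : 0 < - h by rewrite oppr_gt0 lt_neqAle hn.
rewrite (ler0_norm hle); case: m => [|m].
  by rewrite big_geq// !mul0r subrr normr0 add0r divr_ge0// ltW.
(* For a negative step, the progression is read backwards from its last point. *)
rewrite big_nat_rev/=.
rewrite (eq_big_nat _ _ (F2 := fun i => psi (v + m%:R * h + i%:R * (- h)))).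
  exact: periodic_average_pos.
move=> i /andP[_ im]; congr psi; rewrite add0n subSS natrB//; ring.
Qed.

End Periodic.
End Cumulative.

Section CellSums.
Context {R : realType} (f : R -> R) (m0 M0 Cf : R) (rf : roof f m0 M0 Cf).
Context (g : R * R -> R) (L : R) (ng : nice f L g) (g0 : forall p, 0 <= g p).
Implicit Types (x y u : R).

Lemma nice_slice x : unit_valued (fun y => g (x, y)).
Proof.
have [g1 _ _ lg] := ng; split; last first.
  by move=> u; rewrite g0/=; exact: le_trans (ler_norm _) (g1 _).
apply: continuous_measurable_fun; apply: (@lipschitz_continuous _ _ L) => y y'.
by have := lg x y x y'; rewrite subrr normr0 add0r.
Qed.

Lemma lift_slice gam x : unit_valued (fun u => lift gam f g (x, u)).
Proof.
split; last first.
  by move=> u; rewrite g0/=; exact: le_trans (ler_norm _) (lift_le1 ng _ _).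
apply: continuous_measurable_fun; apply: (@lipschitz_continuous _ _ L) => y y'.
exact: (lift_lip_u rf ng).
Qed.

(** The integral over the fibre above [x]; its sum over a periodic orbit of the base is the integral
    of [g] along the closed orbit of the flow ([orbit_sum]). *)
Definition cell_sum x := cumul (fun y => g (x, y)) (f x).

Lemma cell_sum_per : periodic1 cell_sum.
Proof.
have [_ pg _ _] := ng => x; rewrite /cell_sum (roof_per rf).
by congr cumul; apply/funext => y; rewrite pg.
Qed.

Let f_ge0 x : 0 <= f x. Proof. exact: le_trans (ltW (roof_m0 rf)) (roof_ge rf x). Qed.

Lemma cell_sum_lip x x' : `|cell_sum x - cell_sum x'| <= M0 * L * `|x - x'|.
Proof.
(* Since [g] vanishes above the roof, all fibres may be given the length [M0]; then only the
   integrand depends on the base point. *)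
have full z : cell_sum z = cumul (fun y => g (z, y)) M0.
  have fM := roof_le rf z.
  have fM0 : 0 <= M0 - f z by rewrite subr_ge0.
  rewrite -[in RHS](subrKC (f z) M0) cumulD//; last exact: nice_slice.
  rewrite (cumul_eq (phi := fun=> 0) _ _ fM0).
  - by rewrite cumul_cst// mul0r addr0.
  - exact: (unit_valued_shift _ (nice_slice z)).
  - by split=> // _; rewrite lexx ler01.
  - have [_ _ z0 _] := ng => u /andP[u0 _]; apply: z0; apply/negP => /andP[_]; lra.
rewrite !full.
have M00 := ltW (roof_M0 rf).
rewrite (_ : _ * _ = (L * `|x - x'|) * M0); last by ring.
apply: cumul_near => //; try exact: nice_slice.
have [_ _ _ lg] := ng => u _.
by have := lg x u x' u; rewrite [u - u]subrr normr0 addr0.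
Qed.

Lemma cell_sum_le x : 0 <= cell_sum x <= f x.
Proof. by rewrite cumul_ge0 ?cumul_le//; exact: nice_slice. Qed.

Let birkhoff_sum gam n x : cumul (fun u => lift gam f g (x, u)) (birkhoff gam f n%:Z x) =
  \sum_(0 <= i < n) cell_sum (x + i%:R * gam).
Proof.
elim: n => [|n IH].
  by rewrite big_geq// birkhoff0 /cumul set_itvco0 Rintegral_set0.
have -> : n.+1%:Z = n%:Z + 1 by lia.
have b0 : 0 <= birkhoff gam f n%:Z x by apply: sumr_ge0 => i _; exact: f_ge0.
rewrite birkhoffS cumulD//; last exact: lift_slice.
rewrite IH big_nat_recr//=; congr (_ + _).
apply: cumul_eq => //.
- exact: (unit_valued_shift _ (lift_slice gam x)).
- exact: nice_slice.
move=> u hu; rewrite -(lift_shift rf g gam x u n).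
rewrite (lift_eq rf ng (n := 0)).
- by rewrite mul0r addr0 birkhoff0 subr0.
- by rewrite birkhoff0 birkhoffS birkhoff0 add0r mul0r addr0.
Qed.

Lemma orbit_sum (c : int) (p q : nat) x : (0 < q)%N -> coprime p q ->
  cumul (fun u => lift (c%:~R + p%:R / q%:R) f g (x, u)) (rsum q f x) = rsum q cell_sum x.
Proof.
move=> q0 pq; rewrite -(rsum_birkhoff c x (roof_per rf) q0 pq) birkhoff_sum.
by rewrite -(rsum_birkhoff c x cell_sum_per q0 pq).
Qed.

Lemma rsum_roof q x : q%:R * m0 <= rsum q f x <= q%:R * M0.
Proof.
have cst (z : R) : \sum_(0 <= j < q) z = q%:R * z.
  by rewrite sumr_const_nat subn0 mulr_natl.
rewrite -!cst; apply/andP; split; apply: ler_sum => j _.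
  exact: (roof_ge rf).
exact: (roof_le rf).
Qed.

(** The mean of [g] along the periodic orbit through [x], for an angle of denominator [q]. *)
Definition orbit_mean q x := rsum q cell_sum x / rsum q f x.

Lemma orbit_mean01 q x : (0 < q)%N -> 0 <= orbit_mean q x <= 1.
Proof.
move=> q0; have /andP[h _] := rsum_roof q x.
have r0 : 0 < rsum q f x by apply: lt_le_trans h; rewrite mulr_gt0 ?ltr0n// (roof_m0 rf).
rewrite divr_ge0/= ?(ltW r0)//; last first.
  by apply: sumr_ge0 => j _; have /andP[] := cell_sum_le (x + j%:R / q%:R).
rewrite ler_pdivrMr// mul1r; apply: ler_sum => j _.
by have /andP[] := cell_sum_le (x + j%:R / q%:R).
Qed.

(** Numerator and denominator oscillate by bounded amounts ([rsum_osc]), whereas the denominator is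
    at least [q * m0]: for large [q] all orbit means are nearly equal. *)
Lemma orbit_mean_osc q x x' : (0 < q)%N ->
  `|orbit_mean q x - orbit_mean q x'| <= (M0 * L + Cf) / m0 / q%:R.
Proof.
move=> q0; have qr : 0 < q%:R :> R by rewrite ltr0n.
have m00 := roof_m0 rf.
have /andP[h _] := rsum_roof q x; have /andP[h' _] := rsum_roof q x'.
have qm : 0 < q%:R * m0 by rewrite mulr_gt0.
have r0 : 0 < rsum q f x by exact: lt_le_trans h.
have r0' : 0 < rsum q f x' by exact: lt_le_trans h'.
have /andP[e0 e1] := orbit_mean01 x' q0.
have d1 := rsum_osc cell_sum_per q0 cell_sum_lip x x'.
have d2 := rsum_osc (roof_per rf) q0 (roof_lip rf) x' x.
have -> : orbit_mean q x - orbit_mean q x' =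
  ((rsum q cell_sum x - rsum q cell_sum x') + orbit_mean q x' * (rsum q f x' - rsum q f x)) / rsum q f x.
  by rewrite /orbit_mean; field; rewrite !gt_eqF.
have num : `|(rsum q cell_sum x - rsum q cell_sum x') + orbit_mean q x' * (rsum q f x' - rsum q f x)|
    <= M0 * L + Cf.
  apply: (le_trans (ler_normD _ _)); apply: lerD => //.
  by rewrite normrM (ger0_norm e0); apply: le_trans d2; rewrite ler_piMl.
rewrite normrM normfV (gtr0_norm r0) ler_pdivrMr//.
apply: (le_trans num); rewrite -mulrA -invfM.
have n0 : 0 <= M0 * L + Cf by exact: le_trans num.
rewrite mulrAC ler_pdivlMr; last by rewrite mulrC.
by rewrite ler_wpM2l// mulrC.
Qed.

End CellSums.

(** * Integration over a box containing the phase space *)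

Section Box.
Context {R : realType} (M0 : R) (M00 : 0 < M0).
Local Notation mu := (@vol R).
Implicit Types (H : R * R -> R) (a C : R).

(** Unlike the phase space, the box is invariant under horizontal rotations, over which the
    correlation integrals are averaged. *)
Definition box : set (R * R) := [set p | 0 <= p.1 < 1] `&` [set p | 0 <= p.2 < M0].

Lemma vol_box : mu box = M0%:E.
Proof. by rewrite vol_rect ?ler01 ?ltW// !subr0 mul1r. Qed.

Lemma box_measurable : measurable (box : set (plane R)).
Proof.
apply: measurableI; first exact: measurable_strip.
rewrite (_ : [set p | _] = [set p | 0 <= p.2] `&` [set p | p.2 < M0]).
  have m2 : measurable_fun [set: R * R] (fun p => p.2) by exact: measurable_snd.
  by apply: measurableI; [exact: measurable_le2|exact: measurable_lt2].
by apply/seteqP; split => p /=; [move=> /andP[-> ->]|move=> [? ?]; apply/andP].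
Qed.

Let box_lty : (mu box < +oo)%E. Proof. by rewrite vol_box ltry. Qed.

Definition bmeas H := measurable_fun [set: plane R] H /\ exists C, forall p, `|H p| <= C.

Lemma bmeasD H H' : bmeas H -> bmeas H' -> bmeas (fun p => H p + H' p).
Proof.
move=> [m1 [C h]] [m2 [C' h']]; split; first exact: measurable_funD.
by exists (C + C') => p; apply: (le_trans (ler_normD _ _)); exact: lerD.
Qed.

Lemma bmeasM H H' : bmeas H -> bmeas H' -> bmeas (fun p => H p * H' p).
Proof.
move=> [m1 [C h]] [m2 [C' h']]; split; first exact: measurable_funM.
by exists (C * C') => p; rewrite normrM; exact: ler_pM.
Qed.

Lemma bmeas_cst C : bmeas (fun=> C).
Proof. by split; [exact: measurable_cst|exists `|C|]. Qed.

Lemma bmeas_norm H : bmeas H -> bmeas (fun p => `|H p|).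
Proof.
move=> [m1 [C h]]; split; first exact: measurableT_comp.
by exists C => p; rewrite normr_id.
Qed.

Lemma bmeas_integrable H : bmeas H -> mu.-integrable box (EFin \o H).
Proof.
move=> [mH [C hC]]; apply: measurable_bounded_integrable => //.
- exact: box_measurable.
- exact: measurable_funTS.
- by exists `|C|; split=> // y Cy x _ /=; apply: (le_trans (hC x)); apply/ltW/(le_lt_trans _ Cy)/ler_norm.
Qed.

Definition box_integral H := Rintegral mu box H.

Lemma bintD H H' : bmeas H -> bmeas H' -> box_integral (fun p => H p + H' p) = box_integral H + box_integral H'.
Proof. by move=> b b'; rewrite /box_integral RintegralD//; [exact: box_measurable|exact: bmeas_integrable..]. Qed.

Lemma bintZ c H : bmeas H -> box_integral (fun p => c * H p) = c * box_integral H.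
Proof. by move=> b; rewrite /box_integral RintegralZl//; [exact: box_measurable|exact: bmeas_integrable]. Qed.

Lemma bint_le H H' : bmeas H -> bmeas H' -> (forall p, box p -> H p <= H' p) -> box_integral H <= box_integral H'.
Proof. by move=> b b' h; apply: le_Rintegral => //; [exact: box_measurable|exact: bmeas_integrable..]. Qed.

Lemma bint_cst C : box_integral (fun=> C) = C * M0.
Proof. by rewrite /box_integral Rintegral_cst//; [rewrite vol_box|exact: box_measurable]. Qed.

Lemma bint_norm H H' : bmeas H -> bmeas H' -> (forall p, box p -> `|H p| <= H' p) ->
  `|box_integral H| <= box_integral H'.
Proof.
move=> b b' h; apply: (@le_trans _ _ (box_integral (fun p => `|H p|))).
  by apply: le_normr_Rintegral; [exact: box_measurable|exact: bmeas_integrable].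
by apply: bint_le => //; exact: bmeas_norm.
Qed.

Lemma bmeas_sum (F : nat -> R * R -> R) n : (forall i, bmeas (F i)) ->
  bmeas (fun p => \sum_(0 <= i < n) F i p).
Proof.
move=> bF; elim: n => [|n IH].
  by under eq_fun do rewrite big_geq//; exact: bmeas_cst.
by under eq_fun do rewrite big_nat_recr//=; exact: bmeasD.
Qed.

Lemma bint_sum (F : nat -> R * R -> R) n : (forall i, bmeas (F i)) ->
  box_integral (fun p => \sum_(0 <= i < n) F i p) = \sum_(0 <= i < n) box_integral (F i).
Proof.
move=> bF; elim: n => [|n IH].
  by under eq_fun do rewrite big_geq//; rewrite bint_cst mul0r big_geq.
under eq_fun do rewrite big_nat_recr//=.
by rewrite bintD ?IH ?big_nat_recr//; exact: bmeas_sum.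
Qed.

(** As in [flow_in], points off the box go to a point off the box, so that the preimage of the box
    is the box itself. *)
Definition box_shift a (p : plane R) : plane R :=
  if p \in box then skew a (fun=> 0) p else (-1, 0).

Let box_shift_measurable a : measurable_fun [set: plane R] (box_shift a).
Proof.
apply: measurable_fun_ifT; last exact: measurable_cst.
  apply: (measurable_fun_bool true) => //.
  rewrite setTI (_ : _ @^-1` _ = box); first exact: box_measurable.
  by apply/seteqP; split => p /=; [move=> h; exact/set_mem|move/mem_set].
exact: (measurable_skew a (measurable_cst (0 : R))).
Qed.

Let skew_box a p : box p -> box (skew a (fun=> 0) p).
Proof. by move=> [_ h2]; split; rewrite /= ?addr0//; exact: frac_in01. Qed.

Let box_shift_preimage a (A : set (R * R)) : A `<=` box ->
  box_shift a @^-1` A = strip `&` [set p | A (skew a (fun=> 0) p)].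
Proof.
move=> AX; apply/seteqP; split => p /=; rewrite /box_shift.
  case: ifPn => [|_ /AX [/= h _]]; first by rewrite inE => -[h _] Ap; split.
  by exfalso; move: h; lra.
move=> [h1 h2]; have [_ h3] := AX _ h2.
by rewrite mem_set//; split=> //; move: h3; rewrite /= addr0.
Qed.

Lemma bint_shift a H : bmeas H -> (forall p, 0 <= H p) ->
  (forall x y, H (x + 1, y) = H (x, y)) ->
  box_integral (fun p => H (p.1 + a, p.2)) = box_integral H.
Proof.
move=> [mH _] H0 Hp; rewrite /box_integral /Rintegral; congr fine.
have mE : measurable_fun (box : set (plane R)) (EFin \o H).
  by apply/measurable_EFinP; exact: measurable_funTS.
have H0' p : p \in box -> (0 <= (EFin \o H) p)%E by rewrite lee_fin.
have := @ge0_integral_pushforward _ _ _ _ R _ (box_shift_measurable a) mu box _ box_measurable mE H0'.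
rewrite (box_shift_preimage a (@subset_refl _ box)).
rewrite (_ : strip `&` _ = box); last first.
  apply/seteqP; split => p /=; last by move=> bp; split; [exact: bp.1|exact: skew_box].
  by move=> [h1 [_ h2]]; split=> //; move: h2; rewrite /= addr0.
move=> E; transitivity (\int[mu]_(p in box) ((EFin \o H) \o box_shift a) p)%E.
  apply: eq_integral => -[x y] pX /=; rewrite /box_shift pX /skew/= addr0; congr _%:E.
  by rewrite (periodic1_frac (f := fun z => H (z, y)))// => z; exact: Hp.
rewrite -E; apply: eq_measure_integral => A mA AX.
have As : A `<=` strip by move=> p /AX[].
rewrite -[in RHS](vol_skew a (measurable_cst (0 : R)) mA As) /= /pushforward; congr (mu _).
exact: box_shift_preimage.
Qed.

Lemma bmeas_comp_shift a H : bmeas H -> bmeas (fun p => H (p.1 + a, p.2)).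
Proof.
move=> [mH [C hC]]; split; last by exists C => p; exact: hC.
have m : measurable_fun [set: plane R] (fun p : plane R => (p.1 + a, p.2) : plane R).
  by apply: measurable_fun_pair; [apply: measurable_funD => //; exact: measurable_fst|exact: measurable_snd].
exact: (measurableT_comp mH m).
Qed.

Lemma bmeas_indic (A : set (plane R)) : measurable A -> bmeas (\1_A : R * R -> R).
Proof.
move=> mA; split; first exact: measurable_indic.
by exists 1 => p; rewrite indicE; case: (_ \in _); rewrite ?normr1 ?normr0.
Qed.

Lemma bint_indic (A : set (plane R)) : measurable A ->
  box_integral (\1_A : R * R -> R) = fine (mu (A `&` box)).
Proof. by move=> mA; rewrite /box_integral /Rintegral integral_indic//; exact: box_measurable. Qed.

(** Continuity from above: within a box of finite measure, the sets where [|w| < 1 / (n + 1)]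
    decrease to a null set. *)
Lemma small_values (w : R -> R) (d : R) : measurable_fun [set: R] w ->
  lebesgue_measure [set x | w x = 0] = 0%E -> 0 < d ->
  exists2 k : R, 0 < k & fine (mu ([set p | `|w p.1| < k] `&` box)) <= d.
Proof.
move=> mw w0 d0.
have mwn : measurable_fun [set: R * R] (fun p => `|w p.1|).
  by apply: (measurable_fst_comp (h := fun x => `|w x|)); exact: measurableT_comp.
pose F n : set (plane R) := [set p | `|w p.1| < n.+1%:R^-1] `&` box.
have mF n : measurable (F n).
  by apply: measurableI; [exact: measurable_lt2|exact: box_measurable].
have mN : measurable [set x | w x = 0].
  by have := mw measurableT [set 0] (measurable_set1 0); rewrite setTI.
have capF : \bigcap_n F n `<=` [set p | w p.1 = 0].
  move=> p Fp /=; apply/eqP; rewrite -normr_le0; apply/ler_addgt0Pl => e e0; rewrite addr0.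
  have [h _] := Fp (Num.truncn e^-1) I; apply/ltW/(lt_trans h).
  by rewrite -[ltRHS]invrK ltf_pV2 ?posrE ?invr_gt0//; exact: truncnS_gt.
have mC : measurable (\bigcap_n F n) by exact: bigcapT_measurable.
have mZ : measurable [set p : plane R | w p.1 = 0].
  rewrite (_ : [set p | _] = (fun p : plane R => p.1) @^-1` [set x | w x = 0])//.
  by rewrite -[_ @^-1` _]setTI; exact: measurable_fst.
have c0 : mu (\bigcap_n F n) = 0%E.
  apply/eqP; rewrite eq_le measure_ge0 andbT -(vol_fst_null mN w0).
  by apply: le_measure => //; rewrite inE.
have := @nonincreasing_cvg_mu _ _ R mu F _ mF mC.
rewrite c0 => /(_ _ _)/fine_cvgP [||_].
- apply: le_lt_trans box_lty; apply: le_measure; last by move=> p [].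
    by rewrite inE; exact: mF.
  by rewrite inE; exact: box_measurable.
- move=> n m nm; apply/subsetPset; apply: setSI => p /= h; apply: (lt_le_trans h).
  by rewrite lef_pV2 ?posrE// ler_nat.
move=> /cvgrPdist_le /(_ _ d0) [N _ /(_ N (leqnn N))].
rewrite /= sub0r normrN => h; exists N.+1%:R^-1 => //.
exact: le_trans (ler_norm _) h.
Qed.

End Box.

(** * Decorrelation by shearing at a rational angle *)

Section RiemannLebesgue.
Context {R : realType} (f : R -> R) (m0 M0 Cf : R) (rf : roof f m0 M0 Cf).
Context (C D : R) (C0 : 0 < C).
Context (taylor : forall x h, `|f (x + h) - f x - h * derive1 f x| <= C * h ^+ 2).
Context (df_cont : continuous (derive1 f)) (df_le : forall x, `|derive1 f x| <= D).
Local Notation mu := (@vol R).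
Local Notation X := (phase f).
Local Notation ip := (@inner _ (plane R) R mu X).
Local Notation one := (fun _ : R * R => 1 : R).
Local Notation koop := (koopman f).
Local Notation Q := (box M0).
Local Notation bint := (box_integral M0).
Implicit Types (x y u s t : R).

Let M00 : 0 < M0. Proof. exact: (roof_M0 rf). Qed.
Let m00 : 0 < m0. Proof. exact: (roof_m0 rf). Qed.
Let D0 : 0 <= D. Proof. exact: le_trans (df_le 0). Qed.

Context (c : int) (p q : nat) (q0 : (0 < q)%N) (pq : coprime p q).
Local Notation gam := (c%:~R + p%:R / q%:R : R).
Local Notation rho := (rsum q f).
Local Notation drho := (rsum q (derive1 f)).

Let qr : 0 < q%:R :> R. Proof. by rewrite ltr0n. Qed.
Let rho_ge x : q%:R * m0 <= rho x. Proof. by have /andP[] := rsum_roof rf q x. Qed.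
Let rho_le x : rho x <= q%:R * M0. Proof. by have /andP[] := rsum_roof rf q x. Qed.
Let rho_gt0 x : 0 < rho x. Proof. by apply: lt_le_trans (rho_ge x); rewrite mulr_gt0. Qed.

Let drho_le x : `|drho x| <= q%:R * D.
Proof.
apply: (le_trans (ler_norm_sum _ _ _)).
rewrite (_ : q%:R * D = \sum_(0 <= j < q) D); first by apply: ler_sum => j _.
by rewrite sumr_const_nat subn0 mulr_natl.
Qed.

Let rho_taylor x h : `|rho (x + h) - rho x - h * drho x| <= q%:R * C * h ^+ 2.
Proof. exact: rsum_taylor. Qed.

Let lift_mult g x u (k : nat) : lift gam f g (x, u - k%:R * rho x) = lift gam f g (x, u).
Proof.
elim: k u => [|k IH] u; first by rewrite mul0r subr0.
rewrite -(lift_rational_period rf c g x (u - k.+1%:R * rho x) q0 pq) -[RHS]IH.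
by rewrite -[k.+1%:R]natr1 mulrDl mul1r opprD addrA subrK.
Qed.

Section Pair.
Context (g : R * R -> R) (L : R) (ng : nice f L g) (g0 : forall z, 0 <= g z)
  (mg : measurable_fun [set: plane R] g).
Context (h : R * R -> R) (Lh : R) (nh : nice f Lh h) (h0 : forall z, 0 <= h z)
  (mh : measurable_fun [set: plane R] h).
Local Notation F := (lift gam f g).

(* Moving [x] by [s / t] delays the flow at time [t] by about [s * drho / rho]. *)
Let near_shift (S : R) : 0 <= S -> exists2 K : R, 0 <= K & forall t x y s, 1 <= t ->
  0 <= y <= M0 -> 0 <= s <= S ->
  `|F (x + s / t, y + t) - F (x, y + t - s * (drho x / rho x))| <= K / t.
Proof.
move=> S0.
pose K2 := S * (q%:R * D) + C * S ^+ 2 / m0.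
have K20 : 0 <= K2.
  by rewrite addr_ge0// ?mulr_ge0 ?invr_ge0 ?exprn_ge0// ltW.
pose U := M0 + q%:R * M0 + S * D / m0 + K2.
have [K K0 hK] := lift_lip_x rf ng U.
have L0 := nice_L0 ng.
exists (K * S + L * K2); first by rewrite addr_ge0// mulr_ge0.
move=> t x y s t1 /andP[y0 yM] /andP[s0 sS].
have t0 : 0 < t by exact: lt_le_trans t1.
have r0 := rho_gt0 x; have rg := rho_ge x; have rl := rho_le x; have dl := drho_le x.
have ta := rho_taylor x (s / t).
have a0 : 0 <= s / t by rewrite divr_ge0// ltW.
pose k := Num.truncn (t / rho x).
have tr0 : 0 <= t / rho x by rewrite divr_ge0// ltW.
have /andP[k1 k2] := truncn_itv tr0; rewrite -/k in k1 k2.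
rewrite ler_pdivlMr// in k1; rewrite ltr_pdivrMr// -natr1 mulrDl mul1r in k2.
set r := rho x in r0 rg rl ta k1 k2 *; set r' := drho x in dl ta *.
pose e := rho (x + s / t) - r - s / t * r'.
pose y' := t - k%:R * r.
have y'0 : 0 <= y' by rewrite subr_ge0.
have y'r : y' < r by rewrite /y'; lra.
rewrite -(lift_mult g (x + s / t) (y + t) k) -(lift_mult g x (y + t - _) k) -/r.
set u1 := y + t - k%:R * _; set u2 := y + t - s * _ - _.
(* The drift [k * (s / t) * r'] over [k] periods equals [s * r' / r] up to the contribution of the
   incomplete period [y']; [e] is the Taylor error of one period. *)
have diff : u1 - u2 = s * r' / r * (y' / t) - k%:R * e.
  by rewrite /u1 /u2 /e /y' -/r; field; rewrite !gt_eqF.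
have sr : `|s * r' / r| <= S * D / m0.
  rewrite normrM normfV (gtr0_norm r0) normrM (ger0_norm s0) ler_pdivrMr//.
  rewrite mulrAC -[leRHS]mulrA; apply: (@le_trans _ _ (S * (q%:R * D))).
    exact: ler_pM.
  rewrite (_ : S * (q%:R * D) = S * D * q%:R); last by ring.
  by rewrite ler_wpM2l ?mulr_ge0// ler_pdivlMr.
have d1 : `|s * r' / r * (y' / t)| <= S * (q%:R * D) / t.
  rewrite (_ : s * r' / r * (y' / t) = s * r' * (y' / r) / t); last by field; rewrite !gt_eqF.
  rewrite normrM normfV (gtr0_norm t0) ler_pM2r ?invr_gt0//.
  have yr : `|y' / r| <= 1 by rewrite ger0_norm ?divr_ge0 ?(ltW r0)// ler_pdivrMr// mul1r ltW.
  rewrite normrM; apply: (@le_trans _ _ (`|s * r'|)); first by rewrite ler_piMr.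
  by rewrite normrM (ger0_norm s0); exact: ler_pM.
have d2 : `|k%:R * e| <= C * S ^+ 2 / m0 / t.
  rewrite normrM normr_nat.
  apply: (@le_trans _ _ (k%:R * (q%:R * C * (s / t) ^+ 2))); first by rewrite ler_wpM2l.
  have kt : k%:R * (q%:R * m0) <= t by apply: le_trans k1; rewrite ler_wpM2l.
  rewrite (_ : k%:R * (q%:R * C * (s / t) ^+ 2) =
    (k%:R * (q%:R * m0)) * (C * s ^+ 2 / m0 / t ^+ 2)); last by field; rewrite !gt_eqF.
  rewrite (_ : C * S ^+ 2 / m0 / t = t * (C * S ^+ 2 / m0 / t ^+ 2)); last by field; rewrite !gt_eqF.
  apply: ler_pM => //; rewrite ?mulr_ge0 ?invr_ge0 ?exprn_ge0 ?(ltW C0) ?(ltW m00) ?(ltW t0) ?ler0n//.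
  by rewrite !ler_pM2r ?invr_gt0 ?exprn_gt0// ler_pM2l// lerXn2r// nnegrE//; exact: le_trans sS.
have du : `|u1 - u2| <= K2 / t.
  rewrite diff [leRHS]mulrDl; apply: (le_trans (ler_normB _ _)); exact: lerD.
have K2t : K2 / t <= K2 by rewrite ler_pdivrMr// ler_peMr.
have u2b : `|u2| <= M0 + q%:R * M0 + S * D / m0.
  have -> : u2 = y + y' - s * r' / r by rewrite /u2 /y' -/r -/r'; ring.
  apply: (le_trans (ler_normB _ _)); apply: lerD => //.
  by rewrite (ger0_norm (addr_ge0 y0 y'0)) lerD//; apply: le_trans rl; exact: ltW.
have u1b : `|u1| <= U.
  rewrite -[u1](subrK u2) addrC; apply: (le_trans (ler_normD _ _)).
  by apply: lerD => //; exact: le_trans K2t.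
have e1 : `|F (x + s / t, u1) - F (x, u1)| <= K * S / t.
  apply: (le_trans (hK gam gam x (x + s / t) u1 u1b)).
  rewrite [x + _]addrC addrK (ger0_norm a0) (_ : gam - gam = 0) ?subrr// normr0 addr0 mulrA.
  by rewrite ler_pM2r ?invr_gt0// ler_wpM2l.
have e2 := lift_lip_u rf ng gam x u1 u2.
rewrite mulrDl -[X in `|X|](subrKA (F (x, u1))); apply: (le_trans (ler_normD _ _)).
apply: lerD => //; apply: (le_trans e2); rewrite -mulrA; exact: ler_wpM2l.
Qed.

Let lift_measurable t : measurable_fun [set: plane R] (fun z : plane R => F (z.1, z.2 + t)).
Proof.
rewrite (_ : (fun z : plane R => _) = g \o sflow gam f t).
  exact: measurableT_comp (measurable_sflow rf gam t).
by apply/funext => z; rewrite /lift/= -sflowE.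
Qed.

Let bF t : bmeas (fun z => F (z.1, z.2 + t)).
Proof. by split; [exact: lift_measurable|exists 1 => z; exact: (lift_le1 ng)]. Qed.

Let bh : bmeas h.
Proof. by have [h1 _ _ _] := nh; split=> //; exists 1. Qed.

Let X_box z : X z -> Q z.
Proof.
move=> [h1 /andP[h2 h3]]; split=> //=; rewrite h2/=.
exact: lt_le_trans h3 (roof_le rf _).
Qed.

Let bint_phase (H : R * R -> R) : (forall z, Q z -> ~ X z -> H z = 0) ->
  bint H = Rintegral mu X H.
Proof.
move=> H0; rewrite /box_integral [LHS]Rintegral_mkcond [RHS]Rintegral_mkcond.
congr Rintegral; apply/funext => z; rewrite !patchE.
have [zX|zX] := boolP (z \in X).
  by rewrite mem_set//; apply: X_box; exact: set_mem.
case: ifPn => // /set_mem zQ; apply: H0 => // Xz.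
by move: zX; rewrite mem_set.
Qed.

Let h_off z : Q z -> ~ X z -> h z = 0.
Proof.
move=> [z1 z2] nX; case: z z1 z2 nX => x y /= z1 z2 nX.
have [_ _ hz _] := nh; apply: hz; apply/negP => /andP[y0 yf]; apply: nX.
by split=> //=; rewrite (ltW y0).
Qed.

Let ip_box t : ip (koop gam t g) h = bint (fun z => h z * F (z.1, z.2 + t)).
Proof.
rewrite bint_phase; last by move=> z Qz nX; rewrite h_off// mul0r.
by rewrite /inner; congr Rintegral; apply/funext => z; rewrite mulrC /koopman /lift -sflowE.
Qed.

Let ip_one_box : ip one h = bint h.
Proof.
rewrite bint_phase; last exact: h_off.
by rewrite /inner; congr Rintegral; apply/funext => z; rewrite mul1r.
Qed.

(** Horizontal translates of the correlation integrand. All have the same integral ([bint_W]), which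
    is therefore the integral of their average over small shifts. *)
Let W t (a : R) (z : R * R) := h (z.1 + a, z.2) * F (z.1 + a, z.2 + t).

Let bW t a : bmeas (W t a).
Proof. exact: (bmeas_comp_shift a (bmeasM bh (bF t))). Qed.

Let bint_W t a : bint (W t a) = ip (koop gam t g) h.
Proof.
rewrite ip_box -(bint_shift M0 a (bmeasM bh (bF t))) => [//|z|x y].
  by rewrite mulr_ge0//; have /andP[] := (lift_slice rf ng g0 gam z.1).2 (z.2 + t).
have [_ ph _ _] := nh.
by rewrite /= ph; have := lift_int rf g gam x (y + t) 1; rewrite mulr1z => ->.
Qed.

Local Notation E := (orbit_mean f g q).
Local Notation KE := ((M0 * L + Cf) / m0 / q%:R).

(** Shifts by multiples of [S / (m * t)] displace the point along its periodic orbit by an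
    arithmetic progression of step [S / m * lam]. The two bounds by [d] say that this step is short
    and that the whole progression, of length [S * |lam|], is long compared with the period, so it
    equidistributes. *)
Let average_good (k : R) (S d : R) (m : nat) : 0 < k -> 0 < S -> (0 < m)%N -> 0 < d ->
  L * (S / m%:R) * (D / m0) <= d -> q%:R * M0 / (S * (k / (q%:R * M0))) <= d ->
  exists2 T : R, 1 <= T & forall t, T <= t -> forall z, Q z -> k <= `|drho z.1| ->
  `|\sum_(0 <= i < m) W t (i%:R * (S / m%:R) / t) z - m%:R * (E 0 * h z)| <=
  m%:R * (4 * d + KE).
Proof.
move=> k0 S0 m_gt0 d0 hm hS.
have [K K0 hK] := near_shift (ltW S0).
have mr : 0 < m%:R :> R by rewrite ltr0n.
have Lh0 := nice_L0 nh; have L0 := nice_L0 ng.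
have n0 : 0 <= (Lh * S + K) / d by rewrite divr_ge0 ?addr_ge0 ?mulr_ge0// ltW.
(* From this time on, the variation of [h] over a shift of at most [S / t] and the error [K / t] of
   [near_shift] together cost at most [d]. *)
exists (1 + (Lh * S + K) / d); first by rewrite lerDl.
move=> t Tt [x y] [/= x01 /andP[y0 yM]] kx.
have t1 : 1 <= t by apply: le_trans Tt; rewrite lerDl.
have t0 : 0 < t by exact: lt_le_trans t1.
have small : Lh * S / t + K / t <= d.
  rewrite -mulrDl ler_pdivrMr// [d * t]mulrC -ler_pdivrMr//; apply: le_trans Tt.
  by rewrite lerDr.
pose lam := drho x / rho x.
pose hh := - (S / m%:R * lam).
have r0 := rho_gt0 x.
have lam_ge : k / (q%:R * M0) <= `|lam|.
  rewrite /lam normrM normfV (gtr0_norm r0) ler_pM ?invr_ge0 ?(ltW k0) ?mulr_ge0 ?(ltW M00)//.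
  by rewrite lef_pV2 ?posrE// mulr_gt0.
have lam_le : `|lam| <= D / m0.
  rewrite /lam normrM normfV (gtr0_norm r0) ler_pdivrMr// mulrAC ler_pdivlMr//.
  apply: (@le_trans _ _ (q%:R * D * m0)); first by rewrite ler_wpM2r// ltW.
  by rewrite -mulrA mulrCA ler_wpM2l.
have lam0 : 0 < `|lam| by apply: lt_le_trans lam_ge; rewrite divr_gt0// mulr_gt0.
have Sm : 0 < S / m%:R by rewrite divr_gt0.
have hh_norm : `|hh| = S / m%:R * `|lam| by rewrite normrN normrM (gtr0_norm Sm).
have hh0 : hh != 0 by rewrite -normr_gt0 hh_norm mulr_gt0.
have per u : F (x, u + rho x) = F (x, u) by exact: (lift_rational_period rf c g x u q0 pq).
have avg := periodic_average (lift_slice rf ng g0 gam x) r0 (lift_lip_u rf ng gam x) per (y + t) m hh0.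
rewrite (orbit_sum rf ng g0 c x q0 pq) -/(E x) in avg.
have avg' : `|\sum_(0 <= i < m) F (x, y + t + i%:R * hh) - m%:R * E x| <= m%:R * (2 * d).
  apply: (le_trans avg); rewrite (_ : m%:R * (2 * d) = m%:R * d + m%:R * d); last by ring.
  rewrite hh_norm; apply: lerD.
    rewrite ler_pM2l// mulrA; apply: le_trans hm; apply: ler_wpM2l => //.
    by apply: mulr_ge0 => //; exact: ltW.
  rewrite ler_pdivrMr; last by apply: mulr_gt0.
  rewrite (_ : m%:R * d * (S / m%:R * `|lam|) = d * (S * `|lam|)); last by field; rewrite gt_eqF.
  apply: (le_trans (rho_le x)).
  have kp : 0 < k / (q%:R * M0) by apply: divr_gt0 => //; exact: mulr_gt0.
  move: hS; rewrite ler_pdivrMr; last by apply: mulr_gt0.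
  move=> hS.
  apply: (le_trans hS); rewrite !ler_pM2l//.
have each i : (i < m)%N -> `|W t (i%:R * (S / m%:R) / t) (x, y) - h (x, y) * F (x, y + t + i%:R * hh)| <= d.
  move=> im; pose s := i%:R * (S / m%:R).
  have s0 : 0 <= s by rewrite mulr_ge0// ltW.
  have sS : s <= S.
    by rewrite /s mulrC mulrAC ler_pdivrMr// ler_pM2l// ler_nat ltnW.
  rewrite /W /= -/s.
  have e1 : `|h (x + s / t, y) - h (x, y)| <= Lh * S / t.
    have [_ _ _ lh] := nh; apply: (le_trans (lh _ _ _ _)).
    rewrite subrr normr0 addr0 [x + _]addrC addrK ger0_norm ?divr_ge0 ?(ltW t0)//.
    by rewrite -mulrA ler_wpM2l// ler_pM2r ?invr_gt0.
  have y01 : 0 <= y <= M0 by rewrite y0 ltW.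
  have s01 : 0 <= s <= S by rewrite s0.
  have e2 := hK t x y s t1 y01 s01.
  have -> : y + t + i%:R * hh = y + t - s * (drho x / rho x) by rewrite /hh /s /lam; ring.
  set A := F (x + s / t, y + t) in e2 *; set B := F (x, _) in e2 *.
  rewrite (_ : _ * A - _ * B = (h (x + s / t, y) - h (x, y)) * A + h (x, y) * (A - B)); last by ring.
  apply: (le_trans (ler_normD _ _)); apply: le_trans small; rewrite !normrM; apply: lerD.
    by apply: le_trans e1; rewrite ler_piMr//; exact: (lift_le1 ng).
  by apply: le_trans e2; rewrite ler_piMl//; have [] := nh.
have sum1 : `|\sum_(0 <= i < m) W t (i%:R * (S / m%:R) / t) (x, y) -
    h (x, y) * \sum_(0 <= i < m) F (x, y + t + i%:R * hh)| <= m%:R * d.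
  rewrite mulr_sumr -sumrB; apply: (le_trans (ler_norm_sum _ _ _)).
  rewrite (_ : m%:R * d = \sum_(0 <= i < m) d); last by rewrite sumr_const_nat subn0 mulr_natl.
  by apply: ler_sum_nat => i /andP[_]; exact: each.
have osc := orbit_mean_osc rf ng g0 x 0 q0.
have h1 : `|h (x, y)| <= 1 by have [] := nh.
set A := \sum_(0 <= i < m) W _ _ _ in sum1 *.
set B := \sum_(0 <= i < m) F _ in sum1 avg'.
rewrite (_ : A - _ = (A - h (x, y) * B) + h (x, y) * ((B - m%:R * E x) + m%:R * (E x - E 0))); last by ring.
apply: (le_trans (ler_normD _ _)); rewrite normrM.
have i1 : `|B - m%:R * E x + m%:R * (E x - E 0)| <= m%:R * (2 * d) + m%:R * KE.
  apply: (le_trans (ler_normD _ _)); apply: lerD => //.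
  by rewrite normrM normr_nat ler_pM2l.
have i2 : `|h (x, y)| * `|B - m%:R * E x + m%:R * (E x - E 0)| <= m%:R * (2 * d) + m%:R * KE.
  by apply: le_trans i1; rewrite ler_piMl.
have md : 0 <= m%:R * d by rewrite mulr_ge0// ltW.
move: sum1 i2; rewrite !mulrDr; move: (`|_ - _|) (_ * `|_|) (m%:R * KE) => n1 n2 n3.
rewrite (_ : m%:R * (2 * d) = 2 * (m%:R * d)); last by ring.
rewrite (_ : m%:R * (4 * d) = 4 * (m%:R * d)); last by ring.
by move: md; move: (m%:R * d) => n4; lra.
Qed.

(** The trivial bound, for the points where [drho] is small; they form a set of small measure. *)
Let average_bad (S t : R) (m : nat) z :
  `|\sum_(0 <= i < m) W t (i%:R * (S / m%:R) / t) z - m%:R * (E 0 * h z)| <= m%:R.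
Proof.
have w01 a : 0 <= W t a z <= 1.
  have /andP[f0 f1] := (lift_slice rf ng g0 gam (z.1 + a)).2 (z.2 + t).
  have [h1 _ _ _] := nh; rewrite mulr_ge0//= mulr_ile1//.
  exact: le_trans (ler_norm _) (h1 _).
have /andP[e0 e1] := orbit_mean01 rf ng g0 0 q0.
have h1 : h z <= 1 by have [h1 _ _ _] := nh; exact: le_trans (ler_norm _) (h1 _).
have s0 : 0 <= \sum_(0 <= i < m) W t (i%:R * (S / m%:R) / t) z.
  by apply: sumr_ge0 => i _; have /andP[] := w01 (i%:R * (S / m%:R) / t).
have s1 : \sum_(0 <= i < m) W t (i%:R * (S / m%:R) / t) z <= m%:R.
  rewrite [leRHS](_ : _ = \sum_(0 <= i < m) (1 : R)); last by rewrite sumr_const_nat subn0.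
  by apply: ler_sum => i _; have /andP[] := w01 (i%:R * (S / m%:R) / t).
have b0 : 0 <= m%:R * (E 0 * h z) by apply: mulr_ge0 => //; exact: mulr_ge0.
have b1 : m%:R * (E 0 * h z) <= m%:R by rewrite ler_piMr// mulr_ile1.
by rewrite ler_norml; apply/andP; split; lra.
Qed.

Lemma koop_limit (d : R) : lebesgue_measure [set x | drho x = 0] = 0%E -> 0 < d ->
  exists2 T : R, 1 <= T & forall t, T <= t ->
  `|ip (koop gam t g) h - E 0 * ip one h| <= d + KE * M0.
Proof.
move=> nul d0.
have mdr : measurable_fun [set: R] drho.
  apply: measurable_sum => j; apply: measurableT_comp; last exact: measurable_addr.
  exact: continuous_measurable_fun.
have d2 : 0 < d / 2 by rewrite divr_gt0.
(* The order of choices: [k] gives the bad set measure at most [d / 2]; [d'] lets the good points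
   contribute [4 * d' * M0 = d / 2]; then [S] makes the progressions long and [m] makes their steps
   short. *)
have [k k0 hk] := small_values M00 mdr nul d2.
pose d' := d / (8 * M0); have d'0 : 0 < d' by rewrite divr_gt0// mulr_gt0.
pose k' := k / (q%:R * M0); have k'0 : 0 < k' by rewrite divr_gt0// mulr_gt0.
pose S := q%:R * M0 / (d' * k').
have S0 : 0 < S by apply: divr_gt0; exact: mulr_gt0.
have hS : q%:R * M0 / (S * k') <= d'.
  by rewrite le_eqVlt; apply/orP; left; apply/eqP; rewrite /S; field; rewrite !gt_eqF.
have L0 := nice_L0 ng.
pose m := (Num.truncn (L * S * (D / m0) / d')).+1.
have hm : L * (S / m%:R) * (D / m0) <= d'.
  have : L * S * (D / m0) / d' < m%:R by exact: truncnS_gt.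
  rewrite ltr_pdivrMr// => /ltW hle.
  rewrite (_ : L * (S / m%:R) * (D / m0) = L * S * (D / m0) / m%:R); last first.
    by move: (m%:R^-1) (D / m0) => y z; ring.
  by rewrite ler_pdivrMr ?ltr0n// [d' * _]mulrC.
have [T T1 hT] := average_good k0 S0 (ltn0Sn _ : (0 < m)%N) d'0 hm hS.
exists T => // t Tt.
pose Bad : set (plane R) := [set z | `|drho z.1| < k].
have mBad : measurable Bad.
  apply: measurable_lt2; last exact: measurable_cst.
  by apply: (measurable_fst_comp (h := fun x => `|drho x|)); exact: measurableT_comp.
pose A z := \sum_(0 <= i < m) W t (i%:R * (S / m%:R) / t) z.
have bA : bmeas A by exact: bmeas_sum.
have bE : bmeas (fun z => - (m%:R * E 0) * h z) by exact: bmeasM (bmeas_cst _) bh.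
have bI := bmeas_indic mBad.
have bC := bmeas_cst (m%:R * (4 * d' + KE)).
have bmI : bmeas (fun z => m%:R * (\1_Bad : R * R -> R) z) by exact: bmeasM (bmeas_cst _) bI.
have mr : 0 < m%:R :> R by rewrite ltr0n.
have KE0 : 0 <= KE by exact: le_trans (orbit_mean_osc rf ng g0 0 0 q0).
have main : `|bint (fun z => A z + - (m%:R * E 0) * h z)| <=
    bint (fun z => m%:R * (4 * d' + KE) + m%:R * (\1_Bad : R * R -> R) z).
  apply: (bint_norm M00); [exact: bmeasD|exact: bmeasD|move=> z Qz].
  rewrite mulNr -[_ * E 0 * h z]mulrA indicE; have [zB|zB] := boolP (z \in Bad).
    rewrite mulr1; apply: (le_trans (average_bad S t m z)).
    by rewrite lerDr mulr_ge0// addr_ge0// mulr_ge0// ltW.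
  rewrite mulr0 addr0; apply: hT => //.
  by rewrite leNgt; apply/negP => h1; move: zB; rewrite mem_set.
move: main; rewrite (bintD M00 bA bE) (bintZ M00 _ bh) (bintD M00 bC bmI) (bintZ M00 _ bI).
rewrite (bint_cst M00) (bint_indic M0 mBad) (bint_sum M00)//; under eq_bigr do rewrite bint_W.
rewrite sumr_const_nat subn0 -[X in `|X + _|]mulr_natl -ip_one_box.
rewrite (_ : m%:R * _ + - (m%:R * E 0) * _ = m%:R * (ip (koop gam t g) h - E 0 * ip one h)); last by ring.
rewrite normrM normr_nat -mulrA -mulrDr ler_pM2l// => main.
apply: (le_trans main).
have e8 : 4 * d' * M0 = d / 2 by rewrite /d'; field; rewrite gt_eqF.
by rewrite mulrDl e8 [in leRHS](splitr d) [leLHS]addrAC lerD2r lerD2l; exact: hk.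
Qed.

End Pair.
End RiemannLebesgue.

Lemma irrational_in {R : realType} (lo hi : R) : lo < hi ->
  exists x, lo < x < hi /\ irrational x.
Proof.
move=> lohi; have [F hF FE] := @irrational_Gdelta R.
have dF := Baire hF; rewrite -FE in dF.
have /dF : `]lo, hi[%classic !=set0 by exists ((lo + hi) / 2); rewrite /= in_itv/=; lra.
have op : open (`]lo, hi[%classic : set R) by exact: interval_open.
move=> /(_ op)[x [/= xI ix]].
by exists x; split=> //; move: xI; rewrite in_itv.
Qed.

(** For each denominator up to [E] the nearest fractions on both sides of [x] are at a positive
    distance, and there are finitely many denominators. Hence fractions close to [x] have
    denominators beyond [E]. *)
Lemma irrational_far_rational {R : realType} (x : R) (E : nat) : irrational x ->
  exists2 d : R, 0 < d & forall (q : nat) (p : int), (0 < q)%N -> (q <= E)%N ->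
    d <= `|x - p%:~R / q%:R|.
Proof.
move=> ix; elim: E => [|E [d d0 hd]]; first by exists 1 => // q p q0; rewrite leqNgt q0.
have E0 : 0 < E.+1%:R :> R by rewrite ltr0n.
pose z := x * E.+1%:R; pose k := Num.floor z.
have h1 := floor_le_tmp z; have h2 := floorD1_gt z; rewrite -/k intrD in h1 h2.
have zk : z != k%:~R.
  apply/eqP => zk; apply: ix; exists (k%:Q / E.+1%:Q) => //=.
  rewrite rmorphM/= fmorphV/= !ratr_int -zk /z -pmulrn mulfK// gt_eqF//.
pose d' := Num.min d (Num.min (z - k%:~R) (k%:~R + 1 - z) / E.+1%:R).
exists d'.
  rewrite lt_min d0 divr_gt0// lt_min !subr_gt0 h2 andbT.
  by rewrite lt_neqAle eq_sym zk.
move=> q p q0; rewrite leq_eqVlt => /orP[/eqP ->|qE]; last first.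
  by apply: le_trans (hd q p q0 qE); rewrite ge_min lexx.
apply: (@le_trans _ _ (Num.min (z - k%:~R) (k%:~R + 1 - z) / E.+1%:R)).
  by rewrite ge_min lexx orbT.
have -> : x - p%:~R / E.+1%:R = (z - p%:~R) / E.+1%:R by rewrite /z; field; rewrite gt_eqF.
rewrite normrM normfV (gtr0_norm E0) ler_pM2r ?invr_gt0//.
case: (leP p k) => pk.
  apply: (@le_trans _ _ (z - k%:~R)); first by rewrite ge_min lexx.
  have pk' : p%:~R <= k%:~R :> R by rewrite ler_int.
  by rewrite ger0_norm; [rewrite lerD2l lerN2|rewrite subr_ge0; exact: le_trans h1].
apply: (@le_trans _ _ (k%:~R + 1 - z)); first by rewrite ge_min lexx orbT.
have pk' : k%:~R + 1 <= p%:~R :> R by rewrite -[1]/(1%:~R) -intrD ler_int lezD1.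
by rewrite distrC ger0_norm; [rewrite lerD2r|rewrite subr_ge0; apply: le_trans pk'; exact: ltW].
Qed.

(** Here [o] is an orbit mean; [A] and [B] are inner products of a translate with [h] and with a
    function close to [1], near [o * J] and [o * W]. As [B] is near the integral [I] and [W] near
    the area [V], the orbit mean is near the space mean [I / V]. *)
Lemma product_close {R : realType} (A B I J W o V d : R) : 0 < V ->
  `|A - o * J| <= d -> `|B - o * W| <= d -> `|B - I| <= d -> `|V - W| <= d ->
  `|J| <= V -> 0 <= o <= 1 -> `|A - I * J / V| <= 4 * d.
Proof.
move=> V0 hA hB hI hW hJ /andP[z0 z1].
have hoV : `|o * V - I| <= 3 * d.
  rewrite (_ : o * V - I = o * (V - W) + ((o * W - B) + (B - I))); last by ring.
  apply: (le_trans (ler_normD _ _)); rewrite (_ : 3 * d = d + (d + d)); last by ring.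
  apply: lerD; first by rewrite normrM (ger0_norm z0); apply: le_trans hW; rewrite ler_piMl.
  by apply: (le_trans (ler_normD _ _)); apply: lerD; rewrite // distrC.
rewrite (_ : A - I * J / V = (A - o * J) + (o * V - I) * (J / V)); last by field; rewrite gt_eqF.
apply: (le_trans (ler_normD _ _)); rewrite (_ : 4 * d = d + 3 * d); last by ring.
apply: lerD => //; rewrite normrM; apply: le_trans hoV; rewrite ler_piMr//.
by rewrite normrM normfV (gtr0_norm V0) ler_pdivrMr// mul1r.
Qed.

(** * Density of the angles with a mixing time *)

Section MixingDense.
Context {R : realType} (f : R -> R) (m0 M0 Cf : R) (rf : roof f m0 M0 Cf).
Context (C : R) (C0 : 0 < C).
Context (taylor : forall x h, `|f (x + h) - f x - h * derive1 f x| <= C * h ^+ 2).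
Context (fan : real_analytic f) (dfp : periodic1 (derive1 f)) (dfan : real_analytic (derive1 f)).
Local Notation mu := (@vol R).
Local Notation X := (phase f).
Local Notation sqint := (@sq_integrable _ (plane R) R mu X).
Local Notation nrm := (@norm2 _ (plane R) R mu X).
Local Notation sqn := (@sqnorm _ (plane R) R mu X).
Local Notation ip := (@inner _ (plane R) R mu X).
Local Notation one := (fun _ : R * R => 1 : R).
Local Notation koop := (koopman f).
Local Notation correl := (correlation f).

Let mX : measurable (X : set (plane R)). Proof. exact: (phase_measurable rf). Qed.
Let finX : (mu X < +oo)%E. Proof. exact: (phase_lty rf). Qed.

(** The constant [1] does not vanish on the base, so [koop_limit] does not apply to it; a test
    function close to [1] serves instead to identify the orbit mean with the space mean. *)
Lemma bump_near_one (e : R) : 0 < e ->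
  exists a c k, nrm (fun p => 1 - bump f a c k p) < e.
Proof.
move=> e0; pose s n : R := n.+1%:R^-1.
have s0 n : 0 < s n by rewrite invr_gt0.
have cs (z : R) : (fun n => z - s n) @ \oo --> z.
  rewrite -[X in _ --> X]subr0; apply: cvgB; first exact: cvg_cst.
  exact: cvg_harmonic.
(* The limits [2] and [M0] exceed the two coordinates of every point of the phase space. *)
pose phi n := bump f (2 - s n) (M0 - s n) n.
have cv : (fun n => sqn (fun p => one p - phi n p)) @ \oo --> (0 : R); last first.
  by have [n hn] := nrm_cvg0 cv e0; exists (2 - s n), (M0 - s n), n.
apply: (@sqint_dominated _ _ _ _ _ mX _ _ (fun=> 2)) => //.
- by move=> n; apply: measurable_funTS; exact: (bump_measurable rf).
- exact: (sqint_cst mX finX).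
- move=> n p _; rewrite [leRHS]ger0_norm//; apply: (le_trans (ler_normB _ _)).
  rewrite (_ : 2 = 1 + 1)//; apply: lerD; first by rewrite normr1.
  by have [h _ _ _] := bump_nice rf (2 - s n) (M0 - s n) n; exact: h.
apply: ae_off_axes => x y x0 y0 Xp.
have := bump_cvg (a := 2) (c := M0) (an := fun n => 2 - s n) (cn := fun n => M0 - s n) Xp.
rewrite indicE mem_set; last first.
  have [/= /andP[_ x1] /andP[_ yf]] := Xp; split; first by apply: lt_trans x1 _; lra.
  exact: lt_le_trans (roof_le rf x).
move=> /(_ x0 y0) h; apply: h; [| |exact: cs|exact: cs];
  by move=> n; have := s0 n; lra.
Qed.

Let nrm_le1 g : sqint g -> (forall p, X p -> `|g p| <= 1) -> nrm g <= Num.sqrt (area f).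
Proof.
move=> [mg _] h; apply: ler_wsqrtr.
by have := sqn_bounded mX finX ler01 mg h; rewrite expr1n mul1r.
Qed.

Lemma mixing_dense (b : R) (G : nat -> R * R -> R) n (e lo hi : R) :
  irrational b -> weak_mixing b f ->
  (forall i, measurable_fun [set: plane R] (G i)) -> (forall i p, 0 <= G i p) ->
  (forall i, exists L, nice f L (G i)) -> 0 < e -> lo < hi ->
  exists a t, [/\ lo < a < hi, 0 <= t & forall i j, (i < n)%N -> (j < n)%N ->
    `|correl a t (G i) (G j)| < e].
Proof.
move=> ib wm mG G0 /choice[L nL] e0 lohi.
have V0 := area_gt0 rf; have m00 := roof_m0 rf; have M00 := roof_M0 rf.
have sV : 0 < Num.sqrt (area f) by rewrite sqrtr_gt0.
have sVV : Num.sqrt (area f) * Num.sqrt (area f) = area f by rewrite -expr2 sqr_sqrtr// ltW.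
pose eta := e / (8 * Num.sqrt (area f)); have eta0 : 0 < eta by rewrite divr_gt0// mulr_gt0.
have [wa [wc [wk hw]]] := bump_near_one eta0; set w := bump f wa wc wk in hw.
have nw := bump_nice rf wa wc wk; rewrite -/w in nw.
have mw := bump_measurable rf wa wc wk; rewrite -/w in mw.
have w0 p : 0 <= w p.
  by rewrite /w /bump le_min ler01/= mulr_ge0// le_min tent_ge0 height_ge0.
have sw : sqint w := nice_sqint rf nw mw.
have sG i : sqint (G i) := nice_sqint rf (nL i) (mG i).
pose K := \sum_(0 <= i < n) ((M0 * L i + Cf) / m0 * M0).
have K1 i : 0 <= (M0 * L i + Cf) / m0 * M0.
  rewrite mulr_ge0 ?(ltW M00)// divr_ge0 ?(ltW m00)// addr_ge0 ?(roof_C0 rf)//.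
  by rewrite mulr_ge0 ?(ltW M00)// (nice_L0 (nL i)).
have K0 : 0 <= K by apply: sumr_ge0.
(* For [q > E], the oscillation of the orbit means contributes at most [e / 16] to the bound of
   [koop_limit]. *)
pose E := (Num.truncn (K / (e / 16))).+1.
have e16 : 0 < e / 16 by rewrite divr_gt0.
have hE : K / (e / 16) < E%:R by exact: truncnS_gt.
(* Fractions close enough to an irrational point have denominators beyond [E]. *)
have [x0 [x0I ix0]] := irrational_in lohi.
have [d d0 hd] := irrational_far_rational E ix0.
pose d1 := Num.min d (Num.min (x0 - lo) (hi - x0)).
have /andP[x0l x0h] := x0I.
have d10 : 0 < d1 by rewrite lt_min d0 lt_min !subr_gt0 x0l.
have d1d : d1 <= d by rewrite ge_min lexx.
have d1l : d1 <= x0 - lo by rewrite !ge_min lexx orbT.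
have d1h : d1 <= hi - x0 by rewrite !ge_min lexx !orbT.
(* A frequency of [f] so high that some fraction with denominator [N = |k|] lies within [d1] of
   [x0]. In lowest terms its denominator [q] still divides [k], which makes [rsum q f]
   nonconstant. *)
have [k [ph [kE hk]]] := high_frequency rf (Num.truncn d1^-1) ib wm.
pose N := absz k.
have N0 : (0 < N)%N by exact: leq_ltn_trans kE.
have Nr : 0 < N%:R :> R by rewrite ltr0n.
have Nd : N%:R^-1 < d1.
  rewrite -[ltRHS]invrK ltf_pV2 ?posrE ?invr_gt0//.
  by apply: (lt_le_trans (truncnS_gt _)); rewrite ler_nat.
pose c := Num.floor x0; pose r := x0 - c%:~R.
have r0 : 0 <= r by rewrite subr_ge0 floor_le_tmp.
pose p0 := Num.truncn (r * N%:R).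
have /andP[p1 p2] := truncn_itv (mulr_ge0 r0 (ltW Nr)); rewrite -/p0 -natr1 in p1 p2.
pose gc := gcdn p0 N; have gc0 : (0 < gc)%N by rewrite gcdn_gt0 N0 orbT.
pose p := (p0 %/ gc)%N; pose q := (N %/ gc)%N.
have q0 : (0 < q)%N by rewrite divn_gt0// dvdn_leq// dvdn_gcdr.
have pq : coprime p q.
  rewrite /coprime -(eqn_pmul2r gc0) mul1n muln_gcdl !divnK ?dvdn_gcdl ?dvdn_gcdr//.
have qr : 0 < q%:R :> R by rewrite ltr0n.
have pqE : p%:R / q%:R = p0%:R / N%:R :> R.
  have gr : gc%:R != 0 :> R by rewrite pnatr_eq0 -lt0n.
  have -> : p0%:R = p%:R * gc%:R :> R by rewrite -natrM divnK// dvdn_gcdl.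
  have -> : N%:R = q%:R * gc%:R :> R by rewrite -natrM divnK// dvdn_gcdr.
  by field; rewrite gr gt_eqF.
have qN : (q%:Z %| k)%Z by rewrite dvdzE/= -/N; apply: dvdn_div; exact: dvdn_gcdr.
pose gam := c%:~R + p%:R / q%:R : R.
have near : 0 <= x0 - gam < d1.
  have -> : x0 - gam = (r * N%:R - p0%:R) / N%:R by rewrite /gam pqE /r; field; rewrite gt_eqF.
  rewrite divr_ge0 ?subr_ge0 ?(ltW Nr)//=; apply: le_lt_trans Nd.
  by rewrite ler_pdivrMr// mulVf ?gt_eqF//; move: p2; lra.
have qE : (E < q)%N.
  rewrite ltnNge; apply/negP => qE; have := hd q (c * q%:Z + p%:Z) q0 qE.
  have -> : (c * q%:Z + p%:Z)%:~R / q%:R = gam.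
    by rewrite intrD intrM -!pmulrn /gam; field; rewrite gt_eqF.
  by case/andP: near => g0 g1; rewrite ger0_norm// leNgt (lt_le_trans g1 d1d).
have rnc : forall z : R, exists x, rsum q f x != z.
  have k0 : k != 0 by rewrite -absz_eq0 -lt0n.
  exact: (rsum_nonconst (roof_cper rf) q0 qN k0 hk).
have df_cont := real_analytic_continuous dfan.
have [D hD] := periodic1_bounded dfp df_cont.
have nul : lebesgue_measure [set x | rsum q (derive1 f) x = 0] = 0%E.
  apply: real_analytic_zeros_null.
    have an m : real_analytic (fun x => \sum_(0 <= j < m) derive1 f (x + j%:R / q%:R)).
      elim: m => [|m IH]; first by under eq_fun do rewrite big_geq//; exact: real_analytic_cst.
      under eq_fun do rewrite big_nat_recr//=; apply: (real_analyticD IH).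
      exact: (real_analytic_shift (f := derive1 f)).
    exact: an.
  apply: contrapT => /forallNP h.
  have [x hx] := rnc (rsum q f 0); move/eqP: hx; apply.
  have der : forall x : R, is_derive x 1 (rsum q f) (rsum q (derive1 f) x).
    have [_ df] := real_analytic_is_derive fan.
    have dm m y : is_derive (y : R) 1 (fun x => \sum_(0 <= j < m) f (x + j%:R / q%:R))
        (\sum_(0 <= j < m) derive1 f (y + j%:R / q%:R)).
      elim: m => [|m IH].
        by under eq_fun do rewrite big_geq//; rewrite big_geq//; exact: is_derive_cst.
      under eq_fun do rewrite big_nat_recr//=; rewrite big_nat_recr//=.
      apply: is_deriveD.
      have := @is_derive1_comp _ f (fun x => x + m%:R / q%:R) y (derive1 f (y + m%:R / q%:R)) 1 (df _).
      rewrite mulr1; apply.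
      rewrite -[1 in X in is_derive _ _ _ X]addr0.
      by apply: is_deriveD.
    exact: dm.
  have := @derive_le_lipschitz _ (rsum q f) (rsum q (derive1 f)) 0 der _ x 0.
  rewrite mul0r => hh; apply/eqP; rewrite -subr_eq0 -normr_le0; apply: hh => y.
  by rewrite normr_le0; apply/negPn/negP; exact: h.
have lim i (h : R * R -> R) Lh : nice f Lh h -> (forall z, 0 <= h z) ->
    measurable_fun [set: plane R] h -> (i < n)%N ->
    \forall t \near +oo, `|ip (koop gam t (G i)) h - orbit_mean f (G i) q 0 * ip one h| <= e / 8.
  move=> nh h0 mh ni.
  have [T _ hT] := koop_limit rf C0 taylor df_cont hD c q0 pq (nL i) (G0 i) (mG i) nh h0 mh nul e16.
  exists T; split; first exact: num_real.
  move=> t /ltW /hT /le_trans; apply.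
  have : (M0 * L i + Cf) / m0 / q%:R * M0 <= e / 16.
    rewrite mulrAC ler_pdivrMr//.
    apply: (le_trans (sum_nat_bound K1 ni)); rewrite -/K.
    move: hE; rewrite ltr_pdivrMr// => /ltW hE; apply: (le_trans hE).
    by rewrite mulrC ler_pM2l// ler_nat ltnW.
  by move: (_ * M0) => z; lra.
pose P (i j : 'I_n) : set R := [set t |
    `|ip (koop gam t (G i)) (G j) - orbit_mean f (G i) q 0 * ip one (G j)| <= e / 8 /\
    `|ip (koop gam t (G i)) w - orbit_mean f (G i) q 0 * ip one w| <= e / 8].
have lim2 : \forall t \near +oo, 0 <= t /\ forall i j, P i j t.
  apply: filterI; first exact: nbhs_pinfty_ge.
  have FF : Filter (pinfty_nbhs R) by exact: _.
  refine (@filter_forall R _ (fun i => [set t | forall j, P i j t]) (pinfty_nbhs R) FF _) => i.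
  refine (@filter_forall R _ (P i) (pinfty_nbhs R) FF _) => j; apply: filterI.
    exact: (lim i (G j) (L j) (nL j) (G0 j) (mG j) (ltn_ord i)).
  exact: (lim i w _ nw w0 mw (ltn_ord i)).
have [t [t0 ht]] := filter_ex lim2.
exists gam, t; split => //.
  have /andP[g1 /lt_le_trans g2] := near; move: g1; rewrite subr_ge0 => g1.
  rewrite (le_lt_trans g1 x0h) andbT.
  by have := g2 _ d1l; rewrite ltrD2l ltrN2.
move=> i j ni nj; have [h1 h2] := ht (Ordinal ni) (Ordinal nj).
rewrite /= in h1 h2.
have s1 := sqint_one rf.
have sk := sqint_koop rf gam t (sG i).
(* By invariance the translate has the same mean as [G i], and [w] stands for [1] up to [eta]. *)
have h3 : `|ip (koop gam t (G i)) w - ip (G i) one| <= e / 8.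
  rewrite -(ip_koop_one rf gam t (sG i)) -(ipBr mX)//.
  apply: (le_trans (ip_le_nrm mX sk (sqintB mX sw s1))).
  rewrite (nrm_koop rf)// (nrmBC f w one).
  have nG : nrm (G i) <= Num.sqrt (area f).
    by apply: nrm_le1 => // z _; have [] := nL i.
  apply: (@le_trans _ _ (Num.sqrt (area f) * eta)).
    by apply: ler_pM; rewrite ?nrm_ge0// ltW.
  by rewrite /eta; rewrite le_eqVlt; apply/orP; left; apply/eqP; field; rewrite gt_eqF.
have h4 : `|area f - ip one w| <= e / 8.
  rewrite -(sqn_one rf) /sqnorm -(ipBr mX)//.
  apply: (le_trans (ip_le_nrm mX s1 (sqintB mX s1 sw))).
  apply: (@le_trans _ _ (Num.sqrt (area f) * eta)).
    apply: ler_pM; rewrite ?nrm_ge0// ?(ltW hw)//.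
    by apply: nrm_le1 => // z _; rewrite normr1.
  by rewrite /eta; rewrite le_eqVlt; apply/orP; left; apply/eqP; field; rewrite gt_eqF.
have h5 : `|ip one (G j)| <= area f.
  rewrite -sVV; apply: (le_trans (ip_le_nrm mX s1 (sG j))).
  apply: ler_pM; rewrite ?nrm_ge0//; apply: nrm_le1 => // z _; rewrite ?normr1//.
  by have [] := nL j.
rewrite /correlation.
apply: (@le_lt_trans _ _ (4 * (e / 8))).
  by apply: product_close h1 h2 h3 h4 h5 (orbit_mean01 rf (nL i) (G0 i) 0 q0).
by rewrite (_ : 4 * (e / 8) = e / 2); [rewrite ltr_pdivrMr// ltr_pMr// ltr1n|field].
Qed.

End MixingDense.

(** * Mutual singularity of spectral measures *)

Section Separation.
Context {R : realType}.
Implicit Types (sg : {measure set R -> \bar R}) (v : R -> R) (A : set R) (s : seq R) (t u e : R).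

(** Sets [A n] are chosen for the errors [1 / 2 ^ (n + 1)]. Their upper limit is null for [sg1] by
    Borel-Cantelli; its complement is the lower limit of the complements, null for [sg2] as the
    errors tend to zero. *)
Lemma mutually_singular_approx sg1 sg2 :
  (forall e, 0 < e -> exists A, [/\ measurable A, (sg1 A <= e%:E)%E & (sg2 (~` A) <= e%:E)%E]) ->
  mutually_singular sg1 sg2.
Proof.
move=> h; have half n : 0 < 1 / (2 ^ n.+1)%:R :> R by rewrite divr_gt0// ltr0n expn_gt0.
have [A hA] := choice (fun n => h _ (half n)).
have mA n : measurable (A n) by have [] := hA n.
exists (lim_sup_set A); split.
- by apply: bigcapT_measurable => n; exact: bigcup_measurable.
- apply: lim_sup_set_cvg0 => //.
  apply: (@le_lt_trans _ _ 1%:E); last exact: ltry.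
  apply: le_trans (epsilon_trick0 xpredT ler01).
  by apply: lee_nneseries => // n _; have [] := hA n.
have -> : ~` lim_sup_set A = \bigcup_n \bigcap_(k in [set k | (n <= k)%N]) ~` A k.
  rewrite /lim_sup_set setC_bigcap; apply: eq_bigcupr => n _.
  by rewrite setC_bigcup.
have mB n : measurable (\bigcap_(k in [set k | (n <= k)%N]) ~` A k).
  by apply: bigcap_measurable => [|k _]; [exists n => /=|exact: measurableC].
apply/eqP; rewrite eq_le measure_ge0 andbT.
apply: (@le_trans _ _ (\sum_(0 <= n <oo) sg2 (\bigcap_(k in [set k | (n <= k)%N]) ~` A k))%E).
  by apply: measure_sigma_subadditive => //; exact: bigcup_measurable.
rewrite eseries0// => n _ _; apply/eqP; rewrite eq_le measure_ge0 andbT.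
apply/lee_addgt0Pr => e e0; rewrite add0e.
have [k [nk ke]] : exists k, (n <= k)%N /\ 1 / (2 ^ k.+1)%:R <= e.
  pose k := maxn n (Num.truncn e^-1); exists k; split; first exact: leq_maxl.
  rewrite div1r -[leRHS]invrK lef_pV2 ?posrE ?invr_gt0 ?ltr0n ?expn_gt0//.
  apply: (le_trans (ltW (truncnS_gt _))); rewrite ler_nat.
  apply: (@leq_trans k.+1); first by rewrite ltnS leq_maxr.
  exact/ltnW/ltn_expl.
have [_ _ h2] := hA k.
apply: (@le_trans _ _ (1 / (2 ^ k.+1)%:R)%:E); last by rewrite lee_fin.
apply: le_trans h2; apply: le_measure; rewrite ?inE//; first exact: measurableC.
by move=> x; apply.
Qed.

Section FiniteMeasure.
Context (sg : {measure set R -> \bar R}) (sfin : (sg setT < +oo)%E).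
Context (c : R -> R) (hc : forall t, (\int[sg]_x (cos (t * x))%:E = (c t)%:E)%E).

Definition bmeas1 v := measurable_fun [set: R] v /\ exists C, forall x, `|v x| <= C.
Definition sint v := Rintegral sg setT v.

Lemma bmeas1D v w : bmeas1 v -> bmeas1 w -> bmeas1 (fun x => v x + w x).
Proof.
move=> [m1 [C h]] [m2 [C' h']]; split; first exact: measurable_funD.
by exists (C + C') => p; apply: (le_trans (ler_normD _ _)); exact: lerD.
Qed.

Lemma bmeas1M v w : bmeas1 v -> bmeas1 w -> bmeas1 (fun x => v x * w x).
Proof.
move=> [m1 [C h]] [m2 [C' h']]; split; first exact: measurable_funM.
by exists (C * C') => p; rewrite normrM; exact: ler_pM.
Qed.

Lemma bmeas1_cst C : bmeas1 (fun=> C).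
Proof. by split; [exact: measurable_cst|exists `|C|]. Qed.

Lemma bmeas1_cos t : bmeas1 (fun x => cos (t * x)).
Proof.
split; last by exists 1 => x; rewrite ler_norml cos_geN1 cos_le1.
apply: continuous_measurable_fun => x.
apply: (@continuous_comp _ _ _ (fun x => t * x) cos); last exact: continuous_cos.
by apply: cvgMr; exact: cvg_id.
Qed.

Lemma bmeas1_indic A : measurable A -> bmeas1 (\1_A : R -> R).
Proof.
move=> mA; split; first exact: measurable_indic.
by exists 1 => p; rewrite indicE; case: (_ \in _); rewrite ?normr1 ?normr0.
Qed.

Lemma bmeas1_integrable v : bmeas1 v -> sg.-integrable setT (EFin \o v).
Proof.
move=> [mv [C vC]]; apply: measurable_bounded_integrable => //.
by exists `|C|; split=> // y Cy x _ /=; apply: (le_trans (vC x)); apply/ltW/(le_lt_trans _ Cy)/ler_norm.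
Qed.

Lemma sintD v w : bmeas1 v -> bmeas1 w -> sint (fun x => v x + w x) = sint v + sint w.
Proof. by move=> bv bw; rewrite /sint RintegralD//; exact: bmeas1_integrable. Qed.

Lemma sintZ (a : R) v : bmeas1 v -> sint (fun x => a * v x) = a * sint v.
Proof. by move=> bv; rewrite /sint RintegralZl//; exact: bmeas1_integrable. Qed.

Lemma sint_le v w : bmeas1 v -> bmeas1 w -> (forall x, v x <= w x) -> sint v <= sint w.
Proof. by move=> bv bw h; apply: le_Rintegral => //; exact: bmeas1_integrable. Qed.

Lemma sint_cos t : sint (fun x => cos (t * x)) = c t.
Proof. by rewrite /sint /Rintegral hc. Qed.

Lemma sint_cst (a : R) : sint (fun=> a) = a * c 0.
Proof.
rewrite -(sint_cos 0) -sintZ; last exact: bmeas1_cos.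
by congr sint; apply/funext => x; rewrite mul0r cos0 mulr1.
Qed.

Lemma sint_indic A : measurable A -> sint (\1_A : R -> R) = fine (sg A).
Proof. by move=> mA; rewrite /sint /Rintegral integral_indic// setIT. Qed.

Definition cos_sum s x : R := \sum_(t <- s) cos (t * x).

Lemma bmeas1_cos_sum s : bmeas1 (cos_sum s).
Proof.
elim: s => [|t s IH].
  by rewrite /cos_sum; under eq_fun do rewrite big_nil; exact: bmeas1_cst.
by rewrite /cos_sum; under eq_fun do rewrite big_cons; apply: bmeas1D => //; exact: bmeas1_cos.
Qed.

Lemma sint_cos_sum s : sint (cos_sum s) = \sum_(t <- s) c t.
Proof.
elim: s => [|t s IH].
  by rewrite /cos_sum; under eq_fun do rewrite big_nil; rewrite sint_cst mul0r big_nil.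
rewrite /cos_sum; under eq_fun do rewrite big_cons; rewrite sintD; last exact: bmeas1_cos_sum.
  by rewrite big_cons sint_cos IH.
exact: bmeas1_cos.
Qed.

Lemma sint_cosM t s : 2 * sint (fun x => cos (t * x) * cos_sum s x) =
  \sum_(u <- s) (c (t + u) + c (t - u)).
Proof.
have bt := bmeas1_cos t.
elim: s => [|u s IH].
  rewrite /cos_sum; under eq_fun do rewrite big_nil mulr0; rewrite sint_cst big_nil; ring.
rewrite big_cons -IH -!sint_cos.
rewrite (_ : (fun x => cos (t * x) * cos_sum (u :: s) x) = fun x =>
  2^-1 * (cos ((t + u) * x) + cos ((t - u) * x)) + cos (t * x) * cos_sum s x); last first.
  apply/funext => x; rewrite /cos_sum big_cons mulrDl mulrBl cosD cosB.
  by move: (\sum_(_ <- _) _) => y; field.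
have b2 : bmeas1 (fun x => cos ((t + u) * x) + cos ((t - u) * x)).
  by apply: bmeas1D; exact: bmeas1_cos.
rewrite sintD; last 2 first.
- by apply: bmeas1M => //; exact: bmeas1_cst.
- by apply: bmeas1M => //; exact: bmeas1_cos_sum.
by rewrite sintZ// sintD; [field|exact: bmeas1_cos|exact: bmeas1_cos].
Qed.

(** The product formula turns the cross terms into values of [c] at [t + u] and at [t - u], which is
    why both are assumed small. *)
Lemma sint_cos_sum_sqr (d : R) s : 0 <= d ->
  pairwise (fun t u => (`|c (t + u)| <= d) && (`|c (t - u)| <= d)) s ->
  sint (fun x => cos_sum s x ^+ 2) <= (size s)%:R * c 0 + (size s)%:R * (size s)%:R * d.
Proof.
move=> d0; elim: s => [|t s IH] /=.
  move=> _; rewrite /cos_sum; under eq_fun do rewrite big_nil expr0n/=.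
  by rewrite sint_cst !mul0r addr0.
move=> /andP[ht /IH {}IH].
have bt := bmeas1_cos t; have bs := bmeas1_cos_sum s.
have b1 : bmeas1 (fun x => cos (t * x) * cos (t * x)) by exact: bmeas1M.
have b2 : bmeas1 (fun x => 2 * (cos (t * x) * cos_sum s x)).
  by apply: bmeas1M; [exact: bmeas1_cst|exact: bmeas1M].
have b3 : bmeas1 (fun x => cos_sum s x ^+ 2).
  by under eq_fun do rewrite expr2; exact: bmeas1M.
rewrite (_ : (fun x => cos_sum (t :: s) x ^+ 2) = fun x =>
  cos (t * x) * cos (t * x) + (2 * (cos (t * x) * cos_sum s x) + cos_sum s x ^+ 2)); last first.
  by apply/funext => x; rewrite /cos_sum big_cons; move: (\sum_(_ <- _) _) => y; ring.
rewrite sintD//; last exact: bmeas1D.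
rewrite sintD// sintZ; last exact: bmeas1M.
rewrite sint_cosM.
have h1 : sint (fun x => cos (t * x) * cos (t * x)) <= c 0.
  rewrite -[leRHS]mul1r -sint_cst; apply: (sint_le b1 (bmeas1_cst 1)) => x.
  have := cos2Dsin2 (t * x); have := sqr_ge0 (sin (t * x)).
  by rewrite -expr2; move: (cos _ ^+ 2) (sin _ ^+ 2) => y z; lra.
have h2 : \sum_(u <- s) (c (t + u) + c (t - u)) <= (size s)%:R * (2 * d).
  rewrite -sum1_size natr_sum mulr_suml big_seq [leRHS]big_seq; apply: ler_sum => u us.
  have /andP[] := allP ht u us; rewrite !ler_norml => /andP[_ ?] /andP[_ ?]; lra.
rewrite -[(size s).+1%:R]natr1.
have S0 : 0 <= (size s)%:R :> R by [].
move: h1 h2 IH S0; move: ((size s)%:R : R) => n; move: (sint _) (\sum_(_ <- _) _) (sint _) => x y z.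
have -> : (n + 1) * c 0 + (n + 1) * (n + 1) * d = c 0 + (n * (2 * d) + (n * c 0 + n * n * d)) + d by ring.
by lra.
Qed.

Lemma sint_markov A (v : R -> R) (a : R) : measurable A -> bmeas1 v -> 0 < a ->
  (forall x, 0 <= v x) -> (forall x, A x -> a <= v x) -> (sg A <= (sint v / a)%:E)%E.
Proof.
move=> mA bv a0 v0 av.
have sA : (sg A \is a fin_num).
  rewrite ge0_fin_numE//; apply: le_lt_trans sfin; apply: le_measure; rewrite ?inE//.
rewrite -[leLHS]fineK// lee_fin ler_pdivlMr// mulrC -sint_indic// -sintZ; last exact: bmeas1_indic.
apply: sint_le => //; first by apply: bmeas1M; [exact: bmeas1_cst|exact: bmeas1_indic].
move=> x; rewrite indicE; have [xA|xA] := boolP (x \in A); last by rewrite mulr0.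
by rewrite mulr1; apply: av; exact: set_mem.
Qed.

End FiniteMeasure.

(* Averages of the functions [cos (t x)] over well-spread times [t] are close to 1 in
   the mean for the first measure and to 0 in square mean for the second. *)
Lemma spectral_separation sg1 sg2 (c1 c2 : R -> R) (tk : nat -> R) :
  (sg1 setT < +oo)%E -> (sg2 setT < +oo)%E ->
  (forall t, (\int[sg1]_x (cos (t * x))%:E = (c1 t)%:E)%E) ->
  (forall t, (\int[sg2]_x (cos (t * x))%:E = (c2 t)%:E)%E) ->
  (fun k => c1 (tk k)) @ \oo --> c1 0 ->
  (forall u, (fun k => c2 (tk k + u)) @ \oo --> (0 : R)) ->
  mutually_singular sg1 sg2.
Proof.
move=> fin1 fin2 hc1 hc2 h1 h2; apply: mutually_singular_approx => e e0.
pose d := e / 8; have d0 : 0 < d by rewrite divr_gt0.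
have times J : exists s, [/\ size s = J, all (fun t => c1 0 - c1 t <= d) s &
    pairwise (fun t u => (`|c2 (t + u)| <= d) && (`|c2 (t - u)| <= d)) s].
  elim: J => [|J [s [sJ s1 s2]]]; first by exists [::].
  have [N hN] : exists N, forall k, (N <= k)%N ->
      all (fun u => (`|c2 (tk k + u)| <= d) && (`|c2 (tk k - u)| <= d)) s.
    move=> {sJ s1 s2}; elim: s => [|u s [N hN]]; first by exists 0%N.
    have /cvgrPdist_le/(_ _ d0)[N1 _ hN1] := h2 u.
    have /cvgrPdist_le/(_ _ d0)[N2 _ hN2] := h2 (- u).
    exists (maxn N (maxn N1 N2)) => k; rewrite !geq_max /= => /and3P[/hN -> /hN1 i1 /hN2 i2].
    by move: i1 i2; rewrite /= !sub0r !normrN => -> ->.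
  have /cvgrPdist_le/(_ _ d0)[N1 _ hN1] := h1.
  exists (tk (maxn N N1) :: s); rewrite /= sJ s1 s2 hN ?leq_maxl//; split => //.
  rewrite andbT; apply: le_trans (hN1 _ (leq_maxr _ _)); exact: ler_norm.
pose J := (Num.truncn (8 * c2 0 / e)).+1.
have J0 : 0 < J%:R :> R by rewrite ltr0n.
have hJ : 8 * c2 0 <= e * J%:R.
  by have := truncnS_gt (8 * c2 0 / e); rewrite -/J ltr_pdivrMr// [J%:R * e]mulrC => /ltW.
have [s [sJ s1 s2]] := times J.
have bE := bmeas1_cos_sum s.
(* The mean of the cosines is near [1] for [sg1] and near [0] for [sg2]. With the threshold [1 / 2],
   Markov's inequality gives the bounds [2 * d] and [4 * c2 0 / J + 4 * d], both at most [e]. *)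
pose A := [set x | cos_sum s x < J%:R / 2].
have mA : measurable A.
  have := bE.1 measurableT `]-oo, (J%:R / 2)[%classic (measurable_itv _); rewrite setTI.
  by rewrite (_ : _ @^-1` _ = A)//; apply/seteqP; split => x /=; rewrite in_itv.
have J2 : 0 < J%:R / 2 :> R by rewrite divr_gt0.
have ecs x : cos_sum s x <= J%:R.
  rewrite -sJ -sum1_size natr_sum; apply: ler_sum => t _; exact: cos_le1.
exists A; split => //.
- have b1 : bmeas1 (fun x => J%:R + -1 * cos_sum s x).
    by apply: bmeas1D; [exact: bmeas1_cst|apply: bmeas1M => //; exact: bmeas1_cst].
  apply: (le_trans (sint_markov fin1 mA b1 J2 _ _)).
  + by move=> x; have := ecs x; lra.
  + by move=> x /=; rewrite /A/=; lra.
  rewrite lee_fin ler_pdivrMr//.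
  rewrite sintD//; last 2 first.
    exact: bmeas1_cst.
    by apply: bmeas1M => //; exact: bmeas1_cst.
  rewrite (sint_cst fin1 hc1) sintZ// (sint_cos_sum fin1 hc1) mulN1r.
  have : J%:R * c1 0 - \sum_(t <- s) c1 t <= J%:R * d.
    rewrite -sJ -sum1_size natr_sum !mulr_suml -sumrB big_seq [leRHS]big_seq.
    by apply: ler_sum => t ts; rewrite !mul1r; exact: (allP s1).
  by move: J0; rewrite /d; move: (J%:R : R) (\sum_(_ <- _) _) (c1 0) => j y z; nra.
- have b2 : bmeas1 (fun x => cos_sum s x ^+ 2) by under eq_fun do rewrite expr2; exact: bmeas1M.
  have J4 : 0 < (J%:R / 2) ^+ 2 :> R by rewrite exprn_gt0.
  apply: (le_trans (sint_markov fin2 (measurableC mA) b2 J4 _ _)).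
  + by move=> x; exact: sqr_ge0.
  + move=> x /= /negP; rewrite /A/= -leNgt => hx.
    by rewrite lerXn2r// nnegrE; [exact: ltW|exact: le_trans (ltW J2) hx].
  rewrite lee_fin ler_pdivrMr//.
  apply: (le_trans (sint_cos_sum_sqr fin2 hc2 (ltW d0) s2)); rewrite sJ /d.
  by move: J0 hJ; move: (J%:R : R) (c2 0) => j y j0 hj; nra.
Qed.

End Separation.

(** * Rigid times and continuity in the angle *)

Section RigidTimes.
Context {R : realType} (f : R -> R) (m0 M0 Cf : R) (rf : roof f m0 M0 Cf).
Local Notation mu := (@vol R).
Local Notation X := (phase f).
Local Notation sqint := (@sq_integrable _ (plane R) R mu X).
Local Notation nrm := (@norm2 _ (plane R) R mu X).
Local Notation sqn := (@sqnorm _ (plane R) R mu X).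
Local Notation ip := (@inner _ (plane R) R mu X).
Local Notation one := (fun _ : R * R => 1 : R).
Local Notation koop := (koopman f).
Local Notation correl := (correlation f).

Let mX : measurable (X : set (plane R)). Proof. exact: (phase_measurable rf). Qed.
Let finX : (mu X < +oo)%E. Proof. exact: (phase_lty rf). Qed.

Let sqn_koopB gam t g : sqint g ->
  sqn (fun p => koop gam t g p - g p) = 2 * (ip g g - ip (koop gam t g) g).
Proof.
move=> sg; have sk := sqint_koop rf gam t sg.
rewrite (_ : (fun p => _) = fun p => -1 * g p + koop gam t g p); last first.
  by apply/funext => p; rewrite mulN1r addrC.
rewrite (sqnD mX)// (sqn_koop rf)// ipC /sqnorm; ring.
Qed.

(** Koopman operators being isometries, this amounts to convergence of the translates to [g] in norm
    ([sqn_koopB]); the inner product is the quantity that spectral measures see. *)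
Definition rigid_times gam (tk : nat -> R) := forall g, sqint g ->
  (fun k => ip (koop gam (tk k) g) g) @ \oo --> ip g g.

Lemma rigid_times_bump gam tk :
  (forall (a c : rat) (k : nat), let g := bump f (ratr a) (ratr c) k in
     (fun n => ip (koop gam (tk n) g) g) @ \oo --> ip g g) ->
  rigid_times gam tk.
Proof.
move=> hb.
have key : forall g, sqint g -> forall e : R, 0 < e ->
    exists N, forall n, (N <= n)%N -> nrm (fun p => koop gam (tk n) g p - g p) < e.
  apply: (sqint_ind_bump rf (P := fun g => forall e : R, 0 < e ->
    exists N, forall n, (N <= n)%N -> nrm (fun p => koop gam (tk n) g p - g p) < e)).
  - move=> c g h sg sh Pg Ph e e0.
    have c1 : 0 < `|c| + 1 by have := normr_ge0 c; lra.
    have e1 : 0 < e / 2 / (`|c| + 1) by rewrite divr_gt0//; lra.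
    have e2 : 0 < e / 2 by lra.
    have [N hN] := Pg _ e1; have [N' hN'] := Ph _ e2.
    exists (maxn N N') => n; rewrite geq_max => /andP[/hN h1 /hN' h2].
    have s1 := sqintB mX (sqint_koop rf gam (tk n) sg) sg.
    have s2 := sqintB mX (sqint_koop rf gam (tk n) sh) sh.
    rewrite (_ : (fun p => _ - _) = fun p => c * (koop gam (tk n) g p - g p) + (koop gam (tk n) h p - h p)); last first.
      by apply/funext => p; rewrite /koopman; ring.
    apply: (le_lt_trans (nrmD rf c s1 s2)).
    have h3 : `|c| * nrm (fun p => koop gam (tk n) g p - g p) <= e / 2.
      apply: (@le_trans _ _ ((`|c| + 1) * (e / 2 / (`|c| + 1)))).
        by apply: ler_pM; rewrite ?nrm_ge0 ?(ltW h1)// lerDl.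
      by rewrite mulrC divfK// gt_eqF.
    by rewrite [ltRHS]splitr ler_ltD.
  - move=> g phi sg sphi Pphi hphi e e0.
    have e3 : 0 < e / 3 by lra.
    have [m hm] := nrm_cvg0 hphi e3.
    have [N hN] := Pphi m _ e3; exists N => n /hN hs.
    have sB := sqintB mX sg (sphi m).
    have s1 := sqint_koop rf gam (tk n) sB.
    have s2 := sqintB mX (sqint_koop rf gam (tk n) (sphi m)) (sphi m).
    rewrite (_ : (fun p => _ - _) = fun p => 1 * koop gam (tk n) (fun p => g p - phi m p) p +
      (-1 * (g p - phi m p) + (koop gam (tk n) (phi m) p - phi m p))); last first.
      by apply/funext => p; rewrite /koopman; ring.
    apply: (le_lt_trans (nrmD rf 1 s1 (sqintD mX (-1) sB s2))).
    have := nrmD rf (-1) sB s2.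
    rewrite (nrm_koop rf)// normrN normr1 !mul1r; move: hm hs.
    by move: (nrm _) (nrm _) (nrm _) => ? ? ? ? ?; lra.
  - move=> a c k e e0; set g := bump f _ _ _.
    have sg : sqint g := nice_sqint rf (bump_nice rf _ _ _) (bump_measurable rf _ _ _).
    have e2 : 0 < e ^+ 2 / 2 by rewrite divr_gt0// exprn_gt0.
    have /cvgrPdist_lt/(_ _ e2)[N _ hN] := hb a c k.
    exists N => n /hN; rewrite /= -/g => hn.
    rewrite -(@ltr_pXn2r _ 2)// ?nnegrE ?nrm_ge0 ?(ltW e0)// nrm_sqr sqn_koopB//.
    by have := le_lt_trans (ler_norm _) hn; lra.
move=> g sg; apply/cvgrPdist_lt => e e0.
have h1 : 0 < nrm g + 1 by rewrite ltr_wpDl// nrm_ge0.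
have e1 : 0 < e / (nrm g + 1) by rewrite divr_gt0.
have [N hN] := key g sg _ e1; exists N => // n /= /hN.
rewrite ltr_pdivlMr// => hn; have sk := sqint_koop rf gam (tk n) sg.
rewrite distrC -(ipBl mX)//; apply: le_lt_trans hn.
apply: (le_trans (ip_le_nrm mX (sqintB mX sk sg) sg)).
by rewrite ler_wpM2l ?nrm_ge0// lerDl.
Qed.

Let sqint_L2_0 g : L2_0 f g -> sqint g /\ ip g one = 0.
Proof.
move=> [mg ig i0]; split; first by split; [exact: mg|exact: ig].
by rewrite /inner; under eq_Rintegral do rewrite mulr1; exact: i0.
Qed.

Let corrE gam g t : corr gam f g t = ip (koop gam t g) g / area f.
Proof. by []. Qed.

(** The cosine transform of a spectral measure is the autocorrelation divided by the area. Along
    [tk] it tends to its value at [0] for the first flow and, with any fixed lag [u], to [0] for the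
    second, as [spectral_separation] requires. *)
Lemma spectrally_orthogonal_times a b tk : rigid_times a tk -> mixing_times f b tk ->
  spectrally_orthogonal a f b f.
Proof.
move=> rig [_ mix] g1 g2 /sqint_L2_0[s1 _] /sqint_L2_0[s2 z2] sg1 sg2 [fin1 h1] [fin2 h2].
have V0 := area_gt0 rf.
apply: (spectral_separation fin1 fin2 (fun t => (h1 t).1) (fun t => (h2 t).1) (tk := tk)).
- rewrite corrE; under eq_fun do rewrite corrE.
  apply: cvgMl; rewrite (_ : ip (koop a 0 g1) g1 = ip g1 g1); first exact: rig.
  by apply: ip_eq => // p /set_mem Xp; exact: (koop0 rf a g1 Xp).
- move=> u; have m := mix _ _ (sqint_koop rf b u s2) s2.
  have : (fun k => correl b (tk k) (koop b u g2) g2 / area f) @ \oo --> 0 / area f.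
    by apply: cvgMl; exact: m.
  rewrite mul0r (_ : (fun k => _ / area f) = fun k => corr b f g2 (tk k + u))//.
  by apply/funext => k; rewrite (correl_koopl rf)// corrE /correlation z2 !mul0r subr0.
Qed.

(** At a fixed time the heights stay bounded, so [lift_lip_x] gives a Lipschitz bound in the angle,
    uniform on the phase space. Openness of the conditions on the angle comes from here. *)
Lemma koop_angle_continuous g h L t : nice f L g -> measurable_fun [set: plane R] g -> sqint h ->
  continuous (fun gam : R => ip (koop gam t g) h : R).
Proof.
move=> ng mg sh gam; have sg := nice_sqint rf ng mg.
have [K K0 hK] := lift_lip_x rf ng (M0 + `|t|).
pose B := K * Num.sqrt (area f) * nrm h.
have B0 : 0 <= B by rewrite !mulr_ge0 ?nrm_ge0.
apply/cvgrPdist_lt => e e0; exists (e / (B + 1)) => /=; first by rewrite divr_gt0// ltr_wpDl.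
move=> gam' /=; rewrite ltr_pdivlMr; last by rewrite ltr_wpDl.
move=> hd; have sk := sqint_koop rf gam t sg; have sk' := sqint_koop rf gam' t sg.
rewrite -(ipBl mX)//; apply: (le_lt_trans (ip_le_nrm mX (sqintB mX sk sk') sh)).
have pt p : X p -> `|koop gam t g p - koop gam' t g p| <= K * `|gam - gam'|.
  move=> [/= _ /andP[p2 pf]]; rewrite /koopman !(sflowE f _ t p).
  have := hK gam' gam p.1 p.1 (p.2 + t); rewrite subrr normr0 add0r; apply.
  apply: (le_trans (ler_normD _ _)); rewrite lerD2r ger0_norm//.
  by apply: le_trans (roof_le rf p.1); exact: ltW.
have : nrm (fun p => koop gam t g p - koop gam' t g p) <= K * `|gam - gam'| * Num.sqrt (area f).
  have Kd : 0 <= K * `|gam - gam'| by rewrite mulr_ge0.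
  rewrite -[X in X * _](@ger0_norm _ (K * `|gam - gam'|))// -sqrtr_sqr -sqrtrM ?sqr_ge0//.
  apply: ler_wsqrtr; apply: (sqn_bounded mX finX) => //.
  by apply: measurable_funB; [exact: sk.1|exact: sk'.1].
move=> hn; apply: le_lt_trans hd.
apply: (@le_trans _ _ (K * `|gam - gam'| * Num.sqrt (area f) * nrm h)).
  by rewrite ler_wpM2r// nrm_ge0.
rewrite (_ : _ * nrm h = `|gam - gam'| * B); last by rewrite /B; ring.
by rewrite ler_wpM2l// lerDl.
Qed.

End RigidTimes.

(** * The generic set of angles *)

Lemma roof_exists {R : realType} (f : R -> R) :
  periodic1 f -> (forall x, 0 < f x) -> real_analytic f ->
  exists m0 M0 C, [/\ roof f m0 M0 C, 0 < C, periodic1 (derive1 f), real_analytic (derive1 f) &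
    forall x h, `|f (x + h) - f x - h * derive1 f x| <= C * h ^+ 2].
Proof.
move=> pf f0 af; have cf := real_analytic_continuous af.
have [m0 m00 fm] := periodic1_min pf cf f0.
have [M0 fM] := periodic1_bounded pf cf.
have [C [C0 pd ad lf [_ tf]]] := real_analytic_taylor2 pf af.
exists m0, M0, C; split=> //; split=> // x.
by have := fM x; rewrite gtr0_norm.
Qed.

Lemma near_forall_ord {T : topologicalType} (x : T) n (P : nat -> nat -> T -> Prop) :
  (forall i j, (i < n)%N -> (j < n)%N -> \forall y \near x, P i j y) ->
  \forall y \near x, forall i j, (i < n)%N -> (j < n)%N -> P i j y.
Proof.
move=> h.
have : \forall y \near x, forall i j : 'I_n, P i j y.
  have FF : Filter (nbhs x) by exact: _.
  refine (@filter_forall T _ (fun i : 'I_n => [set y | forall j : 'I_n, P i j y]) (nbhs x) FF _) => i.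
  refine (@filter_forall T _ (fun j : 'I_n => P i j) (nbhs x) FF _) => j.
  exact: h.
apply: filterS => y hy i j ni nj; exact: (hy (Ordinal ni) (Ordinal nj)).
Qed.

Lemma dense_itv {R : realType} (S : set R) :
  (forall lo hi, lo < hi -> exists2 a, lo < a < hi & S a) -> dense S.
Proof.
move=> h O [x Ox] oO; have /nbhs_ballP[r /= r0 hr] := open_nbhs_nbhs (conj oO Ox).
have lohi : x - r < x + r by lra.
have [a /andP[a1 a2] Sa] := h _ _ lohi.
exists a; split=> //; apply: hr; rewrite /ball/= ltr_distl; lra.
Qed.

Lemma cvg_dist_harmonic {R : realType} (phi : nat -> R) (l : R) (N : nat) :
  (forall n, (N <= n)%N -> `|phi n - l| < n.+1%:R^-1) -> phi @ \oo --> l.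
Proof.
move=> h; apply/cvgrPdist_lt => e e0; exists (maxn N (Num.truncn e^-1)) => // n /=.
rewrite geq_max => /andP[/h hn en]; rewrite distrC; apply: (lt_trans hn).
rewrite -[ltRHS]invrK ltf_pV2 ?posrE ?invr_gt0//.
by apply: (lt_le_trans (truncnS_gt _)); rewrite ler_nat ltnS.
Qed.

Theorem theorem1p1 (R : realType) (beta : R) (f : R -> R) :
  liouville beta ->
  periodic1 f -> (forall x, 0 < f x) -> real_analytic f ->
  weak_mixing beta f ->
  exists S : set R, [/\ dense S, Gdelta S &
    forall alpha : R, S alpha ->
      [/\ irrational alpha, weak_mixing alpha f &
          spectrally_orthogonal alpha f beta f]].
Proof.
move=> [ib _] pf f0 af wm.
have [m0 [M0 [C [rf C0 pd ad tf]]]] := roof_exists pf f0 af.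
(* Enumerates the test functions with rational parameters; codes of no triple give [bump f 0 0 0], a
   function of the same family. *)
pose G n : R * R -> R := if unpickle n is Some (a, c, k)
  then bump f (ratr (a : rat)) (ratr (c : rat)) (k : nat) else bump f 0 0 0.
pose ix (a c : rat) (k : nat) : nat := pickle (a, c, k).
have Gix a c k : G (ix a c k) = bump f (ratr a) (ratr c) k by rewrite /G pickleK.
have Gbump n : exists a c k, G n = bump f a c k.
  by rewrite /G; case: unpickle => [[[a c] k]|]; do 3 eexists.
have mG n : measurable_fun [set: plane R] (G n).
  by have [a [c [k ->]]] := Gbump n; exact: (bump_measurable rf).
have nG n : exists L, nice f L (G n).
  by have [a [c [k ->]]] := Gbump n; exists (k%:R * (1 + C)); exact: (bump_nice rf).
have pG n p : 0 <= G n p.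
  have [a [c [k ->]]] := Gbump n.
  by rewrite /bump le_min ler01/= mulr_ge0// le_min tent_ge0 height_ge0.
have sG n : sq_integrable (@vol R) (phase f) (G n).
  by have [L nL] := nG n; exact: (nice_sqint rf nL (mG n)).
pose ipX := @inner _ (plane R) R (@vol R) (phase f).
(* The [n]-th condition involves the first [n] test functions and the error [1 / (n + 1)], so that
   times chosen for each [n] work in the limit for every test function. *)
pose U n := [set a : R | exists2 t, 0 <= t & forall i j, (i < n)%N -> (j < n)%N ->
  `|correlation f a t (G i) (G j)| < n.+1%:R^-1].
pose V n := [set a : R | exists2 t, 0 <= t & forall i j, (i < n)%N -> (j < n)%N ->
  `|ipX (koopman f a t (G i)) (G i) - ipX (G i) (G i)| < n.+1%:R^-1 /\
  `|correlation f beta t (G i) (G j)| < n.+1%:R^-1].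
have n0 n : 0 < n.+1%:R^-1 :> R by rewrite invr_gt0.
have cG i j t : continuous (fun a : R => ipX (koopman f a t (G i)) (G j) : R).
  by have [L nL] := nG i; exact: (koop_angle_continuous rf nL (mG i) (sG j)).
have oU n : open (U n).
  rewrite openE => a [t t0 h]; rewrite /interior.
  have : \forall a' \near a, forall i j, (i < n)%N -> (j < n)%N ->
      `|correlation f a' t (G i) (G j)| < n.+1%:R^-1.
    apply: near_forall_ord => i j ni nj.
    have cc : (fun a' => `|correlation f a' t (G i) (G j)|) @ a --> `|correlation f a t (G i) (G j)|.
      by apply: cvg_norm; apply: cvgB; [exact: cG|exact: cvg_cst].
    exact: (cvgr_lt _ cc _ (h i j ni nj)).
  by apply: filterS => a' ha; exists t.
have oV n : open (V n).
  rewrite openE => a [t t0 h]; rewrite /interior.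
  have : \forall a' \near a, forall i j, (i < n)%N -> (j < n)%N ->
      `|ipX (koopman f a' t (G i)) (G i) - ipX (G i) (G i)| < n.+1%:R^-1.
    apply: near_forall_ord => i j ni nj.
    have cc : (fun a' => `|ipX (koopman f a' t (G i)) (G i) - ipX (G i) (G i)|) @ a -->
        `|ipX (koopman f a t (G i)) (G i) - ipX (G i) (G i)|.
      by apply: cvg_norm; apply: cvgB; [exact: cG|exact: cvg_cst].
    exact: (cvgr_lt _ cc _ (h i j ni nj).1).
  apply: filterS => a' ha; exists t => // i j ni nj.
  by split; [exact: (ha i j)|exact: (h i j ni nj).2].
have dU n : dense (U n).
  apply: dense_itv => lo hi lohi.
  have [a [t [aI t0 h]]] := mixing_dense rf C0 tf af pd ad n ib wm mG pG nG (n0 n) lohi.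
  by exists a => //; exists t.
have dV n : dense (V n).
  apply: dense_itv => lo hi lohi.
  have [a [t [aI t0 h]]] := rigid_dense rf C0 tf n wm (fun i => conj (mG i) (nG i)) (n0 n) lohi.
  by exists a => //; exists t.
(* The irrational angles are themselves a countable intersection of dense open sets, which joins the
   other conditions. *)
have [F hF FE] := @irrational_Gdelta R.
pose W n := F n `&` (U n `&` V n).
have hW n : open (W n) /\ dense (W n).
  have [oF dF] := hF n; split; first by apply: openI => //; exact: openI.
  by apply: denseI => //; exact: denseI.
exists (\bigcap_n W n); split.
- exact: Baire.
- by exists W => // n; have [] := hW n.
move=> a Wa; split.
- by rewrite FE => n _; have [] := Wa n I.
- have Ua n : exists t : R, 0 <= t /\ forall i j, (i < n)%N -> (j < n)%N ->
      `|correlation f a t (G i) (G j)| < n.+1%:R^-1.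
    by have [_ [[t t0 h] _]] := Wa n I; exists t.
  have [tk htk] := choice Ua.
  apply: (mixing_times_weak_mixing rf (tk := tk)).
  apply: (mixing_times_bump rf) => [n|x y x' y' k k']; first by have [] := htk n.
  rewrite -!Gix; apply: (cvg_dist_harmonic (N := (maxn (ix x y k) (ix x' y' k')).+1)) => n.
  by rewrite gtn_max subr0 => /andP[i1 i2]; exact: (htk n).2.
- have Va n : exists t : R, 0 <= t /\ forall i j, (i < n)%N -> (j < n)%N ->
      `|ipX (koopman f a t (G i)) (G i) - ipX (G i) (G i)| < n.+1%:R^-1 /\
      `|correlation f beta t (G i) (G j)| < n.+1%:R^-1.
    by have [_ [_ [t t0 h]]] := Wa n I; exists t.
  have [tk htk] := choice Va.
  apply: (spectrally_orthogonal_times rf (tk := tk)).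
    apply: (rigid_times_bump rf) => x y k /=; rewrite -Gix -/ipX; set i := ix x y k.
    apply: (cvg_dist_harmonic (N := i.+1)) => n i1.
    by have [] := (htk n).2 i i i1 i1.
  apply: (mixing_times_bump rf) => [n|x y x' y' k k']; first by have [] := htk n.
  rewrite -!Gix; apply: (cvg_dist_harmonic (N := (maxn (ix x y k) (ix x' y' k')).+1)) => n.
  by rewrite gtn_max subr0 => /andP[i1 i2]; have [] := (htk n).2 _ _ i1 i2.
Qed.
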